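(* Let $\theta,\alpha$ be inner functions, let $(A_{2+},B_{2+})\in \mathrm{CP}^+$ and $(A_{1-},B_{1-})\in\mathrm{CP}^-$ with $B_{2+}\not\equiv0$, $B_{1-}\not\equiv 0$, and suppose that $$\phi=\overline{\theta}\,\frac{A_{1-}}{B_{1-}}-\alpha\,\frac{A_{2+}}{B_{2+}}\in L^\infty.$$ Suppose that $$\mathcal S:=\left(\alpha\begin{bmatrix}1&\frac{A_{2+}}{B_{2+}}\end{bmatrix}(H^2_+)^2\right)\cap\left(\begin{bmatrix}1&\frac{A_{1-}}{B_{1-}}\end{bmatrix}(H^2_-)^2\right)=\{0\}.$$ Then $\ker A^{\theta,\alpha}_\phi$ does not depend on $\alpha$, and we have $$\ker A^{\theta,\alpha}_\phi=B_{2+}\,\ker^+ S_{\overline\theta B_{2+},\,-B_{1-}}.$$ Further, if $\overline{B_{1-}}=I_1O_1$ and $B_{2+}=I_2O_2$ are inner--outer factorizations ($I_1,I_2$ inner, $O_1,O_2$ outer) with $O_1,O_2\in\mathcal G H^\infty$, then $$\ker A^{\theta,\alpha}_\phi=I_2\,\ker T_{\overline\theta(I_1I_2)}.$$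
   Context: $\mathbb T$ is the unit circle, $\mathbb D$ the unit disc, $L^2=L^2(\mathbb T)$, $L^\infty=L^\infty(\mathbb T)$. $H^2_+=H^2(\mathbb D)$ (as a subspace of $L^2$ via boundary values), $H^2_-=L^2\ominus H^2_+=\overline{H^2_0}$, with orthogonal projections $P^\pm$ of $L^2$ onto $H^2_\pm$. $H^\infty$ is the algebra of bounded analytic functions on $\mathbb D$ (identified with boundary functions), $\overline{H^\infty}$ the set of conjugates of its elements, $\mathcal G H^\infty$ the group of invertible elements of $H^\infty$. $\mathrm{CP}^+$ is the set of corona pairs: pairs $(f_1,f_2)\in (H^\infty)^2$ for which there are $\tilde f_1,\tilde f_2\in H^\infty$ with $f_1\tilde f_1+f_2\tilde f_2=1$; $\mathrm{CP}^-$ is defined likewise with $\overline{H^\infty}$ in place of $H^\infty$. For an inner function $\theta$, $K_\theta=H^2_+\ominus\theta H^2_+$ is the model space and $P_\theta$ the orthogonal projection of $L^2$ onto $K_\theta$. The asymmetric truncated Toeplitz operator is $A^{\theta,\alpha}_\phi:K_\theta\to K_\alpha$, $A^{\theta,\alpha}_\phi=P_\alpha\phi P_\theta|_{K_\theta}$. Row vectors times $(H^2_\pm)^2$ denote sets of measurable functions on $\mathbb T$: $\mathcal S$ is the set of functions that can be written both as $\alpha(\phi_{1+}+\frac{A_{2+}}{B_{2+}}\phi_{2+})$ with $\phi_{1+},\phi_{2+}\in H^2_+$ and as $\phi_{1-}+\frac{A_{1-}}{B_{1-}}\phi_{2-}$ with $\phi_{1-},\phi_{2-}\in H^2_-$.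 For $a,b\in L^\infty$, $S_{a,b}:L^2\to L^2$ is $S_{a,b}\phi=aP^+\phi+bP^-\phi$ and $\ker^+S_{a,b}:=P^+\ker S_{a,b}$, i.e. $\phi_+\in\ker^+S_{a,b}$ iff $\phi_+\in H^2_+$ and there is $\phi_-\in H^2_-$ with $a\phi_++b\phi_-=0$. For $g\in L^\infty$, $T_g:H^2_+\to H^2_+$, $T_g\phi=P^+(g\phi)$, is the Toeplitz operator. ''Does not depend on $\alpha$'' means that, among inner functions $\alpha$ satisfying the hypotheses with $\theta,A_{1-},B_{1-},A_{2+},B_{2+}$ fixed, the kernel is the same. *)

(* Defs.v *)
From HB Require Import structures.
From mathcomp Require Import all_boot all_order all_algebra.
From mathcomp Require Import complex.
From mathcomp Require Import all_classical all_reals all_analysis.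

Set Implicit Arguments.
Unset Strict Implicit.
Unset Printing Implicit Defensive.

Import Order.TTheory GRing.Theory Num.Theory.
Import numFieldNormedType.Exports.
Import Normc.

Local Open Scope classical_set_scope.
Local Open Scope ring_scope.
Local Open Scope complex_scope.

(* A function on the unit circle T is a total function R[i] -> R[i], of which
   only the restriction to T matters; T is parametrized bijectively by
   t |-> exp(it) on [0, 2pi[, and its normalized arc length is dt / (2pi).
   Classes modulo a.e. equality are not formed: each space of functions on T
   below is a set of (Borel) measurable functions that is saturated for a.e.
   equality, so equality of such sets is equality of the sets of classes. *)

Definition cis {R : realType} (t : R) : R[i] := cos t +i* sin t.

Definition arc {R : realType} : set R := `[0, 2 * pi[.

Definition aeT {R : realType} (P : R[i] -> Prop) : Prop :=
  {ae (@lebesgue_measure R), forall t, arc t -> P (cis t)}.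

Definition eqT {R : realType} (f g : R[i] -> R[i]) : Prop :=
  aeT (fun z => f z = g z).

Definition measT {R : realType} (f : R[i] -> R[i]) : Prop :=
  measurable_fun arc (fun t : R => complex.Re (f (cis t))) /\
  measurable_fun arc (fun t : R => complex.Im (f (cis t))).

Definition intT {R : realType} (f : R[i] -> R[i]) : R[i] :=
  ((2 * pi)^-1)%:C *
  (Rintegral lebesgue_measure arc (fun t : R => complex.Re (f (cis t))) +i*
   Rintegral lebesgue_measure arc (fun t : R => complex.Im (f (cis t)))).

Definition conjT {R : realType} (f : R[i] -> R[i]) : R[i] -> R[i] :=
  fun z => (f z)^*.

(* As x / 0 = 0, this is the quotient of functions wherever g is nonzero. *)
Definition divT {R : realType} (f g : R[i] -> R[i]) : R[i] -> R[i] :=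
  fun z => f z / g z.

Definition zeroT {R : realType} : set (R[i] -> R[i]) :=
  [set f | measT f /\ eqT f (cst 0)].

Definition L2T {R : realType} : set (R[i] -> R[i]) :=
  [set f | measT f /\
    (\int[@lebesgue_measure R]_(t in arc) (normc (f (cis t)) ^+ 2)%:E
      < +oo)%E].

Definition LinfT {R : realType} : set (R[i] -> R[i]) :=
  [set f | measT f /\ exists M : R, aeT (fun z => normc (f z) <= M)].

Definition dotT {R : realType} (f g : R[i] -> R[i]) : R[i] :=
  intT (f \* conjT g).

(* Analytic on the open unit disc: sum of a power series converging there
   (the topology of C is the one of the normed field R[i]^o). *)
Definition analyticD {R : realType} (F : R[i] -> R[i]) : Prop :=
  exists a : nat -> R[i], forall z : R[i], normc z < 1 ->
    series (fun k => a k * z ^+ k : R[i]^o) n @[n --> \oo] --> (F z : R[i]^o).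

Definition hardy2D {R : realType} : set (R[i] -> R[i]) :=
  [set F | analyticD F /\ exists M : R, forall r : R, 0 <= r < 1 ->
    (\int[@lebesgue_measure R]_(t in arc) (normc (F (r%:C * cis t)) ^+ 2)%:E
      <= M%:E)%E].

Definition hardyinfD {R : realType} : set (R[i] -> R[i]) :=
  [set F | analyticD F /\
    exists M : R, forall z : R[i], normc z < 1 -> normc (F z) <= M].

(* Radial limits a.e. *)
Definition boundary {R : realType} (F f : R[i] -> R[i]) : Prop :=
  aeT (fun z => (F (r%:C * z) : R[i]^o) @[r --> (1 : R)^'-] --> (f z : R[i]^o)).

Definition H2p {R : realType} : set (R[i] -> R[i]) :=
  [set f | L2T f /\ exists2 F, hardy2D F & boundary F f].

Definition ominus {R : realType} (M N : set (R[i] -> R[i])) :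
    set (R[i] -> R[i]) :=
  [set f | M f /\ forall g, N g -> dotT f g = 0].

Definition H2m {R : realType} : set (R[i] -> R[i]) := ominus L2T H2p.

Definition Hinf {R : realType} : set (R[i] -> R[i]) :=
  [set f | measT f /\ exists2 F, hardyinfD F & boundary F f].

Definition cHinf {R : realType} : set (R[i] -> R[i]) :=
  [set f | Hinf (conjT f)].

Definition GHinf {R : realType} : set (R[i] -> R[i]) :=
  [set f | Hinf f /\ exists2 g, Hinf g & eqT (f \* g) (cst 1)].

Definition corona {R : realType} (H : set (R[i] -> R[i]))
    (f1 f2 : R[i] -> R[i]) : Prop :=
  [/\ H f1, H f2 & exists g1 g2 : R[i] -> R[i],
    [/\ H g1, H g2 & eqT (f1 \* g1 \+ f2 \* g2) (cst 1)]].

Definition CPp {R : realType} (f1 f2 : R[i] -> R[i]) := corona Hinf f1 f2.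

Definition CPm {R : realType} (f1 f2 : R[i] -> R[i]) := corona cHinf f1 f2.

Definition inner {R : realType} (f : R[i] -> R[i]) : Prop :=
  Hinf f /\ aeT (fun z => normc (f z) = 1).

Definition cexp {R : realType} (z : R[i]) : R[i] :=
  (expR (complex.Re z))%:C * cis (complex.Im z).

(* f is the boundary function of
     F(z) = c exp(1/(2pi) int (w + z)/(w - z) k(w) |dw|),  |c| = 1,
   with k real and integrable; then k = log |f| a.e. *)
Definition outer {R : realType} (f : R[i] -> R[i]) : Prop :=
  measT f /\ exists (c : R[i]) (k : R[i] -> R),
    [/\ normc c = 1,
        lebesgue_measure.-integrable arc (fun t : R => (k (cis t))%:E) &
        boundary
          (fun z => c * cexp (intT (fun w => (w + z) / (w - z) * (k w)%:C)))
          f].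

(* f M, the products being taken in L^2 *)
Definition mulset {R : realType} (f : R[i] -> R[i])
    (M : set (R[i] -> R[i])) : set (R[i] -> R[i]) :=
  [set h | L2T h /\ exists2 g, M g & eqT h (f \* g)].

(* c [1 a] (M)^2, a set of measurable functions not required to lie in L^2 *)
Definition rowset {R : realType} (c a : R[i] -> R[i])
    (M : set (R[i] -> R[i])) : set (R[i] -> R[i]) :=
  [set h | measT h /\
    exists u v, [/\ M u, M v & eqT h (c \* (u \+ a \* v))]].

Definition modelK {R : realType} (theta : R[i] -> R[i]) :
    set (R[i] -> R[i]) :=
  ominus H2p (mulset theta H2p).

(* Orthogonal projection onto M: a representative of the a.e. class of the
   element of M characterized by f - g being orthogonal to M. *)
Definition proj {R : realType} (M : set (R[i] -> R[i]))
    (f : R[i] -> R[i]) : R[i] -> R[i] :=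
  xget (cst 0) [set g | M g /\ forall h, M h -> dotT (f \- g) h = 0].

Definition Pp {R : realType} (f : R[i] -> R[i]) := proj H2p f.

Definition Pm {R : realType} (f : R[i] -> R[i]) := proj H2m f.

Definition ATTO {R : realType} (theta alpha phi f : R[i] -> R[i]) :
    R[i] -> R[i] :=
  proj (modelK alpha) (phi \* proj (modelK theta) f).

Definition toeplitz {R : realType} (g f : R[i] -> R[i]) : R[i] -> R[i] :=
  Pp (g \* f).

Definition opS {R : realType} (a b f : R[i] -> R[i]) : R[i] -> R[i] :=
  a \* Pp f \+ b \* Pm f.

Definition kerT {R : realType} (D : set (R[i] -> R[i]))
    (A : (R[i] -> R[i]) -> R[i] -> R[i]) : set (R[i] -> R[i]) :=
  [set f | D f /\ eqT (A f) (cst 0)].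

Definition kerATTO {R : realType} (theta alpha phi : R[i] -> R[i]) :=
  kerT (modelK theta) (ATTO theta alpha phi).

Definition kertoeplitz {R : realType} (g : R[i] -> R[i]) :=
  kerT H2p (toeplitz g).

Definition kerSp {R : realType} (a b : R[i] -> R[i]) :
    set (R[i] -> R[i]) :=
  [set g | L2T g /\ exists2 f, kerT L2T (opS a b) f & eqT g (Pp f)].

Definition symbol {R : realType}
    (theta alpha A1 B1 A2 B2 : R[i] -> R[i]) : R[i] -> R[i] :=
  conjT theta \* divT A1 B1 \- alpha \* divT A2 B2.

Definition setS {R : realType} (alpha A1 B1 A2 B2 : R[i] -> R[i]) :
    set (R[i] -> R[i]) :=
  rowset alpha (divT A2 B2) H2p `&` rowset (cst 1) (divT A1 B1) H2m.

(* Main.v *)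
Require Import Defs.
From mathcomp Require Import all_boot all_order all_algebra.
From mathcomp Require Import complex.
From mathcomp Require Import all_classical all_reals all_analysis.
From mathcomp Require Import measurable_realfun.
From mathcomp Require Import ring lra.

(** The model space K_theta consists of the f in H^2_+ with conj(theta) f in
    H^2_- ([modelKP]), and the orthogonal complement of K_alpha in L^2 is
    H^2_- + alpha H^2_+ ([modelK_orthP]). So f in K_theta belongs to the kernel
    exactly when phi f = m + alpha p for some m in H^2_- and p in H^2_+. With
    phi = conj(theta) A1 / B1 - alpha A2 / B2 this reads
      alpha (p + (A2 / B2) f) = - m + (A1 / B1) conj(theta) f.
    The left side is of the first form that defines S and the right side of the
    second, so both vanish: p = - (A2 / B2) f and m = (A1 / B1) conj(theta) f.
    A corona relation A2 c + B2 d = 1 then gives f = B2 (d f - c p), a product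
    of B2 with a function of H^2_+; likewise conj(theta) f is the product of B1
    with a function of H^2_- ([kerATTO_sub]). Conversely every f of this kind is
    in the kernel ([kerATTO_sup]). The pair of conditions f = B2 g and
    conj(theta) f = B1 h says that f is in B2 ker^+ S, and alpha has disappeared
    from it. If B2 = I2 O2 and conj(B1) = I1 O1 with invertible outer factors,
    then O2 and conj(O1) are absorbed by g and h ([kerATTOE_outer]).

    The function theory behind this argument is: the orthogonal projections onto
    H^2_+ and K_theta exist, H^infinity multiplies H^2_+ into itself, and a
    nonzero function of H^infinity is nonzero almost everywhere, so that one may
    divide by B1 and B2.

    As H^2_+ is defined by radial limits, the first two facts rest on the
    description of H^2_+ as the set of L^2 limits of analytic polynomials
    ([H2pP]). It is obtained from the Riesz-Fischer theorem ([RieszFischer]) and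
    from Fatou's theorem on the radial limits of Cauchy integrals
    ([boundary_Cauchy]); the latter is deduced from the convergence of Poisson
    integrals at Lebesgue points ([Poisson_lebesgue_pt]). The projection onto
    H^2_+ then keeps the Fourier coefficients of nonnegative index
    ([H2p_projection]).

    The last fact is proved by an extremal problem in the manner of Beurling
    ([H2p_neq0]): if f in H^2_+ is nonzero, an element g of least norm among the
    functions of H^2_+ that vanish where f does and share its first nonzero
    Fourier coefficient is orthogonal to all z^m g, m > 0; so |g| is a nonzero
    constant, and f vanishes almost nowhere. *)

Set Implicit Arguments.
Unset Strict Implicit.
Unset Printing Implicit Defensive.

Import Order.TTheory GRing.Theory Num.Theory.
Import numFieldNormedType.Exports.
Import Normc.
Import Defs.

Local Open Scope classical_set_scope.
Local Open Scope ring_scope.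
Local Open Scope complex_scope.

(** * Complex numbers and their norm *)

Section ComplexNorm.
Context {R : realType}.
Implicit Types (x y z : R[i]).

Lemma ComplexP x y : complex.Re x = complex.Re y ->
  complex.Im x = complex.Im y -> x = y.
Proof. by case: x y => a b [c d] /= -> ->. Qed.

Lemma cReD x y : complex.Re (x + y) = complex.Re x + complex.Re y.
Proof. by case: x y => a b [c d]. Qed.
Lemma cImD x y : complex.Im (x + y) = complex.Im x + complex.Im y.
Proof. by case: x y => a b [c d]. Qed.
Lemma cReN x : complex.Re (- x) = - complex.Re x.
Proof. by case: x. Qed.
Lemma cImN x : complex.Im (- x) = - complex.Im x.
Proof. by case: x. Qed.
Lemma cReM x y : complex.Re (x * y) =
  complex.Re x * complex.Re y - complex.Im x * complex.Im y.
Proof. by case: x y => a b [c d]. Qed.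
Lemma cImM x y : complex.Im (x * y) =
  complex.Re x * complex.Im y + complex.Im x * complex.Re y.
Proof. by case: x y => a b [c d]. Qed.
Lemma cReJ x : complex.Re (conjc x) = complex.Re x.
Proof. by case: x. Qed.
Lemma cImJ x : complex.Im (conjc x) = - complex.Im x.
Proof. by case: x. Qed.

Definition ReImE := (cReD, cImD, cReN, cImN, cReM, cImM, cReJ, cImJ).

Lemma cReZ (a : R) x : complex.Re (a%:C * x) = a * complex.Re x.
Proof. by rewrite cReM /= mul0r subr0. Qed.
Lemma cImZ (a : R) x : complex.Im (a%:C * x) = a * complex.Im x.
Proof. by rewrite cImM /= mul0r addr0. Qed.

Lemma normc_ge0 x : 0 <= normc x.
Proof. by case: x => a b; exact: sqrtr_ge0. Qed.

Lemma sqr_normcE x : normc x ^+ 2 = complex.Re x ^+ 2 + complex.Im x ^+ 2.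
Proof. by case: x => a b; rewrite /= sqr_sqrtr// addr_ge0// sqr_ge0. Qed.

Lemma mulJc x : x * conjc x = (normc x ^+ 2)%:C.
Proof.
by rewrite sqr_normcE; apply: ComplexP; rewrite !ReImE /=; ring.
Qed.

Lemma normc_conj x : normc (conjc x) = normc x.
Proof. by case: x => a b; rewrite /= sqrrN. Qed.

Lemma conjD x y : conjc (x + y) = conjc x + conjc y. Proof. exact: rmorphD. Qed.
Lemma conjB x y : conjc (x - y) = conjc x - conjc y. Proof. exact: rmorphB. Qed.
Lemma conjN x : conjc (- x) = - conjc x. Proof. exact: rmorphN. Qed.
Lemma conjM x y : conjc (x * y) = conjc x * conjc y. Proof. exact: rmorphM. Qed.
Lemma conjX x n : conjc (x ^+ n) = conjc x ^+ n. Proof. exact: rmorphXn. Qed.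
Lemma conjV x : conjc (x^-1) = (conjc x)^-1. Proof. exact: conjc_inv. Qed.

Lemma normcD x y : normc (x + y) <= normc x + normc y.
Proof. exact: le_normcD. Qed.

Lemma normc_opp x : normc (- x) = normc x.
Proof. exact: normcN. Qed.

Lemma normcBC x y : normc (x - y) = normc (y - x).
Proof. by rewrite -normc_opp opprB. Qed.

Lemma normcR (a : R) : normc a%:C = `|a|.
Proof. by rewrite /= expr0n addr0 sqrtr_sqr. Qed.

Lemma normcX x n : normc (x ^+ n) = normc x ^+ n.
Proof.
elim: n => [|n IH]; first by rewrite !expr0 (@normc1 R).
by rewrite !exprS normcM IH.
Qed.

Lemma Re_le_normc x : `|complex.Re x| <= normc x.
Proof.
case: x => a b; rewrite /= -sqrtr_sqr ler_sqrt ?addr_ge0 ?sqr_ge0//.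
by rewrite lerDl sqr_ge0.
Qed.

Lemma Im_le_normc x : `|complex.Im x| <= normc x.
Proof.
case: x => a b; rewrite /= -sqrtr_sqr ler_sqrt ?addr_ge0 ?sqr_ge0//.
by rewrite lerDr sqr_ge0.
Qed.

Lemma normc_le_ReIm x : normc x <= `|complex.Re x| + `|complex.Im x|.
Proof.
rewrite -(@ler_pXn2r _ 2%N) ?nnegrE ?addr_ge0 ?normc_ge0// sqr_normcE sqrrD.
rewrite !real_normK ?num_real// addrAC lerDl mulrn_wge0// mulr_ge0//.
Qed.

Lemma normc_eq0 x : (normc x == 0) = (x == 0).
Proof. by apply/eqP/eqP => [/eq0_normc//|->]; rewrite normc0. Qed.

(** The norm of the complex field is itself complex-valued; this reduces its
    topology to inequalities between reals. *)
Lemma cvg_normcP T (F : set_system T) (FF : Filter F) (f : T -> R[i]^o)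
    (l : R[i]^o) :
  f @ F --> l <-> forall e : R, 0 < e -> \forall x \near F, normc (f x - l) < e.
Proof.
split=> [/cvgrPdistC_lt H e e0|H].
  have e0' : 0 < e%:C :> R[i] by rewrite ltcR.
  have := H _ e0'; apply: filterS => x.
  by rewrite normc_def /= ltcR; case: (f x - l).
apply/cvgrPdistC_lt => e; rewrite ltcE /= => /andP[/eqP ie re].
have := H _ re; apply: filterS => x; rewrite normc_def ltcE /= ie eqxx /=.
by case: (f x - l).
Qed.

Lemma cvg_ReIm T (F : set_system T) (FF : Filter F) (f : T -> R[i]^o)
    (l : R[i]^o) :
  f @ F --> l <-> (complex.Re (f x) @[x --> F] --> complex.Re l /\
                   complex.Im (f x) @[x --> F] --> complex.Im l).
Proof.
rewrite cvg_normcP; split=> [H|[H1 H2] e e0].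
  split; apply/cvgrPdistC_lt => e /H; apply: filterS => x; apply: le_lt_trans.
    by rewrite /= -cReN -cReD; exact: Re_le_normc.
  by rewrite /= -cImN -cImD; exact: Im_le_normc.
move/cvgrPdistC_lt: H1 => /(_ (e / 2)); move/cvgrPdistC_lt: H2 => /(_ (e / 2)).
rewrite divr_gt0// => /(_ isT) H2 /(_ isT) H1; near=> x.
apply: (le_lt_trans (normc_le_ReIm _)); rewrite !ReImE [ltRHS](splitr e).
by apply: ltrD; near: x.
Unshelve. all: by end_near. Qed.

Lemma cvg_subl T (F : set_system T) (FF : Filter F) (f : T -> R[i]^o)
    (c l : R[i]^o) : f @ F --> l ->
  ((c - f x : R[i]) : R[i]^o) @[x --> F] --> ((c - l : R[i]) : R[i]^o).
Proof.
move=> /cvg_normcP H; apply/cvg_normcP => e /H; apply: filterS => x.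
have E (a b d : R[i]) : normc (a - d - (a - b)) = normc (b - d).
  by congr normc; ring.
by move=> h; rewrite normcBC; apply: le_lt_trans h; rewrite le_eqVlt (E c) eqxx.
Qed.

End ComplexNorm.

(** * Measurable functions on the circle *)

Section Measurability.
Context {R : realType}.
Notation mu := (@lebesgue_measure R).
Implicit Types (f g h : R[i] -> R[i]).

Lemma measurable_arc : measurable (@arc R).
Proof. exact: measurable_itv. Qed.
#[local] Hint Resolve measurable_arc : core.

(** Distinct from [measurable_arc] because the sigma-algebra that carries the
    Lebesgue measure is a different term for the same Borel sets. *)
Lemma measurable_arc_sigma :
  (measurable : set (set (measurableTypeR R))) (@arc R).
Proof. exact: measurable_itv. Qed.
#[local] Hint Resolve measurable_arc_sigma : core.

Lemma twopi_gt0 : 0 < 2 * pi :> R.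
Proof. by rewrite mulr_gt0// pi_gt0. Qed.

Lemma mu_arc : mu (@arc R) = (2 * pi)%:E.
Proof.
by rewrite /arc lebesgue_measure_itv /= lte_fin twopi_gt0 -EFinB subr0.
Qed.

Lemma normc_cis (t : R) : normc (cis t) = 1.
Proof. by rewrite /cis /= cos2Dsin2 sqrtr1. Qed.

Lemma ae_filter : Filter (almost_everywhere mu).
Proof. exact: ae_filter_ringOfSetsType. Qed.
#[local] Existing Instance ae_filter.

Lemma aeT_all (P : R[i] -> Prop) : (forall z, normc z = 1 -> P z) -> aeT P.
Proof. by move=> H; apply: aeW => t _; apply: H; rewrite normc_cis. Qed.

Lemma aeTS (P Q : R[i] -> Prop) : (forall z, P z -> Q z) -> aeT P -> aeT Q.
Proof. move=> H; rewrite /aeT; apply: filterS => t Pt at_.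
by apply: H; exact: Pt. Qed.

Lemma aeTS2 (P Q S : R[i] -> Prop) : (forall z, P z -> Q z -> S z) ->
  aeT P -> aeT Q -> aeT S.
Proof.
move=> H; rewrite /aeT; apply: filterS2 => t Pt Qt at_.
by apply: H; [exact: Pt|exact: Qt].
Qed.

Lemma aeTS3 (P Q S U : R[i] -> Prop) : (forall z, P z -> Q z -> S z -> U z) ->
  aeT P -> aeT Q -> aeT S -> aeT U.
Proof.
move=> H; rewrite /aeT; apply: filterS3 => t Pt Qt St at_.
by apply: H; [exact: Pt|exact: Qt|exact: St].
Qed.

Lemma aeT_forall (P : nat -> R[i] -> Prop) : (forall n, aeT (P n)) ->
  aeT (fun z => forall n, P n z).
Proof.
move=> H; have := @ae_foralln _ _ _ mu (fun n t => arc t -> P n (cis t)) H.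
by apply: filterS => t Ht at_ n; exact: Ht.
Qed.

Lemma eqT_refl f : eqT f f.
Proof. exact: aeT_all. Qed.

Lemma eqT_sym f g : eqT f g -> eqT g f.
Proof. exact: aeTS. Qed.

(** The inverse is discontinuous at 0, where its value is 0; it is the pointwise
    limit of the continuous functions x / (x^2 + 1 / (n + 1)). *)
Lemma measurable_invr : measurable_fun setT (fun x : R => x^-1).
Proof.
apply: (@measurable_fun_cvg _ _ _ _
    (fun n (x : R) => x / (x ^+ 2 + (n.+1%:R)^-1))).
  move=> n; apply: continuous_measurable_fun => x; apply: cvgM => //.
  apply: cvgV.
    by rewrite gt_eqF// ltr_pwDr// ?sqr_ge0// invr_gt0.
  by apply: cvgD; [exact: exprn_continuous|exact: cvg_cst].
move=> x _; have [->|x0] := eqVneq x 0.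
  rewrite invr0; under eq_fun do rewrite mul0r; exact: cvg_cst.
have -> : x^-1 = x / (x ^+ 2 + 0) by rewrite addr0 expr2 invfM mulrA divff// mul1r.
apply: cvgM; first exact: cvg_cst.
apply: cvgV; first by rewrite addr0 sqrf_eq0.
by apply: cvgD; [exact: cvg_cst|exact: cvg_harmonic].
Qed.

Lemma measT_cst (c : R[i]) : measT (cst c).
Proof. by split; exact: measurable_cst. Qed.

Lemma measTD f g : measT f -> measT g -> measT (f \+ g).
Proof.
move=> [f1 f2] [g1 g2]; split.
  by under eq_fun do rewrite cReD; exact: measurable_funD.
by under eq_fun do rewrite cImD; exact: measurable_funD.
Qed.

Lemma measTN f : measT f -> measT (\- f).
Proof.
move=> [f1 f2]; split.
  by under eq_fun do rewrite cReN; exact: measurable_funN.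
by under eq_fun do rewrite cImN; exact: measurable_funN.
Qed.

Lemma measTB f g : measT f -> measT g -> measT (f \- g).
Proof. by move=> mf mg; exact: (measTD mf (measTN mg)). Qed.

Lemma measTM f g : measT f -> measT g -> measT (f \* g).
Proof.
move=> [f1 f2] [g1 g2]; split.
  under eq_fun do rewrite cReM.
  by apply: measurable_funB; exact: measurable_funM.
under eq_fun do rewrite cImM.
by apply: measurable_funD; exact: measurable_funM.
Qed.

Lemma measTJ f : measT f -> measT (conjT f).
Proof.
move=> [f1 f2]; split; first by under eq_fun do rewrite cReJ.
by under eq_fun do rewrite cImJ; exact: measurable_funN.
Qed.

Lemma measTZ (c : R[i]) f : measT f -> measT (fun z => c * f z).
Proof. exact/measTM/measT_cst. Qed.

Lemma measT_sqr_normc f : measT f ->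
  measurable_fun arc (fun t : R => normc (f (cis t)) ^+ 2).
Proof.
move=> [f1 f2]; under eq_fun do rewrite sqr_normcE.
by apply: measurable_funD; exact: measurable_funX.
Qed.

Lemma measT_inv f : measT f -> measT (fun z => (f z)^-1).
Proof.
move=> mf; have mn := measurableT_comp measurable_invr (measT_sqr_normc mf).
case: mf => f1 f2; split.
  have E (z : R[i]) : complex.Re (z^-1) = complex.Re z * (normc z ^+ 2)^-1.
    by rewrite sqr_normcE; case: z.
  by under eq_fun do rewrite E; exact: measurable_funM.
have E (z : R[i]) : complex.Im (z^-1) = - complex.Im z * (normc z ^+ 2)^-1.
  by rewrite sqr_normcE; case: z => a b; rewrite mulNr.
under eq_fun do rewrite E; apply: measurable_funM => //.
exact: measurable_funN.
Qed.

Lemma measT_div f g : measT f -> measT g -> measT (divT f g).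
Proof. by move=> mf mg; exact: (measTM mf (measT_inv mg)). Qed.

Lemma measT_cvg (u : nat -> R[i] -> R[i]) f : (forall n, measT (u n)) ->
  (forall z, normc z = 1 -> (u n z : R[i]^o) @[n --> \oo] --> (f z : R[i]^o)) ->
  measT f.
Proof.
move=> mu_ cu; split.
  apply: (@measurable_fun_cvg _ _ _ _ (fun n t => complex.Re (u n (cis t)))).
    by move=> n; have [] := mu_ n.
  by move=> t _; have /cvg_ReIm[] := cu _ (normc_cis t).
apply: (@measurable_fun_cvg _ _ _ _ (fun n t => complex.Im (u n (cis t)))).
  by move=> n; have [] := mu_ n.
by move=> t _; have /cvg_ReIm[] := cu _ (normc_cis t).
Qed.

End Measurability.

(** * The normalized integral over the circle *)

Section CircleIntegral.
Context {R : realType}.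
Notation mu := (@lebesgue_measure R).
Implicit Types (f g h : R[i] -> R[i]) (u v w : R -> R).
#[local] Hint Resolve measurable_arc measurable_arc_sigma : core.
#[local] Existing Instance ae_filter.

Definition realint u := mu.-integrable arc (EFin \o u).

Lemma realint_meas u : realint u -> measurable_fun arc u.
Proof. by move=> /integrableP[/measurable_EFinP]. Qed.

Lemma realintD u v : realint u -> realint v -> realint (u \+ v).
Proof. by move=> hu hv; exact: (integrableD _ hu hv). Qed.

Lemma realintZ (k : R) u : realint u -> realint (fun t => k * u t).
Proof. by move=> hu; exact: (integrableZl _ k hu). Qed.

Lemma realintN u : realint u -> realint (\- u).
Proof. by move=> /(realintZ (-1)); under eq_fun do rewrite mulN1r. Qed.

Lemma realintB u v : realint u -> realint v -> realint (u \- v).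
Proof. by move=> hu hv; exact/realintD/realintN. Qed.

Lemma realint_le u v : measurable_fun arc u ->
  (forall t, arc t -> `|u t| <= v t) -> realint v -> realint u.
Proof.
move=> mu_ uv; apply: le_integrable => //; first exact/measurable_EFinP.
by move=> t /uv h; rewrite lee_fin (le_trans h)// ler_norm.
Qed.

Lemma realint_cst (c : R) : realint (cst c).
Proof.
apply: measurable_bounded_integrable => //.
  by change (lebesgue_measure (@arc R) < +oo)%E; rewrite mu_arc ltry.
by exists `|c|; split => // M cM x _ /=; exact: ltW.
Qed.

Lemma realint_norm u : realint u -> realint (fun t => `|u t|).
Proof. by move=> hu; exact: (@integrable_norm _ _ _ mu). Qed.

Definition rint u : R := Rintegral mu arc u.

Lemma rintD u v : realint u -> realint v -> rint (u \+ v) = rint u + rint v.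
Proof. by move=> hu hv; exact: RintegralD. Qed.

Lemma rintZ (k : R) u : realint u -> rint (fun t => k * u t) = k * rint u.
Proof. by move=> hu; exact: RintegralZl. Qed.

Lemma rintN u : realint u -> rint (\- u) = - rint u.
Proof.
move=> hu; rewrite -mulN1r -rintZ//.
by congr rint; apply/funext => t; rewrite mulN1r.
Qed.

Lemma rintB u v : realint u -> realint v -> rint (u \- v) = rint u - rint v.
Proof. by move=> hu hv; exact: RintegralB. Qed.

Lemma rint_le u v : realint u -> realint v ->
  (forall t, arc t -> u t <= v t) -> rint u <= rint v.
Proof. by move=> hu hv uv; exact: le_Rintegral. Qed.

Lemma rint_ge0 u : (forall t, arc t -> 0 <= u t) -> 0 <= rint u.
Proof. by move=> hu; exact: Rintegral_ge0. Qed.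

Lemma rint_cst (c : R) : rint (cst c) = c * (2 * pi).
Proof.
rewrite /rint Rintegral_cst//; congr (_ * _).
by change (fine (lebesgue_measure (@arc R)) = 2 * pi); rewrite mu_arc.
Qed.

Lemma eq_rint u v : (forall t, arc t -> u t = v t) -> rint u = rint v.
Proof. by move=> uv; apply: eq_Rintegral => t; rewrite inE; exact: uv. Qed.

Lemma ae_eq_rint u v : measurable_fun arc u -> measurable_fun arc v ->
  {ae mu, forall t, arc t -> u t = v t} -> rint u = rint v.
Proof.
move=> mu_ mv uv; rewrite /rint /Rintegral; congr fine.
apply: ae_eq_integral => //; [exact/measurable_EFinP|exact/measurable_EFinP|].
by apply: filterS uv => t h at_; rewrite h.
Qed.

Lemma rint_norm u : realint u -> `|rint u| <= rint (fun t => `|u t|).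
Proof. by move=> hu; exact: le_normr_Rintegral. Qed.

Lemma rint_le_norm u v : realint u -> realint v ->
  (forall t, arc t -> `|u t| <= v t) -> `|rint u| <= rint v.
Proof.
move=> hu hv uv; apply: (le_trans (rint_norm hu)); apply: rint_le => //.
exact: realint_norm.
Qed.

Lemma EFin_rint u : realint u -> (\int[mu]_(t in arc) (u t)%:E)%E = (rint u)%:E.
Proof. by move=> hu; rewrite /rint /Rintegral fineK//; exact: integrable_fin_num. Qed.

Lemma realint_ge0P u : measurable_fun arc u -> (forall t, arc t -> 0 <= u t) ->
  (\int[mu]_(t in arc) (u t)%:E < +oo)%E <-> realint u.
Proof.
move=> mu_ u0.
have E : (\int[mu]_(t in arc) `|(u t)%:E| = \int[mu]_(t in arc) (u t)%:E)%E.
  by apply: eq_integral => t; rewrite inE => /u0 ut; rewrite gee0_abs.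
split=> [h|/integrableP[_]]; last by rewrite /= E.
by apply/integrableP; split; [exact/measurable_EFinP|rewrite /= E].
Qed.

Lemma ae_le_int u v : measurable_fun arc u -> measurable_fun arc v ->
  (forall t, 0 <= u t) -> (forall t, 0 <= v t) ->
  {ae mu, forall t, arc t -> u t <= v t} ->
  (\int[mu]_(t in arc) (u t)%:E <= \int[mu]_(t in arc) (v t)%:E)%E.
Proof.
move=> mu_ mv u0 v0 uv; apply: ae_ge0_le_integral => //.
- by move=> t _; rewrite lee_fin.
- exact/measurable_EFinP.
- by move=> t _; rewrite lee_fin.
- exact/measurable_EFinP.
Qed.

Definition integT f := realint (fun t => complex.Re (f (cis t))) /\
  realint (fun t => complex.Im (f (cis t))).

Lemma integT_meas f : integT f -> measT f.
Proof. by move=> [/realint_meas ? /realint_meas ?]. Qed.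

Lemma integTD f g : integT f -> integT g -> integT (f \+ g).
Proof.
move=> [f1 f2] [g1 g2]; split.
  by under eq_fun do rewrite cReD; exact: realintD.
by under eq_fun do rewrite cImD; exact: realintD.
Qed.

Lemma integTZ (c : R[i]) f : integT f -> integT (fun z => c * f z).
Proof.
move=> [f1 f2]; split.
  by under eq_fun do rewrite cReM; apply: realintB; exact: realintZ.
by under eq_fun do rewrite cImM; apply: realintD; exact: realintZ.
Qed.

Lemma integTN f : integT f -> integT (\- f).
Proof. by move=> /(integTZ (-1)); under eq_fun do rewrite mulN1r. Qed.

Lemma integTB f g : integT f -> integT g -> integT (f \- g).
Proof. by move=> hf hg; exact: (integTD hf (integTN hg)). Qed.

Lemma integTJ f : integT f -> integT (conjT f).
Proof.
move=> [f1 f2]; split; first by under eq_fun do rewrite cReJ.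
by under eq_fun do rewrite cImJ; exact: realintN.
Qed.

Lemma integT_le f u : measT f -> realint u ->
  (forall t, arc t -> normc (f (cis t)) <= u t) -> integT f.
Proof.
move=> [f1 f2] hu fu; split; apply: realint_le hu => // t /fu; apply: le_trans.
  exact: Re_le_normc.
exact: Im_le_normc.
Qed.

Lemma integT_cst (c : R[i]) : integT (cst c).
Proof. by split; exact: realint_cst. Qed.

Lemma integT0 : integT (cst 0).
Proof. exact: integT_cst. Qed.

Lemma intTE f : intT f = ((2 * pi)^-1)%:C *
  (rint (fun t => complex.Re (f (cis t))) +i*
   rint (fun t => complex.Im (f (cis t)))).
Proof. by []. Qed.

Lemma Re_intT f : complex.Re (intT f) =
  (2 * pi)^-1 * rint (fun t => complex.Re (f (cis t))).
Proof. by rewrite intTE !ReImE /= mul0r subr0. Qed.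

Lemma Im_intT f : complex.Im (intT f) =
  (2 * pi)^-1 * rint (fun t => complex.Im (f (cis t))).
Proof. by rewrite intTE !ReImE /= mul0r addr0. Qed.

Lemma intTD f g : integT f -> integT g -> intT (f \+ g) = intT f + intT g.
Proof.
move=> [f1 f2] [g1 g2]; apply: ComplexP.
  rewrite cReD !Re_intT -mulrDr -rintD//.
  by congr (_ * rint _); apply/funext => t; rewrite cReD.
rewrite cImD !Im_intT -mulrDr -rintD//.
by congr (_ * rint _); apply/funext => t; rewrite cImD.
Qed.

Lemma intTZ (c : R[i]) f : integT f -> intT (fun z => c * f z) = c * intT f.
Proof.
move=> [f1 f2]; apply: ComplexP.
  rewrite [RHS]cReM !Re_intT Im_intT mulrCA (mulrCA _ _^-1) -mulrBr.
  rewrite -(rintZ _ f1) -(rintZ _ f2).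
  rewrite -rintB; [|exact: realintZ|exact: realintZ].
  by congr (_ * rint _); apply/funext => t; rewrite cReM.
rewrite [RHS]cImM !Im_intT Re_intT mulrCA (mulrCA _ _^-1) -mulrDr.
rewrite -(rintZ _ f2) -(rintZ _ f1).
rewrite -rintD; [|exact: realintZ|exact: realintZ].
by congr (_ * rint _); apply/funext => t; rewrite cImM.
Qed.

Lemma intTN f : integT f -> intT (\- f) = - intT f.
Proof.
move=> hf; rewrite -mulN1r -intTZ//.
by congr intT; apply/funext => t; rewrite mulN1r.
Qed.

Lemma intTB f g : integT f -> integT g -> intT (f \- g) = intT f - intT g.
Proof. by move=> hf hg; rewrite -intTN// -intTD//; exact: integTN. Qed.

Lemma intTJ f : integT f -> intT (conjT f) = conjc (intT f).
Proof.
move=> [f1 f2]; apply: ComplexP.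
  rewrite cReJ !Re_intT.
  by congr (_ * rint _); apply/funext => t; rewrite cReJ.
rewrite cImJ !Im_intT -mulrN -rintN//.
by congr (_ * rint _); apply/funext => t; rewrite cImJ.
Qed.

Lemma eq_intT f g : measT f -> measT g -> eqT f g -> intT f = intT g.
Proof.
move=> [f1 f2] [g1 g2] fg; apply: ComplexP.
  rewrite !Re_intT; congr (_ * _); apply: ae_eq_rint => //.
  by move: fg; rewrite /eqT /aeT; apply: filterS => t h /h ->.
rewrite !Im_intT; congr (_ * _); apply: ae_eq_rint => //.
by move: fg; rewrite /eqT /aeT; apply: filterS => t h /h ->.
Qed.

(** Spares the measurability conditions of [eq_intT] when the functions agree
    everywhere on the circle. *)
Lemma eq_intT_circle f g : (forall z, normc z = 1 -> f z = g z) ->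
  intT f = intT g.
Proof.
move=> fg; apply: ComplexP.
  by rewrite !Re_intT; congr (_ * _); apply: eq_rint => t _; rewrite fg ?normc_cis.
by rewrite !Im_intT; congr (_ * _); apply: eq_rint => t _; rewrite fg ?normc_cis.
Qed.

(** The factor 2 comes from bounding the real and the imaginary part separately;
    only the order of magnitude matters where this is applied. *)
Lemma normc_intT_le f u : integT f -> realint u ->
  (forall t, arc t -> normc (f (cis t)) <= u t) ->
  normc (intT f) <= 2 * ((2 * pi)^-1 * rint u).
Proof.
move=> [f1 f2] hu fu; apply: (le_trans (normc_le_ReIm _)).
have p0 : 0 <= (2 * pi)^-1 :> R by rewrite invr_ge0 ltW// twopi_gt0.
rewrite Re_intT Im_intT !normrM (ger0_norm p0) -mulrDr mulrCA ler_wpM2l//.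
rewrite mulr_natl mulr2n lerD//; apply: rint_le_norm => // t /fu; apply: le_trans.
  exact: Re_le_normc.
exact: Im_le_normc.
Qed.

Lemma intT_cst (c : R[i]) : intT (cst c) = c.
Proof.
have p0 : 2 * pi != 0 :> R by rewrite gt_eqF// twopi_gt0.
apply: ComplexP; rewrite ?Re_intT ?Im_intT rint_cst mulrCA mulVf// mulr1 //.
Qed.

Lemma intT_sum I (r : seq I) (F : I -> R[i] -> R[i]) :
  (forall i, integT (F i)) ->
  integT (fun z => \sum_(i <- r) F i z) /\
  intT (fun z => \sum_(i <- r) F i z) = \sum_(i <- r) intT (F i).
Proof.
move=> H; elim: r => [|i r [IH1 IH2]].
  rewrite big_nil; under eq_fun do rewrite big_nil.
  split; first exact: integT0.
  exact: intT_cst.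
rewrite big_cons -IH2; under eq_fun do rewrite big_cons.
by split; [exact: integTD|exact: intTD].
Qed.

End CircleIntegral.

(** * The inner product and the norm of L^2 *)

Section SquareIntegrable.
Context {R : realType}.
Notation mu := (@lebesgue_measure R).
Implicit Types (f g h : R[i] -> R[i]) (u v w : R -> R).
#[local] Hint Resolve measurable_arc measurable_arc_sigma : core.
#[local] Existing Instance ae_filter.

Definition sqn f := fun t : R => normc (f (cis t)) ^+ 2.

Lemma sqn_ge0 f t : 0 <= sqn f t.
Proof. exact: sqr_ge0. Qed.

Lemma L2TP f : L2T f <-> measT f /\ realint (sqn f).
Proof.
split=> -[mf hf]; split => //.
  by apply/realint_ge0P => //; [exact: measT_sqr_normc|move=> t _; exact: sqn_ge0].
by apply/realint_ge0P => //; [exact: measT_sqr_normc|move=> t _; exact: sqn_ge0].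
Qed.

Lemma L2T_meas f : L2T f -> measT f.
Proof. by case. Qed.

Lemma L2T_sqn f : L2T f -> realint (sqn f).
Proof. by move=> /L2TP[]. Qed.

Lemma L2T_le f (u : R -> R) : measT f -> realint u ->
  (forall t, arc t -> sqn f t <= u t) -> L2T f.
Proof.
move=> mf hu fu; apply/L2TP; split => //.
apply: realint_le hu; first exact: measT_sqr_normc.
by move=> t /fu; rewrite ger0_norm// sqn_ge0.
Qed.

Lemma integT_mulJ f g : L2T f -> L2T g -> integT (f \* conjT g).
Proof.
move=> Lf Lg; apply: (@integT_le _ _ (sqn f \+ sqn g)).
- by apply: measTM; [exact: L2T_meas|exact/measTJ/L2T_meas].
- by apply: realintD; exact: L2T_sqn.
- move=> t _; rewrite /conjT /= normcM normc_conj /sqn.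
  have := normc_ge0 (f (cis t)); have := normc_ge0 (g (cis t)).
  by set a := normc _; set b := normc _ => *; nra.
Qed.

Lemma L2TD f g : L2T f -> L2T g -> L2T (f \+ g).
Proof.
move=> Lf Lg; apply: (@L2T_le _ (fun t => 2 * (sqn f t + sqn g t))).
- by apply: measTD; exact: L2T_meas.
- by apply: realintZ; apply: realintD; exact: L2T_sqn.
- move=> t _; rewrite /sqn /=.
  have := normcD (f (cis t)) (g (cis t)); have := normc_ge0 (f (cis t) + g (cis t)).
  set a := normc _; set b := normc _; set c := normc _ => a0 abc.
  apply: (@le_trans _ _ ((b + c) ^+ 2)); last by have := sqr_ge0 (b - c); lra.
  by rewrite ler_pXn2r// nnegrE (le_trans a0).
Qed.

Lemma L2TZ (c : R[i]) f : L2T f -> L2T (fun z => c * f z).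
Proof.
move=> Lf; apply: (@L2T_le _ (fun t => normc c ^+ 2 * sqn f t)).
- by apply: measTZ; exact: L2T_meas.
- by apply: realintZ; exact: L2T_sqn.
- by move=> t _; rewrite /sqn normcM exprMn.
Qed.

Lemma L2TN f : L2T f -> L2T (\- f).
Proof. by move=> /(L2TZ (-1)); under eq_fun do rewrite mulN1r. Qed.

Lemma L2TB f g : L2T f -> L2T g -> L2T (f \- g).
Proof. by move=> hf hg; exact: (L2TD hf (L2TN hg)). Qed.

Lemma L2T_cst (c : R[i]) : L2T (cst c).
Proof.
apply/L2TP; split; first exact: measT_cst.
exact: (realint_cst (normc c ^+ 2)).
Qed.

Lemma L2TJ f : L2T f -> L2T (conjT f).
Proof.
move=> Lf; apply: (L2T_le (measTJ (L2T_meas Lf)) (L2T_sqn Lf)) => t _.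
by rewrite /sqn /conjT normc_conj.
Qed.

Lemma L2T_integ f : L2T f -> integT f.
Proof.
move=> Lf; have := integT_mulJ Lf (L2T_cst 1).
suff -> : f \* conjT (cst 1) = f by [].
by apply/funext => z; rewrite /conjT /= oppr0; exact: mulr1.
Qed.

Lemma eqT_sqn f g : eqT f g -> {ae mu, forall t, arc t -> sqn f t = sqn g t}.
Proof. by rewrite /eqT /aeT; apply: filterS => t h /h; rewrite /sqn => ->. Qed.

Lemma L2T_eqT f g : measT g -> eqT f g -> L2T f -> L2T g.
Proof.
move=> mg fg [mf Lf]; split => //; apply: le_lt_trans Lf.
apply: (@ae_le_int _ (sqn g) (sqn f)).
- exact: measT_sqr_normc.
- exact: measT_sqr_normc.
- exact: sqn_ge0.
- exact: sqn_ge0.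
by apply: filterS (eqT_sqn fg) => t h /h ->.
Qed.

Lemma L2T_mul (M : R) f g : measT g -> L2T f ->
  aeT (fun z => normc (g z) <= M) -> L2T (g \* f).
Proof.
move=> mg Lf gM; have mf := L2T_meas Lf.
split; first exact: measTM.
apply: (@le_lt_trans _ _ (\int[mu]_(t in arc) (M ^+ 2 * sqn f t)%:E)%E).
  apply: (@ae_le_int _ (sqn (g \* f)) (fun t => M ^+ 2 * sqn f t)).
  - by apply: measT_sqr_normc; exact: measTM.
  - by apply: measurable_funM => //; exact: measT_sqr_normc.
  - exact: sqn_ge0.
  - by move=> t; rewrite mulr_ge0 ?sqr_ge0.
  move: gM; rewrite /aeT; apply: filterS => t h /h gM.
  rewrite /sqn /= normcM exprMn ler_wpM2r ?sqr_ge0//.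
  by rewrite ler_pXn2r// nnegrE ?normc_ge0// (le_trans (normc_ge0 _) gM).
apply/realint_ge0P => //.
- by apply: measurable_funM => //; exact: measT_sqr_normc.
- by move=> t _; rewrite mulr_ge0 ?sqr_ge0.
- by apply: realintZ; exact: L2T_sqn.
Qed.

Lemma L2T_mulLinf f g : LinfT g -> L2T f -> L2T (g \* f).
Proof. by move=> [mg [M gM]] Lf; exact: (L2T_mul mg Lf gM). Qed.

Lemma L2T_sum I (r : seq I) (F : I -> R[i] -> R[i]) :
  (forall i, L2T (F i)) -> L2T (fun z => \sum_(i <- r) F i z).
Proof.
move=> H; elim: r => [|i r IH].
  by under eq_fun do rewrite big_nil; exact: L2T_cst.
by under eq_fun do rewrite big_cons; exact: L2TD.
Qed.

Lemma dotTDl f g h : L2T f -> L2T g -> L2T h ->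
  dotT (f \+ g) h = dotT f h + dotT g h.
Proof.
move=> Lf Lg Lh; rewrite /dotT -intTD; [|exact: integT_mulJ|exact: integT_mulJ].
by congr intT; apply/funext => z /=; rewrite mulrDl.
Qed.

Lemma dotTZl (c : R[i]) f h : L2T f -> L2T h ->
  dotT (fun z => c * f z) h = c * dotT f h.
Proof.
move=> Lf Lh; rewrite /dotT -intTZ; last exact: integT_mulJ.
by congr intT; apply/funext => z /=; rewrite mulrA.
Qed.

Lemma dotTJ f g : L2T f -> L2T g -> dotT g f = conjc (dotT f g).
Proof.
move=> Lf Lg; rewrite /dotT -intTJ; last exact: integT_mulJ.
by congr intT; apply/funext => z; rewrite /conjT /= conjM conjcK mulrC.
Qed.

Lemma dotTNl f h : L2T f -> L2T h -> dotT (\- f) h = - dotT f h.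
Proof.
move=> Lf Lh; have -> : \- f = (fun z => -1 * f z).
  by apply/funext => z; rewrite mulN1r.
by rewrite dotTZl// mulN1r.
Qed.

Lemma dotTBl f g h : L2T f -> L2T g -> L2T h ->
  dotT (f \- g) h = dotT f h - dotT g h.
Proof. by move=> Lf Lg Lh; rewrite -dotTNl// -dotTDl//; exact: L2TN. Qed.

Lemma dotTDr f g h : L2T f -> L2T g -> L2T h ->
  dotT h (f \+ g) = dotT h f + dotT h g.
Proof.
move=> Lf Lg Lh; rewrite dotTJ//; last exact: L2TD.
by rewrite dotTDl// conjD -!dotTJ.
Qed.

Lemma dotTZr (c : R[i]) f h : L2T f -> L2T h ->
  dotT h (fun z => c * f z) = conjc c * dotT h f.
Proof.
move=> Lf Lh; rewrite dotTJ//; last exact: L2TZ.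
by rewrite dotTZl// conjM -dotTJ.
Qed.

Lemma eq_dotT f f' g g' : measT f -> measT f' -> measT g -> measT g' ->
  eqT f f' -> eqT g g' -> dotT f g = dotT f' g'.
Proof.
move=> mf mf' mg mg' ff gg; apply: eq_intT.
- by apply: measTM => //; exact: measTJ.
- by apply: measTM => //; exact: measTJ.
- by move: ff gg; apply: aeTS2 => z; rewrite /conjT /= => -> ->.
Qed.

Definition sqnorm f : R := complex.Re (dotT f f).

Lemma sqnormE f : sqnorm f = (2 * pi)^-1 * rint (sqn f).
Proof.
rewrite /sqnorm Re_intT; congr (_ * rint _); apply/funext => t.
by rewrite /conjT /= mulJc.
Qed.

Lemma twopiV_ge0 : 0 <= (2 * pi)^-1 :> R.
Proof. by rewrite invr_ge0 ltW// twopi_gt0. Qed.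

Lemma sqnorm_ge0 f : 0 <= sqnorm f.
Proof.
by rewrite sqnormE mulr_ge0 ?twopiV_ge0// rint_ge0// => t _; exact: sqn_ge0.
Qed.

Lemma rint_sqn f : rint (sqn f) = 2 * pi * sqnorm f.
Proof. by rewrite sqnormE mulVKf// gt_eqF// twopi_gt0. Qed.

Lemma integral_sqn f : L2T f ->
  (\int[mu]_(t in arc) (sqn f t)%:E)%E = (2 * pi * sqnorm f)%:E.
Proof. by move=> Lf; rewrite EFin_rint ?rint_sqn//; exact: L2T_sqn. Qed.

Lemma eq_sqnorm f g : measT f -> measT g -> eqT f g -> sqnorm f = sqnorm g.
Proof. by move=> mf mg fg; rewrite /sqnorm (eq_dotT mf mg mf mg). Qed.

Lemma sqnormD f g : L2T f -> L2T g ->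
  sqnorm (f \+ g) = sqnorm f + sqnorm g + 2 * complex.Re (dotT f g).
Proof.
move=> Lf Lg; rewrite /sqnorm dotTDl ?dotTDr//; try exact: L2TD.
rewrite !cReD (dotTJ Lf Lg) cReJ; ring.
Qed.

Lemma sqnormZ (c : R[i]) f : L2T f ->
  sqnorm (fun z => c * f z) = normc c ^+ 2 * sqnorm f.
Proof.
move=> Lf; rewrite /sqnorm dotTZl ?dotTZr//; last exact: L2TZ.
by rewrite mulrA mulJc cReZ.
Qed.

Lemma sqnormN f : sqnorm (\- f) = sqnorm f.
Proof.
by rewrite !sqnormE; congr (_ * rint _); apply/funext => t; rewrite /sqn normc_opp.
Qed.

Lemma sqnormB f g : L2T f -> L2T g ->
  sqnorm (f \- g) = sqnorm f + sqnorm g - 2 * complex.Re (dotT f g).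
Proof.
move=> Lf Lg; rewrite sqnormD//; last exact: L2TN.
rewrite sqnormN dotTJ//; last exact: L2TN.
by rewrite dotTNl// conjN cReN cReJ dotTJ// cReJ mulrN.
Qed.

Lemma sqnormBC f g : sqnorm (f \- g) = sqnorm (g \- f).
Proof.
by rewrite -sqnormN; congr sqnorm; apply/funext => z /=; rewrite opprB.
Qed.

Lemma sqnormD_le f g : L2T f -> L2T g -> sqnorm (f \+ g) <= 2 * (sqnorm f + sqnorm g).
Proof.
move=> Lf Lg; have := sqnorm_ge0 (f \- g); rewrite sqnormD// sqnormB//; lra.
Qed.

Lemma sqnorm_eq0 f : L2T f -> sqnorm f = 0 -> eqT f (cst 0).
Proof.
move=> Lf f0; have := integral_sqn Lf; rewrite f0 mulr0 => I0.
have mf := measT_sqr_normc (L2T_meas Lf).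
have Iabs : (\int[mu]_(t in arc) `|(EFin \o sqn f) t| = 0)%E.
  apply: etrans I0; apply: eq_integral => t _ /=.
  by rewrite ger0_norm ?sqn_ge0.
have mE : measurable_fun arc (EFin \o sqn f) by exact/measurable_EFinP.
have H : {ae mu, forall t, arc t -> (EFin \o sqn f) t = cst 0%E t}.
  exact: (@ae_eq_integral_abs _ _ _ mu _ measurable_arc_sigma _ mE).1 Iabs.
move: H; rewrite /eqT /aeT /ae_eq; apply: filterS => t h /h /= [].
by rewrite /sqn => /eqP; rewrite sqrf_eq0 normc_eq0 => /eqP.
Qed.

(** The norm of f - s c g is nonnegative for c = (f, g) and every real s. The
    value s = 1 / (g, g) gives the inequality; if g has norm 0, a large s forces
    c = 0. *)
Lemma CauchySchwarz f g : L2T f -> L2T g ->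
  normc (dotT f g) ^+ 2 <= sqnorm f * sqnorm g.
Proof.
move=> Lf Lg; set c := dotT f g.
have key (s : R) : 0 <= sqnorm f + s ^+ 2 * normc c ^+ 2 * sqnorm g
    - 2 * s * normc c ^+ 2.
  have Lh : L2T (fun z => (s%:C * c) * g z) by exact: L2TZ.
  have := sqnorm_ge0 (f \- (fun z => (s%:C * c) * g z)).
  rewrite sqnormB// sqnormZ// normcM normcR exprMn real_normK ?num_real//.
  rewrite dotTZr// -/c conjM -mulrA (mulrC _ c) mulJc.
  by rewrite conjc_real cReZ mulrA.
have f0 := sqnorm_ge0 f; have g0 := sqnorm_ge0 g; have c0 := sqr_ge0 (normc c).
move: g0; rewrite le_eqVlt => /predU1P[g0|g0].
  rewrite -g0 mulr0 leNgt; apply/negP => cp.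
  have := key ((sqnorm f + 1) / (2 * normc c ^+ 2)).
  have -> : 2 * ((sqnorm f + 1) / (2 * normc c ^+ 2)) * normc c ^+ 2 = sqnorm f + 1.
    by field; move: cp; rewrite exprn_even_gt0.
  by rewrite -g0 mulr0; lra.
have := key (sqnorm g)^-1.
have -> : sqnorm f + (sqnorm g)^-1 ^+ 2 * normc c ^+ 2 * sqnorm g
    - 2 * (sqnorm g)^-1 * normc c ^+ 2 = sqnorm f - normc c ^+ 2 / sqnorm g.
  by field; rewrite gt_eqF.
by rewrite subr_ge0 ler_pdivrMr.
Qed.

Lemma sqnorm_mul_le (M : R) f g : measT g -> L2T f ->
  aeT (fun z => normc (g z) <= M) -> sqnorm (g \* f) <= M ^+ 2 * sqnorm f.
Proof.
move=> mg Lf gM; have Lgf := L2T_mul mg Lf gM.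
rewrite !sqnormE mulrCA ler_wpM2l ?twopiV_ge0// -lee_fin -rintZ; last exact: L2T_sqn.
rewrite -!EFin_rint; [|exact/realintZ/L2T_sqn|exact: L2T_sqn].
apply: (@ae_le_int _ (sqn (g \* f)) (fun t => M ^+ 2 * sqn f t)).
- by apply: measT_sqr_normc; exact: L2T_meas.
- by apply: measurable_funM => //; apply: measT_sqr_normc; exact: L2T_meas.
- exact: sqn_ge0.
- by move=> t; rewrite mulr_ge0 ?sqr_ge0.
move: gM; rewrite /aeT; apply: filterS => t h /h gM.
rewrite /sqn /= normcM exprMn ler_wpM2r ?sqr_ge0//.
by rewrite ler_pXn2r// nnegrE ?normc_ge0// (le_trans (normc_ge0 _) gM).
Qed.

Lemma sqnorm_le_bound f (M : R) : L2T f ->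
  (forall z, normc z = 1 -> normc (f z) <= M) -> sqnorm f <= M ^+ 2.
Proof.
move=> Lf fM; have p0 : 2 * pi != 0 :> R by rewrite gt_eqF// twopi_gt0.
have -> : M ^+ 2 = (2 * pi)^-1 * (M ^+ 2 * (2 * pi)) by rewrite mulrCA mulVf// mulr1.
rewrite sqnormE ler_wpM2l ?twopiV_ge0// -rint_cst.
apply: rint_le; [exact: L2T_sqn|exact: realint_cst|] => t _ /=.
have := fM _ (normc_cis t); rewrite /sqn => h.
by rewrite ler_pXn2r// nnegrE ?normc_ge0// (le_trans (normc_ge0 _) h).
Qed.

End SquareIntegrable.

(** * Convergence in L^2 *)

Section L2Convergence.
Context {R : realType}.
Notation mu := (@lebesgue_measure R).
Implicit Types (f g h : R[i] -> R[i]) (u v w : nat -> R[i] -> R[i]).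
#[local] Hint Resolve measurable_arc measurable_arc_sigma : core.
#[local] Existing Instance ae_filter.

Definition cvgL2 u f := sqnorm (u n \- f) @[n --> \oo] --> (0 : R).

Lemma cvgL2P u f : cvgL2 u f <->
  forall e : R, 0 < e -> \forall n \near \oo, sqnorm (u n \- f) < e.
Proof.
split=> [/cvgrPdistC_lt H e /H|H].
  by apply: filterS => n; rewrite subr0 ger0_norm// sqnorm_ge0.
by apply/cvgrPdistC_lt => e /H; apply: filterS => n;
   rewrite subr0 ger0_norm// sqnorm_ge0.
Qed.

Lemma cvgL2_dot u f g : (forall n, L2T (u n)) -> L2T f -> L2T g ->
  cvgL2 u f -> (dotT (u n) g : R[i]^o) @[n --> \oo] --> (dotT f g : R[i]^o).
Proof.
move=> Lu Lf Lg /cvgL2P uf; apply/cvg_normcP => e e0.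
have g0 := sqnorm_ge0 g.
have d0 : 0 < e ^+ 2 / (sqnorm g + 1) by rewrite divr_gt0 ?exprn_gt0// ltr_wpDl.
have := uf _ d0; apply: filterS => n h.
rewrite -dotTBl//.
have := CauchySchwarz (L2TB (Lu n) Lf) Lg.
set a := normc _; set b := sqnorm (_ \- _) in h * => cs.
have a0 : 0 <= a by exact: normc_ge0.
have b0 : 0 <= b by exact: sqnorm_ge0.
rewrite -(@ltr_pXn2r _ 2%N) ?nnegrE//; last exact: ltW.
apply: (le_lt_trans cs); rewrite ltr_pdivlMr in h; last by rewrite ltr_wpDl.
apply: le_lt_trans h; rewrite ler_wpM2l// lerDl//.
Qed.

(** The form in which the continuity of the inner product is applied: the linear
    conditions that define the Fourier coefficients and the orthogonal complements
    pass to limits. *)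
Lemma cvgL2_dot_cst u f g (c : R[i]) : (forall n, L2T (u n)) -> L2T f ->
  L2T g -> cvgL2 u f -> (\forall n \near \oo, dotT (u n) g = c) ->
  dotT f g = c.
Proof.
move=> Lu Lf Lg uf uc.
have := cvgL2_dot Lu Lf Lg uf.
move/cvg_normcP => H; apply/eqP; rewrite -subr_eq0 -normc_eq0; apply/eqP.
apply/eqP; rewrite eq_le normc_ge0 andbT leNgt; apply/negP => p.
have [n []] := @filter_ex _ \oo _ _ (filterI uc (H _ p)).
by move=> ->; rewrite normcBC ltxx.
Qed.

Lemma cvgL2_sqnorm u f : (forall n, L2T (u n)) -> L2T f -> cvgL2 u f ->
  sqnorm (u n) @[n --> \oo] --> sqnorm f.
Proof.
move=> Lu Lf uf.
have E n : sqnorm (u n) = sqnorm f + sqnorm (u n \- f) + 2 * complex.Re (dotT (u n \- f) f).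
  rewrite sqnormB// dotTBl// cReD cReN -/(sqnorm f); ring.
under eq_fun do rewrite E.
suff H : sqnorm f + sqnorm (u n \- f) + 2 * complex.Re (dotT (u n \- f) f)
    @[n --> \oo] --> sqnorm f + 0 + 2 * 0 by move: H; rewrite mulr0 !addr0.
apply: cvgD; first by apply: cvgD => //; exact: cvg_cst.
apply: cvgM; first exact: cvg_cst.
have /cvg_ReIm[H _] := cvgL2_dot Lu Lf Lf uf.
have -> : 0 = complex.Re (dotT f f) - complex.Re (dotT f f) by rewrite subrr.
under eq_fun do rewrite dotTBl// cReD cReN.
by apply: cvgD => //; exact: cvg_cst.
Qed.

Lemma cvgL2D u v f g : (forall n, L2T (u n)) -> (forall n, L2T (v n)) ->
  L2T f -> L2T g -> cvgL2 u f -> cvgL2 v g ->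
  cvgL2 (fun n => u n \+ v n) (f \+ g).
Proof.
move=> Lu Lv Lf Lg uf vg.
have h : 2 * (sqnorm (u n \- f) + sqnorm (v n \- g)) @[n --> \oo] --> (0 : R).
  have -> : 0 = 2 * (0 + 0) :> R by rewrite addr0 mulr0.
  by apply: cvgM; [exact: cvg_cst|exact: cvgD].
apply: (squeeze_cvgr _ (cvg_cst 0) h); near=> n; rewrite sqnorm_ge0/=.
have -> : u n \+ v n \- (f \+ g) = (u n \- f) \+ (v n \- g).
  by apply/funext => z /=; ring.
by apply: sqnormD_le; exact: L2TB.
Unshelve. all: by end_near. Qed.

Lemma cvgL2_mul (M : R) u f g : (forall n, L2T (u n)) -> L2T f -> measT g ->
  aeT (fun z => normc (g z) <= M) -> cvgL2 u f ->
  cvgL2 (fun n => g \* u n) (g \* f).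
Proof.
move=> Lu Lf mg gM uf.
have h : M ^+ 2 * sqnorm (u n \- f) @[n --> \oo] --> (0 : R).
  have -> : 0 = M ^+ 2 * 0 :> R by rewrite mulr0.
  by apply: cvgM; [exact: cvg_cst|exact: uf].
apply: (squeeze_cvgr _ (cvg_cst 0) h); near=> n; rewrite sqnorm_ge0/=.
have -> : g \* u n \- g \* f = g \* (u n \- f).
  by apply/funext => z /=; rewrite mulrBr.
by apply: sqnorm_mul_le => //; exact: L2TB.
Unshelve. all: by end_near. Qed.

Lemma cvgL2Z (c : R[i]) u f : (forall n, L2T (u n)) -> L2T f ->
  cvgL2 u f -> cvgL2 (fun n z => c * u n z) (fun z => c * f z).
Proof.
move=> Lu Lf uf.
exact: (@cvgL2_mul (normc c) u f (cst c) Lu Lf (measT_cst c) (aeT_all _) uf).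
Qed.

(** Fatou's lemma is what turns almost everywhere limits into L^2 statements: in
    the Riesz-Fischer theorem the limit is first obtained pointwise, and the radial
    dilations of a Cauchy integral are pointwise limits of polynomials. *)
Lemma sqnorm_fatou u f (B : R) : (forall n, L2T (u n)) -> measT f ->
  aeT (fun z => (u n z : R[i]^o) @[n --> \oo] --> (f z : R[i]^o)) ->
  (forall e : R, 0 < e -> \forall n \near \oo, sqnorm (u n) <= B + e) ->
  L2T f /\ sqnorm f <= B.
Proof.
move=> Lu mf uf uB.
have msq n : measurable_fun arc (EFin \o sqn (u n)).
  by apply/measurable_EFinP; apply: measT_sqr_normc; exact: L2T_meas.
have mfs : measurable_fun arc (EFin \o sqn f).
  by apply/measurable_EFinP; exact: measT_sqr_normc.
have key : (\int[mu]_(t in arc) (sqn f t)%:E <= (2 * pi * B)%:E)%E.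
  apply: (@le_trans _ _
    (\int[mu]_(t in arc) limn_einf (fun n => (sqn (u n) t)%:E))%E).
    apply: ae_ge0_le_integral => //.
    - by move=> t _; rewrite lee_fin sqn_ge0.
    - move=> t _; rewrite limn_einf_lim; apply: lime_ge; first exact: is_cvg_einfs.
      apply: nearW => n; apply: le_ereal_inf_tmp => _ [m _ <-].
      by rewrite lee_fin sqn_ge0.
    - rewrite /limn_einf; apply: measurableT_comp => //=.
      apply: measurable_fun_limn_esup => n.
      by apply/measurable_EFinP/measurable_funN/measurable_EFinP; exact: msq.
    - move: uf; rewrite /aeT; apply: filterS => t h /h /cvg_ReIm[h1 h2].
      suff /cvg_limn_einf_sup[-> _] :
        (sqn (u n) t)%:E @[n --> \oo] --> (sqn f t)%:E by [].
      apply: cvg_EFin; first exact: nearW.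
      rewrite /sqn sqr_normcE; under eq_fun do rewrite /= sqr_normcE.
      by apply: cvgD; apply: cvgM.
  apply: (le_trans (fatou mu measurable_arc_sigma msq _)).
    by move=> n t _; rewrite lee_fin sqn_ge0.
  apply/lee_addgt0Pr => e e0; rewrite limn_einf_lim.
  apply: lime_le; first exact: is_cvg_einfs.
  apply: nearW => n.
  have d0 : 0 < e / (2 * pi) by rewrite divr_gt0// twopi_gt0.
  have [N _ HN] := uB _ d0.
  apply: (@le_trans _ _ (\int[mu]_(t in arc) (sqn (u (maxn n N)) t)%:E)%E).
    by apply: ereal_inf_lbound; exists (maxn n N) => //=; exact: leq_maxl.
  rewrite integral_sqn// -EFinD lee_fin.
  have := HN (maxn n N) (leq_maxr _ _) => /(ler_wpM2l (ltW (@twopi_gt0 R))).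
  by move=> /le_trans; apply; rewrite mulrDr (mulrC (2 * pi) (e / _)) divfK// gt_eqF// twopi_gt0.
have Lf : L2T f by split => //; apply: le_lt_trans key _; exact: ltry.
split => //; move: key; rewrite integral_sqn// lee_fin ler_pM2l//.
exact: twopi_gt0.
Qed.

End L2Convergence.

(** * The Riesz-Fischer theorem *)

Section RieszFischer.
Context {R : realType}.
Notation mu := (@lebesgue_measure R).
Implicit Types (f g h : R[i] -> R[i]) (u v w : nat -> R[i] -> R[i]).
#[local] Hint Resolve measurable_arc measurable_arc_sigma : core.
#[local] Existing Instance ae_filter.

Lemma geometric_increments_cvg (x : nat -> R) (C : R) :
  (forall j, `|x j.+1 - x j| <= C * 2^-1 ^+ j) -> cvgn x.
Proof.
move=> xC.
have C0 : 0 <= C by have := le_trans (normr_ge0 _) (xC 0%N); rewrite expr0 mulr1.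
have h0 : 0 <= 2^-1 :> R by rewrite invr_ge0.
have cs : cvgn (series (telescope x)).
  apply: normed_cvg; apply: (@series_le_cvg _ _ (geometric C 2^-1)).
  - by move=> n; exact: normr_ge0.
  - by move=> n; rewrite /= mulr_ge0// exprn_ge0.
  - by move=> n; exact: xC.
  - by apply: is_cvg_geometric_series; rewrite ger0_norm// invf_lt1// ltr1n.
have -> : x = (fun n => x 0%N + series (telescope x) n).
  by apply/funext => n; exact: eq_sum_telescope.
by apply: is_cvgD => //; exact: is_cvg_cst.
Qed.

(** An upper limit rather than a choice of limit, since it is measurable whether
    or not the sequence converges. *)
Definition limT w : R[i] -> R[i] := fun z =>
  fine (limn_esup (fun j => (complex.Re (w j z))%:E)) +i*
  fine (limn_esup (fun j => (complex.Im (w j z))%:E)).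

Lemma measT_limT w : (forall n, measT (w n)) -> measT (limT w).
Proof.
move=> mw; split.
  apply: (@measurableT_comp _ _ _ _ _ _ (@fine R)); first exact: fine_measurable.
  apply: measurable_fun_limn_esup => n; apply/measurable_EFinP.
  by have [] := mw n.
apply: (@measurableT_comp _ _ _ _ _ _ (@fine R)); first exact: fine_measurable.
apply: measurable_fun_limn_esup => n; apply/measurable_EFinP.
by have [] := mw n.
Qed.

Lemma limT_cvg w z : cvgn (fun j => complex.Re (w j z)) ->
  cvgn (fun j => complex.Im (w j z)) ->
  (w j z : R[i]^o) @[j --> \oo] --> (limT w z : R[i]^o).
Proof.
have key (x : nat -> R) : cvgn x ->
    x @ \oo --> fine (limn_esup (fun j => (x j)%:E)).
  move=> /cvg_ex[l xl]; suff /cvg_limn_einf_sup[_ ->] :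
    (x j)%:E @[j --> \oo] --> l%:E by [].
  by apply: cvg_EFin => //; exact: nearW.
by move=> c1 c2; apply/cvg_ReIm; split; exact: key.
Qed.

(** The weighted series of 4^j |w_(j+1) - w_j|^2 has a finite integral, of order
    the sum of (4/8)^j, hence is finite almost everywhere; at such a point the
    increments are at most a constant times 2^-j, and the sequence converges. *)
Lemma summable_increments_cvg w : (forall n, L2T (w n)) ->
  (forall j, sqnorm (w j.+1 \- w j) <= 8^-1 ^+ j) ->
  aeT (fun z => (w j z : R[i]^o) @[j --> \oo] --> (limT w z : R[i]^o)).
Proof.
move=> Lw w8; pose d j := w j.+1 \- w j.
have Ld j : L2T (d j) by exact: L2TB.
pose S (t : R) : \bar R := (\sum_(j <oo) (4 ^+ j * sqn (d j) t)%:E)%E.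
have d0 j t : (0 <= (4 ^+ j * sqn (d j) t)%:E)%E.
  by rewrite lee_fin mulr_ge0//; exact: sqn_ge0.
have md j : measurable_fun arc (fun t => (4 ^+ j * sqn (d j) t)%:E).
  apply/measurable_EFinP/measurable_funM => //.
  by apply: measT_sqr_normc; exact: L2T_meas.
have mS : measurable_fun arc S by exact: ge0_emeasurable_sum.
have S0 t : (0 <= S t)%E by exact: nneseries_ge0.
have intS : (\int[mu]_(t in arc) S t < +oo)%E.
  rewrite /S integral_nneseries//.
  apply: (@le_lt_trans _ _ (\sum_(j <oo) ((4 * pi) / (2 ^ j.+1)%:R)%:E)%E).
    apply: lee_nneseries => [j _ _|j _]; first exact: integral_ge0.
    rewrite EFin_rint; last by apply: realintZ; exact: L2T_sqn.
    rewrite rintZ; last exact: L2T_sqn.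
    rewrite rint_sqn lee_fin mulrCA.
    apply: (@le_trans _ _ (2 * pi * (4 ^+ j * 8^-1 ^+ j))).
      by rewrite ler_pM2l ?twopi_gt0// ler_pM2l ?exprn_gt0//; exact: w8.
    rewrite -exprMn (_ : 4 * 8^-1 = 2^-1 :> R); last by field.
    rewrite natrX exprS exprVn.
    by rewrite le_eqVlt; apply/orP; left; apply/eqP; field; rewrite expf_neq0.
  by apply: le_lt_trans (epsilon_trick0 _ _) (ltry _); rewrite mulr_ge0// pi_ge0.
have iS : mu.-integrable arc S.
  apply/integrableP; split => //.
  suff -> : (\int[mu]_(t in arc) `|S t| = \int[mu]_(t in arc) S t)%E by [].
  by apply: eq_integral => t _; rewrite gee0_abs.
have := integrable_ae measurable_arc_sigma iS.
rewrite /aeT; apply: filterS => t + at_ => /(_ at_) fS.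
pose C : R := fine (S t).
have dC j : normc (d j (cis t)) <= Num.sqrt C * 2^-1 ^+ j.
  have h : 4 ^+ j * sqn (d j) t <= C.
    rewrite -lee_fin /C fineK//.
    apply: le_trans (nneseries_lim_ge j.+1 (fun n _ _ => d0 n t)).
    rewrite big_nat_recr//= leeDr// big_nat.
    exact: sume_ge0.
  have C0 : 0 <= C.
    by apply: le_trans h; rewrite mulr_ge0//; exact: sqn_ge0.
  rewrite -(@ler_pXn2r _ 2%N) ?nnegrE ?normc_ge0//.
  rewrite exprMn sqr_sqrtr// -exprM mulnC exprM exprVn -natrX /=.
  by rewrite exprVn ler_pdivlMr ?exprn_gt0// mulrC.
apply: limT_cvg; apply: (@geometric_increments_cvg _ (Num.sqrt C)) => j.
  by apply: le_trans (dC j); rewrite -cReN -cReD; exact: Re_le_normc.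
by apply: le_trans (dC j); rewrite -cImN -cImD; exact: Im_le_normc.
Qed.

(** A subsequence with fast decreasing increments converges almost everywhere, and
    Fatou's lemma shows that its limit is the limit in L^2. The subsequence is part
    of the conclusion: it identifies the L^2 limit with a limit known pointwise. *)
Lemma RieszFischer u : (forall n, L2T (u n)) ->
  (forall e : R, 0 < e -> exists N, forall m n, (N <= m)%N -> (N <= n)%N ->
     sqnorm (u m \- u n) <= e) ->
  exists f (s : nat -> nat), [/\ L2T f, cvgL2 u f, forall j, (j <= s j)%N &
    aeT (fun z => (u (s j) z : R[i]^o) @[j --> \oo] --> (f z : R[i]^o))].
Proof.
move=> Lu cu.
have h8 j : 0 < 8^-1 ^+ j :> R by rewrite exprn_gt0// invr_gt0.
have /choice[N HN] : forall j, exists N, forall m n,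
    (N <= m)%N -> (N <= n)%N -> sqnorm (u m \- u n) <= 8^-1 ^+ j.
  by move=> j; exact: cu.
(* j is added so that s j tends to infinity *)
pose s j := (j + \max_(i < j.+1) N i)%N.
have sN j : (N j <= s j)%N.
  apply: leq_trans (leq_addl _ _).
  exact: (@leq_bigmax _ (fun i : 'I_j.+1 => N i) ord_max).
have s_le j : (s j <= s j.+1)%N.
  rewrite /s leq_add//.
  by rewrite [X in (_ <= X)%N]big_ord_recr /= leq_maxl.
have s_ge j : (j <= s j)%N by exact: leq_addr.
pose w j := u (s j).
have Lw j : L2T (w j) by exact: Lu.
have w8 j : sqnorm (w j.+1 \- w j) <= 8^-1 ^+ j.
  by apply: HN => //; exact: leq_trans (s_le j).
have cw := summable_increments_cvg Lw w8.
have mf : measT (limT w) by apply: measT_limT => n; exact: L2T_meas.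
have key (e : R) : 0 < e -> exists M, forall n, (M <= n)%N ->
    L2T (u n \- limT w) /\ sqnorm (u n \- limT w) <= e.
  move=> e0; have [M HM] := cu _ e0; exists M => n Mn.
  apply: (@sqnorm_fatou _ (fun j => u n \- w j)).
  - by move=> j; exact: L2TB.
  - by apply: measTB => //; exact: L2T_meas.
  - move: cw; apply: aeTS => z; exact: cvg_subl.
  - move=> d d0; exists M => // j /= Mj.
    apply: (@le_trans _ _ e); last by rewrite lerDl ltW.
    by apply: HM => //; exact: leq_trans (s_ge j).
have [M /(_ _ (leqnn M))[L1 _]] := key 1 ltr01.
have Lf : L2T (limT w).
  have -> : limT w = u M \- (u M \- limT w) by apply/funext => z /=; ring.
  exact: L2TB.
exists (limT w), s; split => //.
apply/cvgL2P => e e0; have [] := key (e / 2); first by rewrite divr_gt0.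
move=> M' HM'; exists M' => // n /= /HM'[_] /le_lt_trans; apply.
by rewrite ltr_pdivrMr// ltr_pMr// ltr1n.
Qed.

End RieszFischer.

(** * Orthonormality of the monomials *)

Section Trigonometric.
Context {R : realType}.
Notation mu := (@lebesgue_measure R).
Implicit Types (f g h : R[i] -> R[i]).
#[local] Hint Resolve measurable_arc measurable_arc_sigma : core.
#[local] Existing Instance ae_filter.

Lemma rint_FTC (f F : R -> R) : continuous f ->
  (forall x, is_derive x (1:R) F (f x)) -> realint f ->
  rint f = F (2 * pi) - F 0.
Proof.
move=> cf dF rf; rewrite /rint /arc Rintegral_itv_bndo_bndc//.
have dF1 x : derivable F x 1 by apply: ex_derive; exact: dF.
have cF : continuous F.
  by move=> x; apply/differentiable_continuous/derivable1_diffP/dF1.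
rewrite /Rintegral (@continuous_FTC2 _ f F 0 (2 * pi)).
- by [].
- exact: twopi_gt0.
- exact: continuous_subspaceT.
- split.
  + by move=> x _; exact: dF1.
  + by apply: cvg_at_right_filter; exact: cF.
  + by apply: cvg_at_left_filter; exact: cF.
- by move=> x _; rewrite derive1E; apply: derive_val.
Qed.

Lemma realint_bounded (f : R -> R) (M : R) : measurable_fun arc f ->
  (forall t, `|f t| <= M) -> realint f.
Proof. by move=> mf fM; exact: (realint_le mf (fun t _ => fM t) (realint_cst M)). Qed.

Lemma continuous_measurable_arc (f : R -> R) : continuous f ->
  measurable_fun arc f.
Proof.
by move=> cf; apply: measurable_funTS; exact: continuous_measurable_fun.
Qed.

Lemma is_derive_lin (k x : R) : is_derive x (1:R) (fun t : R => k * t) k.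
Proof.
have := is_deriveZ (f := @id R) (k : R) (is_derive_id x (1:R)).
by rewrite /GRing.scale /= mulr1.
Qed.

Lemma continuous_lin (k : R) : continuous (fun t : R => k * t).
Proof. by move=> x; apply: cvgM; [exact: cvg_cst|exact: cvg_id]. Qed.

Lemma rint_cos (k : nat) : (0 < k)%N -> rint (fun t : R => cos (k%:R * t)) = 0.
Proof.
move=> k0; have kn : k%:R != 0 :> R by rewrite pnatr_eq0 -lt0n.
have cc : continuous (fun t : R => cos (k%:R * t)).
  by move=> x; apply: continuous_comp; [exact: continuous_lin|exact: continuous_cos].
pose F (t : R) : R := k%:R^-1 * sin (k%:R * t).
have -> : rint (fun t : R => cos (k%:R * t)) = F (2 * pi) - F 0; last first.
  rewrite /F; have -> : k%:R * (2 * pi) = 0 + pi *+ 2 *+ k :> R by rewrite add0r; ring.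
  by rewrite (periodicn (@sinD2pi R)) !mulr0 sin0 mulr0 subrr.
apply: rint_FTC => //.
- move=> x; have dl := is_derive_lin k%:R x.
  have dc := is_derive1_comp (f := @sin R) (is_derive_sin _) dl.
  have := is_deriveZ (k%:R^-1 : R) dc.
  rewrite /GRing.scale /=; set c := (X in is_derive _ _ _ X) => h.
  suff -> : cos (k%:R * x) = c by [].
  by rewrite /c; field.
- apply: (@realint_bounded _ 1); first exact: continuous_measurable_arc.
  by move=> t; exact: cos_max.
Qed.

Lemma rint_sin (k : nat) : (0 < k)%N -> rint (fun t : R => sin (k%:R * t)) = 0.
Proof.
move=> k0; have kn : k%:R != 0 :> R by rewrite pnatr_eq0 -lt0n.
have cc : continuous (fun t : R => sin (k%:R * t)).
  by move=> x; apply: continuous_comp; [exact: continuous_lin|exact: continuous_sin].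
pose F (t : R) : R := - k%:R^-1 * cos (k%:R * t).
have -> : rint (fun t : R => sin (k%:R * t)) = F (2 * pi) - F 0; last first.
  rewrite /F; have -> : k%:R * (2 * pi) = 0 + pi *+ 2 *+ k :> R by rewrite add0r; ring.
  by rewrite (periodicn (@cosD2pi R)) !mulr0 subrr.
apply: rint_FTC => //.
- move=> x; have dl := is_derive_lin k%:R x.
  have dc := is_derive1_comp (f := @cos R) (is_derive_cos _) dl.
  have := is_deriveZ (- k%:R^-1 : R) dc.
  rewrite /GRing.scale /=; set c := (X in is_derive _ _ _ X) => h.
  suff -> : sin (k%:R * x) = c by [].
  by rewrite /c; field.
- apply: (@realint_bounded _ 1); first exact: continuous_measurable_arc.
  by move=> t; exact: sin_max.
Qed.

Lemma cisX (t : R) k : cis t ^+ k = cis (k%:R * t).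
Proof.
elim: k => [|k IH]; first by rewrite expr0 mul0r /cis cos0 sin0.
rewrite exprS IH /cis -natr1 mulrDl mul1r addrC cosD sinD.
by apply: ComplexP; rewrite ?cReM ?cImM /=; ring.
Qed.

Definition mono k : R[i] -> R[i] := fun z => z ^+ k.

Lemma normc_mono k (z : R[i]) : normc z = 1 -> normc (mono k z) = 1.
Proof. by move=> z1; rewrite normcX z1 expr1n. Qed.

Lemma measT_mono k : measT (mono k).
Proof.
split; under eq_fun do rewrite /mono cisX /cis /=;
  apply: continuous_measurable_arc => x; apply: continuous_comp;
  by [exact: continuous_lin|exact: continuous_cos|exact: continuous_sin].
Qed.

Lemma L2T_bounded f (M : R) : measT f ->
  (forall z, normc z = 1 -> normc (f z) <= M) -> L2T f.
Proof.
move=> mf fM; apply: (@L2T_le _ _ (cst (M ^+ 2)) mf (realint_cst _)) => t _ /=.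
have := fM _ (normc_cis t); rewrite /sqn => h.
by rewrite ler_pXn2r// nnegrE ?normc_ge0// (le_trans (normc_ge0 _) h).
Qed.

Lemma L2T_mono k : L2T (mono k).
Proof.
by apply: (@L2T_bounded _ 1 (measT_mono k)) => z z1; rewrite normc_mono.
Qed.

Lemma intT_mono k : (0 < k)%N -> intT (mono k) = 0.
Proof.
move=> k0; apply: ComplexP.
  rewrite Re_intT; under [X in _ * rint X]eq_fun do rewrite /mono cisX /cis /=.
  by rewrite rint_cos// mulr0.
rewrite Im_intT; under [X in _ * rint X]eq_fun do rewrite /mono cisX /cis /=.
by rewrite rint_sin// mulr0.
Qed.

(** The modulus of a monomial is 1 on the circle; by this, inner products of
    monomials reduce to the integral of a single one. *)
Lemma dotT_mulmono k f g : dotT (mono k \* f) (mono k \* g) = dotT f g.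
Proof.
apply: eq_intT_circle => z z1; rewrite /conjT /= conjM.
rewrite mulrACA [X in X * _](_ : _ = 1) ?mul1r//.
by rewrite mulJc normc_mono// expr1n.
Qed.

Lemma monoD j k : mono (j + k) = mono j \* mono k.
Proof. by apply/funext => z; rewrite /mono /= exprD. Qed.

Lemma mono0 : mono 0 = cst 1.
Proof. by apply/funext => z; rewrite /mono expr0. Qed.

Lemma dotT_cst1 f : dotT f (cst 1) = intT f.
Proof.
congr intT; apply/funext => z; rewrite /conjT /= oppr0; exact: mulr1.
Qed.

Lemma dotT_mono j k : dotT (mono j) (mono k) = (j == k)%:R.
Proof.
wlog jk : j k / (k <= j)%N => [H|].
  have [/H//|kj] := leqP k j.
  rewrite dotTJ; [|exact: L2T_mono|exact: L2T_mono].
  by rewrite H ?(ltnW kj)// eq_sym; case: eqP => _; rewrite ?rmorph1 ?rmorph0.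
rewrite -{1}(subnKC jk) monoD.
have E : mono k = mono k \* cst 1 by apply/funext => z /=; rewrite mulr1.
rewrite [in X in dotT _ X]E dotT_mulmono dotT_cst1.
have [->|nk] := eqVneq j k; first by rewrite subnn mono0 intT_cst.
by rewrite intT_mono// subn_gt0 ltn_neqAle eq_sym nk.
Qed.

End Trigonometric.

(** * Analytic polynomials and Fourier coefficients *)

Section AnalyticPolynomials.
Context {R : realType}.
Implicit Types (f g h : R[i] -> R[i]) (a b : nat -> R[i]).

Definition poly a N : R[i] -> R[i] := fun z => \sum_(k < N) a k * z ^+ k.

Lemma polyS a N : poly a N.+1 = poly a N \+ (fun z => a N * mono N z).
Proof. by apply/funext => z; rewrite /poly big_ord_recr. Qed.

Lemma L2T_poly a N : L2T (poly a N).
Proof. by apply: L2T_sum => k; apply: L2TZ; exact: L2T_mono. Qed.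

Lemma dotT_poly_mono a N k : dotT (poly a N) (mono k) = if (k < N)%N then a k else 0.
Proof.
elim: N => [|N IH].
  rewrite (_ : poly a 0 = (fun z => 0 * mono 0 z)); last first.
    by apply/funext => z; rewrite /poly big_ord0 mul0r.
  by rewrite dotTZl ?mul0r//; exact: L2T_mono.
rewrite polyS dotTDl; [|exact: L2T_poly|apply: L2TZ; exact: L2T_mono|exact: L2T_mono].
rewrite dotTZl; [|exact: L2T_mono|exact: L2T_mono].
rewrite IH dotT_mono [X in _ = if X then _ else _]ltnS [(k <= N)%N]leq_eqVlt.
have [->|nk] := eqVneq k N; first by rewrite ltnn add0r mulr1.
by rewrite mulr0 addr0.
Qed.

Lemma dotT_poly a b N :
  dotT (poly a N) (poly b N) = \sum_(k < N) a k * conjc (b k).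
Proof.
suff H M : (M <= N)%N ->
    dotT (poly a N) (poly b M) = \sum_(k < M) a k * conjc (b k) by exact: H.
elim: M => [|M IH] MN.
  rewrite (_ : poly b 0 = (fun z => 0 * mono 0 z)); last first.
    by apply/funext => z; rewrite /poly big_ord0 mul0r.
  rewrite dotTZr ?big_ord0; [|exact: L2T_mono|exact: L2T_poly].
  by rewrite conjc0 mul0r.
rewrite polyS dotTDr; [|exact: L2T_poly|apply: L2TZ; exact: L2T_mono|exact: L2T_poly].
rewrite dotTZr; [|exact: L2T_mono|exact: L2T_poly].
by rewrite IH ?(ltnW MN)// dotT_poly_mono MN big_ord_recr/= (mulrC (conjc _)).
Qed.

Lemma sqnorm_poly a N : sqnorm (poly a N) = \sum_(k < N) normc (a k) ^+ 2.
Proof.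
have E : dotT (poly a N) (poly a N) = (\sum_(k < N) normc (a k) ^+ 2)%:C.
  by rewrite dotT_poly rmorph_sum; apply: eq_bigr => k _; rewrite mulJc.
by rewrite /sqnorm E.
Qed.

(** Padding with zeros turns a difference of truncations into a polynomial, whose
    norm is then given by [sqnorm_poly]. *)
Lemma polyB a b N M : (N <= M)%N -> poly b M \- poly a N =
  poly (fun k => b k - (if (k < N)%N then a k else 0)) M.
Proof.
move=> NM; apply/funext => z; rewrite /poly /=.
under [RHS]eq_bigr do rewrite mulrBl.
rewrite sumrB; congr (_ - _).
rewrite (big_ord_widen _ (fun k => a k * z ^+ k) NM) big_mkcond.
by apply: eq_bigr => k _; case: ifP; rewrite ?mul0r.
Qed.

Lemma sqnorm_polyB a N M : (N <= M)%N ->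
  sqnorm (poly a M \- poly a N) = \sum_(N <= k < M) normc (a k) ^+ 2.
Proof.
move=> NM; rewrite polyB// sqnorm_poly -(big_mkord xpredT (fun k =>
  normc (a k - (if (k < N)%N then a k else 0)) ^+ 2)).
rewrite (big_cat_nat _ (n := N))//= big_nat big1 ?add0r.
  by apply: eq_big_nat => k /andP[Nk _]; rewrite ltnNge Nk/= subr0.
by move=> k /andP[_ ->]; rewrite subrr normc0 expr0n.
Qed.

Lemma analytic_coef a f k : L2T f -> cvgL2 (poly a) f -> dotT f (mono k) = a k.
Proof.
move=> Lf af; apply: (cvgL2_dot_cst (L2T_poly a) Lf (L2T_mono k) af).
by exists k.+1 => // N /= kN; rewrite dotT_poly_mono kN.
Qed.

Lemma intT_poly_mono a N k : (0 < k)%N -> intT (poly a N \* mono k) = 0.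
Proof.
move=> k0.
have I (j : 'I_N) : integT (fun z => a j * mono (j + k) z).
  by apply: integTZ; apply: L2T_integ; exact: L2T_mono.
have [_ E] := intT_sum (index_enum 'I_N) I.
have -> : poly a N \* mono k = (fun z => \sum_(j < N) a j * mono (j + k) z).
  apply/funext => z; rewrite /poly /= mulr_suml; apply: eq_bigr => j _.
  by rewrite monoD /= mulrA.
rewrite E big1// => j _; rewrite intTZ; last by apply: L2T_integ; exact: L2T_mono.
by rewrite intT_mono ?mulr0// addn_gt0 k0 orbT.
Qed.

Lemma conjTK f : conjT (conjT f) = f.
Proof. by apply/funext => z; rewrite /conjT conjcK. Qed.

(** The Fourier coefficient of index -k of f is the integral of f z^k; it vanishes
    for polynomials, hence for their limits. *)
Lemma analytic_anticoef a f k : L2T f -> cvgL2 (poly a) f -> (0 < k)%N ->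
  intT (f \* mono k) = 0.
Proof.
move=> Lf af k0.
have E h : dotT h (conjT (mono k)) = intT (h \* mono k) by rewrite /dotT conjTK.
rewrite -E; apply: (cvgL2_dot_cst (L2T_poly a) Lf _ af).
  by apply: L2TJ; exact: L2T_mono.
by apply: nearW => N; rewrite E intT_poly_mono.
Qed.

Definition coef f k : R[i] := dotT f (mono k).

Lemma sqnormB_coef f N : L2T f ->
  sqnorm (f \- poly (coef f) N) = sqnorm f - \sum_(k < N) normc (coef f k) ^+ 2.
Proof.
move=> Lf; have E : dotT f (poly (coef f) N) =
    (\sum_(k < N) normc (coef f k) ^+ 2)%:C.
  rewrite rmorph_sum; elim: N => [|N IH].
    rewrite (_ : poly _ 0 = (fun z => 0 * mono 0 z)); last first.
      by apply/funext => z; rewrite /poly big_ord0 mul0r.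
    rewrite dotTZr ?big_ord0; [|exact: L2T_mono|exact: Lf].
    by rewrite conjc0 mul0r.
  rewrite polyS dotTDr; [|exact: L2T_poly|apply: L2TZ; exact: L2T_mono|exact: Lf].
  rewrite dotTZr; [|exact: L2T_mono|exact: Lf].
  by rewrite IH big_ord_recr -/(coef f N) [conjc _ * _]mulrC mulJc.
rewrite sqnormB//; last exact: L2T_poly.
by rewrite E sqnorm_poly /=; ring.
Qed.

Lemma Bessel f N : L2T f -> \sum_(k < N) normc (coef f k) ^+ 2 <= sqnorm f.
Proof. by move=> Lf; rewrite -subr_ge0 -sqnormB_coef// sqnorm_ge0. Qed.

(** Applied to squared Fourier coefficients: it makes the partial sums of a Fourier
    series Cauchy. *)
Lemma bounded_sum_tail (x : nat -> R) (B : R) : (forall k, 0 <= x k) ->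
  (forall N, \sum_(k < N) x k <= B) -> forall e : R, 0 < e ->
  exists N, forall M, (N <= M)%N -> \sum_(N <= k < M) x k <= e.
Proof.
move=> x0 xB e e0.
pose s n := \sum_(k < n) x k.
have s_mono m n : (m <= n)%N -> s m <= s n.
  move=> mn; rewrite /s -!(big_mkord xpredT x) [leRHS](big_cat_nat _ (n := m))//=.
  by rewrite lerDl sumr_ge0.
have : cvgn s.
  apply: nondecreasing_is_cvgn => //; exists B => _ [n _ <-]; exact: xB.
move=> /cvg_ex[l sl].
have s_le n : s n <= l.
  by rewrite -(cvg_lim _ sl)//; apply: nondecreasing_cvgn_le => //; apply/cvg_ex; exists l.
have /cvgrPdist_lt/(_ e e0)[N _ HN] := sl.
exists N => M NM; have := HN N (leqnn N) => /=.
rewrite ger0_norm ?subr_ge0// => h.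
have E : s M = s N + \sum_(N <= k < M) x k.
  by rewrite /s -!(big_mkord xpredT x) [LHS](big_cat_nat _ (n := N)).
have := s_le M; rewrite E; lra.
Qed.

Lemma cauchy_poly a (B : R) : (forall N, \sum_(k < N) normc (a k) ^+ 2 <= B) ->
  forall e : R, 0 < e -> exists N, forall m n, (N <= m)%N -> (N <= n)%N ->
     sqnorm (poly a m \- poly a n) <= e.
Proof.
move=> aB e e0.
have [N HN] := bounded_sum_tail (fun k => sqr_ge0 (normc (a k))) aB e0.
have key m n : (N <= m)%N -> (m <= n)%N -> sqnorm (poly a n \- poly a m) <= e.
  move=> Nm mn; rewrite sqnorm_polyB//; apply: le_trans (HN n (leq_trans Nm mn)).
  rewrite [leRHS](big_cat_nat _ (n := m))//= lerDr sumr_ge0// => k _.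
  exact: sqr_ge0.
exists N => m n Nm Nn; have [mn|/ltnW nm] := leqP m n; last exact: key.
by rewrite sqnormBC; exact: key.
Qed.

End AnalyticPolynomials.

(** * Cauchy and Poisson integrals *)

Section CauchyPoisson.
Context {R : realType}.
Implicit Types (f g h : R[i] -> R[i]) (z w : R[i]).

(** Comparable with the modulus, and integrable as soon as both parts are, with no
    measurability argument for a square root. *)
Definition norm1 f := fun t : R =>
  `|complex.Re (f (cis t))| + `|complex.Im (f (cis t))|.

Lemma realint_norm1 f : integT f -> realint (norm1 f).
Proof. by move=> [f1 f2]; apply: realintD; exact: realint_norm. Qed.

Lemma integT_mulb f g (M : R) : integT f -> measT g ->
  (forall w, normc w = 1 -> normc (g w) <= M) -> integT (f \* g).
Proof.
move=> If mg gM; apply: (@integT_le _ _ (fun t => M * norm1 f t)).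
- by apply: measTM => //; exact: integT_meas.
- by apply: realintZ; exact: realint_norm1.
- move=> t _; rewrite /= normcM mulrC ler_pM ?normc_ge0//.
    exact/gM/normc_cis.
  exact: normc_le_ReIm.
Qed.

Lemma normc_intT_mulb f g (M : R) : integT f -> measT g ->
  (forall w, normc w = 1 -> normc (g w) <= M) ->
  normc (intT (f \* g)) <= 2 * ((2 * pi)^-1 * (M * rint (norm1 f))).
Proof.
move=> If mg gM; rewrite -rintZ; last exact: realint_norm1.
apply: normc_intT_le; first exact: integT_mulb gM.
  by apply: realintZ; exact: realint_norm1.
move=> t _; rewrite /= normcM mulrC ler_pM ?normc_ge0//.
  exact/gM/normc_cis.
exact: normc_le_ReIm.
Qed.

(** The Cauchy kernel for the arc length: w / (w - z) on the unit circle. *)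
Definition Ckernel z : R[i] -> R[i] := fun w => (1 - z * conjc w)^-1.

Lemma Ckernel_lb z w : normc z < 1 -> normc w = 1 ->
  1 - normc z <= normc (1 - z * conjc w).
Proof.
move=> z1 w1; have := normcD (1 - z * conjc w) (z * conjc w).
by rewrite subrK normcM normc_conj w1 mulr1 (@normc1 R); lra.
Qed.

Lemma Ckernel_neq0 z w : normc z < 1 -> normc w = 1 -> 1 - z * conjc w != 0.
Proof.
move=> z1 w1; rewrite -normc_eq0 gt_eqF//.
by apply: lt_le_trans (Ckernel_lb z1 w1); rewrite subr_gt0.
Qed.

Lemma measT_id : measT (fun w : R[i] => w).
Proof.
have -> : (fun w : R[i] => w) = mono 1 by apply/funext => w; rewrite /mono expr1.
exact: measT_mono.
Qed.

Lemma measT_Ckernel z : measT (Ckernel z).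
Proof.
apply: (@measT_inv _ (fun w => 1 - z * conjc w)); apply: measTB.
  exact: measT_cst.
by apply: measTZ; exact/measTJ/measT_id.
Qed.

Lemma Ckernel_bound z w : normc z < 1 -> normc w = 1 ->
  normc (Ckernel z w) <= (1 - normc z)^-1.
Proof.
move=> z1 w1; rewrite normcV lef_pV2 ?posrE ?subr_gt0 ?Ckernel_lb//.
by apply: lt_le_trans (Ckernel_lb z1 w1); rewrite subr_gt0.
Qed.

Lemma geometric_remainder (x : R[i]) n : 1 - x != 0 ->
  (1 - x)^-1 - \sum_(k < n) x ^+ k = x ^+ n * (1 - x)^-1.
Proof.
move=> x0; have H : (1 - x) * (\sum_(k < n) x ^+ k) = 1 - x ^+ n.
  by rewrite -opprB mulNr -subrX1 opprB.
by apply: (mulfI x0); rewrite mulrBr H divff// mulrCA divff//; ring.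
Qed.

(** The Cauchy kernel is the geometric series of z conj(w), so the Cauchy integral
    of f is the power series of its Fourier coefficients of nonnegative index. *)
Lemma Cauchy_series f z n : integT f -> normc z < 1 ->
  normc (intT (f \* Ckernel z) - \sum_(k < n) coef f k * z ^+ k) <=
  2 * ((2 * pi)^-1 * (normc z ^+ n * (1 - normc z)^-1 * rint (norm1 f))).
Proof.
move=> If z1.
have Ik k : integT (f \* conjT (mono k)).
  apply: (@integT_mulb _ _ 1) => //; first exact/measTJ/measT_mono.
  by move=> w w1; rewrite /conjT normc_conj normc_mono.
have I (k : 'I_n) : integT (fun w => z ^+ k * (f w * conjc (mono k w))).
  by apply: integTZ; exact: Ik.
have [IS ES] := intT_sum (index_enum 'I_n) I.
have -> : \sum_(k < n) coef f k * z ^+ k =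
    intT (fun w => \sum_(k < n) z ^+ k * (f w * conjc (mono k w))).
  rewrite ES; apply: eq_bigr => k _; rewrite intTZ; last exact: Ik.
  by rewrite mulrC.
rewrite -intTB//; last first.
  by apply: integT_mulb (fun w => @Ckernel_bound z w z1) => //; exact: measT_Ckernel.
pose g w := (z * conjc w) ^+ n * Ckernel z w.
rewrite (@eq_intT_circle _ _ (f \* g)); last first.
  move=> w w1; rewrite /g /= -geometric_remainder; last exact: Ckernel_neq0.
  rewrite mulrBr; congr (_ - _); rewrite mulr_sumr; apply: eq_bigr => k _.
  by rewrite /mono conjX exprMn mulrCA.
apply: normc_intT_mulb => //.
  apply: measTM; last exact: measT_Ckernel.
  have -> : (fun w => (z * conjc w) ^+ n) = (fun w => z ^+ n * conjT (mono n) w).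
    by apply/funext => w; rewrite exprMn /conjT /mono conjX.
  by apply: measTZ; exact/measTJ/measT_mono.
move=> w w1; rewrite /g normcM normcX normcM normc_conj w1 mulr1 ler_pM//.
- by rewrite exprn_ge0// normc_ge0.
- exact: normc_ge0.
- exact: Ckernel_bound.
Qed.

Lemma cvg_geo0 (q C : R) : 0 <= q < 1 -> C * q ^+ n @[n --> \oo] --> (0 : R).
Proof.
by move=> /andP[q0 q1]; apply: cvg_geometric; rewrite ger0_norm.
Qed.

Lemma Cauchy_const f z : integT f -> normc z < 1 ->
  (forall k, (0 < k)%N -> coef f k = 0) -> intT (f \* Ckernel z) = intT f.
Proof.
move=> If z1 f0; apply/eqP; rewrite -subr_eq0 -normc_eq0 eq_le normc_ge0 andbT.
set K := rint (norm1 f).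
set C : R := 2 * ((2 * pi)^-1 * ((1 - normc z)^-1 * K)).
have H n : normc (intT (f \* Ckernel z) - intT f) <= C * normc z ^+ n.+1.
  have := Cauchy_series n.+1 If z1.
  rewrite big_ord_recl expr0 mulr1 big1 ?addr0; last first.
    by move=> i _; rewrite f0 ?mul0r.
  rewrite /coef mono0 dotT_cst1 => /le_trans; apply.
  by rewrite le_eqVlt; apply/orP; left; apply/eqP; rewrite /C /K; ring.
have c : C * normc z ^+ n.+1 @[n --> \oo] --> (0 : R).
  have := @cvg_geo0 (normc z) C; rewrite normc_ge0 z1 => /(_ isT) c0.
  by rewrite (cvg_shiftS (fun n => C * normc z ^+ n)).
by rewrite -(cvg_lim _ c)//; apply: limr_ge; [apply/cvg_ex; exists 0|exact: nearW].
Qed.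

(** The Poisson kernel of the point r z of the disc, as a function of w. *)
Definition Pkernel (r : R) z : R[i] -> R[i] := fun w =>
  ((1 - r ^+ 2) / normc (1 - r%:C * z * conjc w) ^+ 2)%:C.

Lemma PkernelE (r : R) z w : 0 <= r < 1 -> normc z = 1 -> normc w = 1 ->
  Pkernel r z w = Ckernel (r%:C * z) w +
                  (conjc (Ckernel (r%:C * z) w) - 1).
Proof.
move=> /andP[r0 r1] z1 w1.
have q1 : normc (r%:C * z) < 1 by rewrite normcM normcR z1 mulr1 ger0_norm.
have n0 := Ckernel_neq0 q1 w1.
rewrite /Ckernel conjV /Pkernel; set x := 1 - r%:C * z * conjc w in n0 *.
have x0 : conjc x != 0 by rewrite -normc_eq0 normc_conj normc_eq0.
rewrite rmorphM fmorphV /= -mulJc.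
have E : (1 - r ^+ 2)%:C = x + conjc x - x * conjc x.
  have : normc (1 - x) ^+ 2 = r ^+ 2.
    rewrite /x opprB addrCA subrr addr0 !normcM normcR z1 normc_conj w1 !mulr1.
    by rewrite real_normK// num_real.
  move=> <-; rewrite rmorphB /= rmorph1 -mulJc conjB conjc1; ring.
rewrite E; move: (conjc x) x0 => y y0; by field; rewrite y0 n0.
Qed.

(** The Poisson kernel is C + conj(C) - 1, with C the Cauchy kernel. If f has no
    Fourier coefficient of negative index, its integral against conj(C) is its mean,
    which the term - 1 cancels. *)
Lemma Pkernel_integral f (r : R) z : integT f -> 0 <= r < 1 -> normc z = 1 ->
  (forall k, (0 < k)%N -> intT (f \* mono k) = 0) ->
  intT (f \* Pkernel r z) = intT (f \* Ckernel (r%:C * z)).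
Proof.
move=> If r01 z1 f0; have /andP[r0 r1] := r01.
have q1 : normc (r%:C * z) < 1 by rewrite normcM normcR z1 mulr1 ger0_norm.
have Ic : integT (f \* Ckernel (r%:C * z)).
  by apply: integT_mulb (fun w => @Ckernel_bound _ w q1) => //; exact: measT_Ckernel.
have IJ := integTJ If.
have IcJ : integT (conjT f \* Ckernel (r%:C * z)).
  by apply: integT_mulb (fun w => @Ckernel_bound _ w q1) => //; exact: measT_Ckernel.
rewrite (@eq_intT_circle _ _ ((f \* Ckernel (r%:C * z)) \+
   (conjT (conjT f \* Ckernel (r%:C * z)) \- f))); last first.
  move=> w w1; rewrite /= (PkernelE r01 z1 w1) mulrDr; congr (_ + _).
  by rewrite /conjT /= conjM conjcK mulrBr mulr1.
rewrite intTD//; last by apply: integTB => //; exact: integTJ.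
rewrite intTB//; last exact: integTJ.
rewrite intTJ// (Cauchy_const IJ q1); first by rewrite intTJ// conjcK subrr addr0.
move=> k k0; rewrite /coef /dotT.
have -> : conjT f \* conjT (mono k) = conjT (f \* mono k).
  by apply/funext => w; rewrite /conjT /= conjM.
rewrite intTJ ?f0 ?conjc0//.
apply: (@integT_mulb _ _ 1) => //; first exact/measT_mono.
by move=> w w1; rewrite normc_mono.
Qed.

End CauchyPoisson.

(** * Estimates for the Poisson kernel *)

Section PoissonFatou.
Context {R : realType}.
Notation mu := (@lebesgue_measure R).
Implicit Types (u v w : R -> R) (A B : set (measurableTypeR R)).
#[local] Hint Resolve measurable_arc measurable_arc_sigma : core.
#[local] Existing Instance ae_filter.

Definition eint A u : \bar R := (\int[mu]_(s in A) (u s)%:E)%E.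

Lemma eint_meas A u : measurable_fun setT u ->
  measurable_fun A (fun s => (u s)%:E).
Proof. by move=> mu_; apply/measurable_EFinP; exact: measurable_funTS. Qed.

Lemma eint_le A u v : measurable A -> measurable_fun setT u ->
  measurable_fun setT v -> (forall s, 0 <= u s) ->
  (forall s, A s -> u s <= v s) -> (eint A u <= eint A v)%E.
Proof.
move=> mA mu_ mv u0 uv; apply: ge0_le_integral => //.
- by move=> s _; rewrite lee_fin.
- exact: eint_meas.
- exact: eint_meas.
Qed.

Lemma eint_split A B u : measurable A -> measurable B -> measurable_fun setT u ->
  (forall s, 0 <= u s) -> A `<=` B ->
  eint B u = (eint A u + eint (B `\` A) u)%E.
Proof.
move=> mA mB mu_ u0 AB; rewrite /eint -{1}(setDUK AB) ge0_integral_setU//.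
- exact: measurableD.
- exact: eint_meas.
- by move=> s _; rewrite lee_fin.
- by rewrite disj_set2E setDIK.
Qed.

Lemma eint_sub A B u : measurable A -> measurable B -> measurable_fun setT u ->
  (forall s, 0 <= u s) -> A `<=` B -> (eint A u <= eint B u)%E.
Proof.
move=> mA mB mu_ u0 AB; apply: ge0_subset_integral => //.
  exact: eint_meas.
by move=> s _; rewrite lee_fin.
Qed.

Lemma eintZ A u (k : R) : measurable A -> measurable_fun setT u ->
  (forall s, 0 <= u s) -> 0 <= k ->
  eint A (fun s => k * u s) = (k%:E * eint A u)%E.
Proof.
move=> mA mu_ u0 k0; rewrite /eint.
under eq_integral do rewrite EFinM.
rewrite ge0_integralZl_EFin//.
  by move=> s _; rewrite lee_fin.
exact: eint_meas.
Qed.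

(** Here K is dominated by a Poisson kernel of width eta, and psi has mass at most
    e h on the ball of radius h around t. The ball of radius eta contributes at
    most a e; on the shell between 2^n eta and 2^(n+1) eta the kernel is at most
    a / (4^n eta) and the mass of psi at most 2^(n+1) e eta, a contribution of
    2 a e / 2^n. The total is a e (1 + 4). *)
Lemma dyadic_estimate (psi K : R -> R) (t d eta a e : R) :
  measurable_fun setT psi -> measurable_fun setT K ->
  (forall s, 0 <= psi s) -> (forall s, 0 <= K s) ->
  0 < d -> 0 < eta -> 0 <= a -> 0 <= e ->
  (forall s, ball t d s -> K s <= a * eta / (eta ^+ 2 + (s - t) ^+ 2)) ->
  (forall h, 0 < h <= d -> (eint (ball t h) psi <= (e * h)%:E)%E) ->
  (eint (ball t d) (fun s => K s * psi s)%R <= (5 * a * e)%:E)%E.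
Proof.
move=> mp mK p0 K0 d0 eta0 a0 e0 Kb pe.
(* radii of the shells, cut off at d, where the hypotheses stop *)
pose rho n : R := Num.min d (2 ^+ n * eta).
have pow0 n : 0 < 2 ^+ n :> R by rewrite exprn_gt0.
have rho0 n : 0 < rho n by rewrite lt_min d0 mulr_gt0.
have rhod n : rho n <= d by rewrite ge_min lexx.
have mKp : measurable_fun setT (fun s => K s * psi s).
  exact: measurable_funM.
have Kp0 s : 0 <= K s * psi s by rewrite mulr_ge0.
have mb h : measurable (ball t h : set (measurableTypeR R)).
  exact: measurable_ball.
have Bsub n s : ball t (rho n) s -> ball t d s.
  by apply: le_ball.
have bound A (c : R) n : measurable A -> A `<=` ball t (rho n) -> 0 <= c ->
    (forall s, A s -> K s <= c) ->
    (eint A (fun s => K s * psi s)%R <= (c * (e * rho n))%:E)%E.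
  move=> mA AB c0 Kc.
  apply: (@le_trans _ _ (eint A (fun s => c * psi s)%R)).
    apply: eint_le => //; first exact: measurable_funM.
    by move=> s As; rewrite ler_wpM2r// Kc.
  rewrite eintZ// EFinM lee_wpmul2l ?lee_fin//.
  apply: (@le_trans _ _ (eint (ball t (rho n)) psi)); first exact: eint_sub.
  by apply: pe; rewrite rho0 rhod.
have step n : (eint (ball t (rho n)) (fun s => K s * psi s)%R <=
    (a * e * (5 - 4 / 2 ^+ n))%:E)%E.
  elim: n => [|n IH].
    apply: (@le_trans _ _ (a / eta * (e * rho 0%N))%:E).
      apply: bound => //; first by rewrite divr_ge0// ltW.
      move=> s Bs; apply: (le_trans (Kb _ (Bsub _ _ Bs))).
      rewrite -mulrA ler_wpM2l// ler_pdivrMr ?ltr_wpDr ?exprn_gt0 ?sqr_ge0//.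
      by rewrite mulrDr expr2 mulKf ?gt_eqF// lerDl mulr_ge0 ?sqr_ge0// invr_ge0 ltW.
    rewrite lee_fin expr0 divr1 (_ : 5 - 4 = 1 :> R); last by ring.
    rewrite mulr1 mulrAC mulrA ler_pdivrMr// -!mulrA ler_wpM2l// ler_wpM2l//.
    by rewrite ge_min expr0 mul1r lexx orbT.
  have sub : (ball t (rho n) : set (measurableTypeR R)) `<=` ball t (rho n.+1).
    apply: le_ball; rewrite /rho le_min ge_min lexx/= ge_min.
    apply/orP; right; rewrite ler_pM2r// ler_eXn2l ?ltr1n//.
  rewrite (eint_split (mb (rho n)))//.
  apply: (@le_trans _ _ ((a * e * (5 - 4 / 2 ^+ n))%:E +
    (a / (4 ^+ n * eta) * (e * rho n.+1))%:E)%E).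
    apply: leeD => //; apply: bound.
    - exact: measurableD.
    - by move=> s [].
    - by rewrite divr_ge0// mulr_ge0 ?exprn_ge0// ltW.
    move=> s [Bs /= nBs]; have Bds := Bsub _ _ Bs.
    apply: (le_trans (Kb _ Bds)).
    have far : 2 ^+ n * eta <= `|s - t|.
      rewrite leNgt; apply/negP => h; apply: nBs.
      rewrite /ball /= distrC /rho lt_min h andbT.
      by move: Bds; rewrite /ball /= distrC.
    rewrite -mulrA ler_wpM2l// ler_pdivrMr ?ltr_wpDr ?exprn_gt0 ?sqr_ge0//.
    rewrite ler_pdivlMl ?mulr_gt0 ?exprn_gt0//.
    have : (2 ^+ n * eta) ^+ 2 <= (s - t) ^+ 2.
      rewrite -[leRHS]real_normK ?num_real// ler_pXn2r// nnegrE.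
      by rewrite mulr_ge0// ltW.
    rewrite exprMn -exprM mulnC exprM (_ : 2 ^+ 2 = 4 :> R); last by ring.
    have : 0 <= eta ^+ 2 by exact: sqr_ge0.
    rewrite -mulrA -expr2; lra.
  rewrite -EFinD lee_fin.
  have h : a / (4 ^+ n * eta) * (e * rho n.+1) <= a * e * (2 / 2 ^+ n).
    apply: (@le_trans _ _ (a / (4 ^+ n * eta) * (e * (2 ^+ n.+1 * eta)))).
      rewrite ler_wpM2l//; first by rewrite divr_ge0// mulr_ge0 ?exprn_ge0// ltW.
      by rewrite ler_wpM2l// ge_min lexx orbT.
    rewrite (_ : 4 = 2 * 2 :> R); last by ring.
    rewrite exprMn exprS le_eqVlt; apply/orP; left; apply/eqP.
    by field; rewrite !gt_eqF.
  apply: (le_trans (lerD (lexx _) h)).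
  rewrite -mulrDr ler_wpM2l ?mulr_ge0// exprS.
  by rewrite le_eqVlt; apply/orP; left; apply/eqP; field; rewrite gt_eqF.
have [n dn] : exists n, d <= 2 ^+ n * eta.
  exists (Num.bound (d / eta)); rewrite -ler_pdivrMr//.
  apply: (le_trans (ltW (archi_boundP (ltW (divr_gt0 d0 eta0))))).
  by rewrite -natrX ler_nat ltnW// ltn_expl.
have := step n; have -> : rho n = d by rewrite /rho min_l.
move=> /le_trans; apply; rewrite lee_fin (_ : 5 * a * e = a * e * 5); last by ring.
rewrite ler_wpM2l ?mulr_ge0// lerBlDr lerDl divr_ge0//.
Qed.

(** The Poisson kernel in terms of the angle u between the two points. *)
Definition poisson (r u : R) : R := (1 - r ^+ 2) / (1 - 2 * r * cos u + r ^+ 2).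

Lemma poisson_den (r u : R) :
  1 - 2 * r * cos u + r ^+ 2 = (1 - r) ^+ 2 + 2 * r * (1 - cos u).
Proof. ring. Qed.

Lemma poisson_den_gt0 (r u : R) : 0 <= r < 1 -> 0 < 1 - 2 * r * cos u + r ^+ 2.
Proof.
move=> /andP[r0 r1]; rewrite poisson_den ltr_wpDr//.
  by rewrite !mulr_ge0// subr_ge0 cos_le1.
by rewrite exprn_gt0// subr_gt0.
Qed.

Lemma poisson_ge0 (r u : R) : 0 <= r < 1 -> 0 <= poisson r u.
Proof.
move=> r01; rewrite divr_ge0//; last exact/ltW/poisson_den_gt0.
by move: r01 => /andP[r0 r1]; rewrite subr_ge0 expr_le1// ltW.
Qed.

Lemma continuous_poisson (r t : R) : 0 <= r < 1 ->
  continuous (fun s => poisson r (s - t)).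
Proof.
move=> r01 s; apply: cvgM; first exact: cvg_cst.
apply: cvgV; first by rewrite gt_eqF// poisson_den_gt0.
apply: cvgD; last exact: cvg_cst.
apply: cvgB; first exact: cvg_cst.
apply: cvgM; first exact: cvg_cst.
apply: (@continuous_comp _ _ _ (fun s : R => s - t) (@cos R)).
  by apply: cvgB; [exact: cvg_id|exact: cvg_cst].
exact: continuous_cos.
Qed.

Lemma Pkernel_cis (r s t : R) :
  Pkernel r (cis t) (cis s) = (poisson r (s - t))%:C.
Proof.
rewrite /Pkernel /poisson; congr (_%:C); congr (_ / _).
rewrite sqr_normcE !cReD !cImD !cReN !cImN -!mulrA !cReZ !cImZ.
rewrite !cReM !cImM /= cosB.
have h1 := cos2Dsin2 s; have h2 := cos2Dsin2 t.
transitivity (1 - 2 * r * (cos s * cos t + sin s * sin t) +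
  r ^+ 2 * ((cos s ^+ 2 + sin s ^+ 2) * (cos t ^+ 2 + sin t ^+ 2))).
  ring.
by rewrite h1 h2 !mulr1 !mulrA.
Qed.

(** 1 - cos u = 2 sin(u/2)^2, and sin v / v is at least 1/2 near 0 because its
    limit there, the derivative of the sine at 0, is 1. *)
Lemma one_sub_cos_lb : exists2 d : R, 0 < d &
  forall u : R, `|u| < d -> u ^+ 2 / 8 <= 1 - cos u.
Proof.
have ds : is_derive (0:R) (1:R) (@sin R) (cos 0) by exact: is_derive_sin.
have : h^-1 *: ((@sin R \o shift 0) (h *: (1:R)) - sin 0) @[h --> (0:R)^'] --> (1 : R).
  by have [dd dv] := ds; rewrite -[X in _ --> X](@cos0 R) -dv; exact: dd.
move=> /cvgrPdist_lt/(_ 2^-1); rewrite invr_gt0 ltr0n => /(_ isT).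
rewrite /dnbhs /within /= => -[d /= d0 Hd].
exists (2 * d); first by rewrite mulr_gt0.
move=> u ud; have [->|u0] := eqVneq u 0.
  by rewrite expr0n mul0r subr_ge0 cos_le1.
have := Hd (u / 2); rewrite /ball /= sub0r normrN normrM (ger0_norm (_ : 0 <= 2^-1))// ltr_pdivrMr// mulrC.
move=> /(_ ud); rewrite mulf_neq0// => /(_ isT).
rewrite sin0 subr0 /shift /= addr0 /GRing.scale /= mulr1 => H.
have H2 : 2^-1 <= (u / 2)^-1 * sin (u / 2).
  by move: H; rewrite ltr_norml => /andP[_]; lra.
have E : cos u = 1 - 2 * sin (u / 2) ^+ 2.
  have -> : u = (u / 2) *+ 2 by rewrite -mulr_natr divfK.
  rewrite cos_mulr2n cos2sin2 (_ : (u / 2) *+ 2 / 2 = u / 2); first by ring.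
  by rewrite -mulr_natr mulfK.
rewrite E.
have H3 : 2^-1 ^+ 2 <= ((u / 2)^-1 * sin (u / 2)) ^+ 2.
  by rewrite ler_pXn2r ?nnegrE ?invr_ge0//; apply: le_trans H2; rewrite invr_ge0.
have -> : 1 - (1 - 2 * sin (u / 2) ^+ 2) = u ^+ 2 / 2 * ((u / 2)^-1 * sin (u / 2)) ^+ 2.
  by field.
rewrite (_ : u ^+ 2 / 8 = u ^+ 2 / 2 * 2^-1 ^+ 2); last by field.
by rewrite ler_wpM2l// divr_ge0// sqr_ge0.
Qed.

Lemma cos_far (d u : R) : 0 < d <= pi -> d <= `|u| <= 2 * pi - d ->
  cos u <= cos d.
Proof.
move=> /andP[d0 dpi] /andP[du ud]; rewrite -cos_norm.
have dI : d \in `[0, pi] by rewrite in_itv/= (ltW d0).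
have [up|up] := leP `|u| pi.
  rewrite leNgt ltr_cos ?in_itv/= ?normr_ge0// -leNgt//.
have -> : cos `|u| = cos (2 * pi - `|u|).
  rewrite -[RHS]cosN opprB mulr_natl -[RHS](@cosD2pi R).
  by rewrite subrK.
rewrite leNgt ltr_cos// ?in_itv/= -?leNgt; lra.
Qed.

End PoissonFatou.

(** * Radial limits of Poisson integrals *)

Section PoissonFatouThm.
Context {R : realType}.
Notation mu := (@lebesgue_measure R).
Implicit Types (w : R -> R).
#[local] Hint Resolve measurable_arc measurable_arc_sigma : core.
#[local] Existing Instance ae_filter.

Lemma poisson_le (r u k : R) : 0 <= r < 1 -> 0 < k ->
  k <= 1 - 2 * r * cos u + r ^+ 2 -> poisson r u <= 2 * (1 - r) / k.
Proof.
move=> r01 k0 kd; have /andP[r0 r1] := r01.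
rewrite /poisson ler_pdivrMr ?poisson_den_gt0// mulrAC ler_pdivlMr//.
have h : (1 + r) * k <= 2 * (1 - 2 * r * cos u + r ^+ 2).
  by apply: ler_pM => //; [rewrite addr_ge0|exact: ltW|lra].
rewrite (_ : (1 - r ^+ 2) * k = (1 - r) * ((1 + r) * k)); last by ring.
rewrite (_ : 2 * (1 - r) * _ = (1 - r) * (2 * (1 - 2 * r * cos u + r ^+ 2))).
  by rewrite ler_wpM2l// subr_ge0 ltW.
by ring.
Qed.

Lemma poisson_bound (r u : R) : 0 <= r < 1 -> poisson r u <= 2 * (1 - r) / (1 - r) ^+ 2.
Proof.
move=> r01; have /andP[r0 r1] := r01.
apply: poisson_le => //; first by rewrite exprn_gt0// subr_gt0.
by rewrite poisson_den lerDl !mulr_ge0// subr_ge0 cos_le1.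
Qed.

Lemma realint_mul_poisson w (r t : R) : realint w -> 0 <= r < 1 ->
  realint (fun s => w s * poisson r (s - t)).
Proof.
move=> iw r01; pose M : R := 2 * (1 - r) / (1 - r) ^+ 2.
apply: (@realint_le _ _ (fun s => M * `|w s|)).
- apply: measurable_funM; first exact: realint_meas.
  by apply: continuous_measurable_arc; exact: continuous_poisson.
- move=> s _; rewrite normrM mulrC ler_wpM2r// ger0_norm ?poisson_ge0//.
  exact: poisson_bound.
- by apply: realintZ; exact: realint_norm.
Qed.

(** The Poisson integral of the constant 1 is its Cauchy integral, which is 1. *)
Lemma rint_poisson (r t : R) : 0 <= r < 1 -> rint (fun s => poisson r (s - t)) = 2 * pi.
Proof.
move=> r01; have /andP[r0 r1] := r01.
have z1 := normc_cis t.
have q1 : normc (r%:C * cis t) < 1 by rewrite normcM normcR z1 mulr1 ger0_norm.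
have I1 : integT (cst (1 : R[i])) by exact: integT_cst.
have E := @Pkernel_integral R (cst 1) r (cis t) I1 r01 z1.
have : intT (cst 1 \* Pkernel r (cis t)) = 1.
  rewrite E; last first.
    move=> k k0; rewrite -(intT_mono k0); congr intT.
    by apply/funext => w /=; rewrite mul1r.
  rewrite Cauchy_const ?intT_cst// => k k0.
  by rewrite /coef -mono0 dotT_mono; case: k k0.
move=> /(congr1 (fun z : R[i] => complex.Re z)); rewrite Re_intT.
rewrite (@eq_rint _ _ (fun s => poisson r (s - t))); last first.
  move=> s _.
  change (complex.Re (1 * Pkernel r (cis t) (cis s)) = poisson r (s - t)).
  by rewrite mul1r Pkernel_cis.
move=> H; have p0 : 2 * pi != 0 :> R by rewrite gt_eqF// twopi_gt0.
by rewrite -[LHS](mulVKf p0) H mulr1.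
Qed.

Lemma Poisson_deviation w (r t c : R) : realint w -> 0 <= r < 1 ->
  `|(2 * pi)^-1 * rint (fun s => w s * poisson r (s - t)) - c| <=
  (2 * pi)^-1 * rint (fun s => poisson r (s - t) * `|w s - c|).
Proof.
move=> iw r01.
have p0 : 2 * pi != 0 :> R by rewrite gt_eqF// twopi_gt0.
have ic : realint (fun s => c * poisson r (s - t)).
  exact: (realint_mul_poisson t (realint_cst c) r01).
have i1 : realint (fun s => poisson r (s - t)).
  have := realint_mul_poisson t (realint_cst 1) r01.
  by under eq_fun do rewrite mul1r.
have iwp := realint_mul_poisson t iw r01.
have -> : c = (2 * pi)^-1 * rint (fun s => c * poisson r (s - t)).
  by rewrite rintZ// rint_poisson// mulrCA mulVf// mulr1.
rewrite -mulrBr -rintB// normrM (ger0_norm twopiV_ge0) ler_wpM2l ?twopiV_ge0//.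
rewrite rintZ// rint_poisson// (mulrC _ (2 * pi)) (mulKf p0).
apply: rint_le_norm; first exact: realintB.
  under eq_fun do rewrite mulrC; apply: realint_mul_poisson => //.
  by apply: realint_norm; apply: realintB => //; exact: realint_cst.
move=> s _ /=; rewrite -mulrBl normrM mulrC ger0_norm//; exact: poisson_ge0.
Qed.

(** The Poisson kernel has mean 1, so the deviation from c = w(t) is at most
    the Poisson mean of |w - c|. On a small ball around t the averages of |w - c|
    are small because t is a Lebesgue point, and the dyadic estimate applies with
    a = 16. Away from that ball the kernel is O(1 - r), uniformly. Restricting to t
    in the interior of the arc keeps the ball inside the arc, so that no periodic
    extension of w is involved. *)
Lemma Poisson_lebesgue_pt w (t : R) : realint w -> 0 < t < 2 * pi ->
  lebesgue_pt (w \_ arc) t ->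
  (2 * pi)^-1 * rint (fun s => w s * poisson r (s - t)) @[r --> (1:R)^'-] --> w t.
Proof.
move=> iw /andP[t0 t2] Lt; set c := w t.
have at_ : arc t by rewrite /arc /= in_itv/= ltW.
pose W : R -> R := w \_ arc.
have Wt : W t = c by rewrite /W patchE mem_set.
pose psi (s : R) : R := `|W s - c|.
have mW : measurable_fun setT W.
  exact: (measurable_restrictT _ measurable_arc).1 (realint_meas iw).
have mpsi : measurable_fun setT psi.
  by apply: measurableT_comp => //; apply: measurable_funB.
have psi0 s : 0 <= psi s by exact: normr_ge0.
have [d1 d10 Hd1] := @one_sub_cos_lb R.
pose Psi := rint psi.
have ipsi : realint psi.
  apply: realint_norm; apply: realintB; last exact: realint_cst.
  have h : {in (arc : set (measurableTypeR R)), EFin \o w =1 EFin \o W}.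
    by move=> s; rewrite inE /= => as_; rewrite /W patchE mem_set.
  by apply: eq_integrable h _; [exact: measurable_arc_sigma|exact: iw].
have Psi0 : 0 <= Psi by apply: rint_ge0.
apply/cvgrPdistC_le => e e0.
(* The ball contributes 5 * 16 * (2 * e1) = 2 e / 5, and the rest at most e / 4. *)
pose e1 : R := e / 400.
have e10 : 0 < e1 by rewrite divr_gt0.
have [d2 d20 Hd2] : exists2 d2 : R, 0 < d2 & forall h, 0 < h < d2 ->
    (eint (ball t h) psi <= (2 * e1 * h)%:E)%E.
  have /fine_cvgP[fin /cvgrPdist_lt/(_ _ e10) H] := Lt.
  have FI := filterI fin H; move: FI => [d2 /= d20 Hd2].
  exists d2 => // h /andP[h0 hd].
  have hb : ball 0 d2 h by rewrite /ball /= sub0r normrN gtr0_norm.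
  have [fh lh] := Hd2 h hb h0.
  have h20 : 2 * h != 0 by rewrite mulf_neq0// gt_eqF.
  have E : davg W t h = (((2 * h)^-1)%:E * eint (ball t h) psi)%E.
    rewrite /davg /iavg lebesgue_measure_ball; last exact: ltW.
    rewrite inver mulrn_eq0/= gt_eqF//= mulr_natl; congr (_ * _)%E.
    by apply: eq_integral => s _; rewrite /psi /= Wt.
  have -> : eint (ball t h) psi = ((2 * h)%:E * davg W t h)%E.
    by rewrite E muleA -EFinM divff// mul1e.
  rewrite -(fineK fh) -EFinM lee_fin (_ : 2 * e1 * h = 2 * h * e1); last by ring.
  rewrite ler_wpM2l ?mulr_ge0 ?(ltW h0)//.
  by move: lh; rewrite /= sub0r normrN => /ltW; apply: le_trans; exact: ler_norm.
(* The bounds by t and 2 pi - t keep the ball inside the arc and make cos (s - t)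
   at most cos d outside of it. *)
pose d : R := Num.min d1 (Num.min (d2 / 2) (Num.min t (2 * pi - t))).
have d0 : 0 < d by rewrite !lt_min d10 divr_gt0//= t0 subr_gt0.
have dd1 : d <= d1 by rewrite ge_min lexx.
have dd2 : d < d2.
  apply: (@le_lt_trans _ _ (d2 / 2)); first by rewrite !ge_min lexx orbT.
  by rewrite ltr_pdivrMr// ltr_pMr// ltr1n.
have dt : d <= t by rewrite !ge_min lexx !orbT.
have dt2 : d <= 2 * pi - t by rewrite !ge_min lexx !orbT.
have dpi : d <= pi by lra.
(* lower bound, for r > 1/2, of the denominator of the kernel off the ball *)
pose k : R := 1 - cos d.
have k0 : 0 < k.
  rewrite subr_gt0 -cos0 ltr_cos ?in_itv/= ?lexx ?pi_ge0//.
  by rewrite (ltW d0).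
pose Bd : set (measurableTypeR R) := ball t d.
have mBd : measurable Bd by exact: measurable_ball.
have Barc : Bd `<=` arc.
  move=> s; rewrite /Bd /ball /= distrC ltr_norml /arc /= in_itv/= => /andP[h1 h2].
  by apply/andP; split; lra.
have eta00 : 0 < e * k / (8 * (Psi + 1)).
  by rewrite divr_gt0 ?mulr_gt0// ltr_wpDl.
near=> r.
have r1 : r < 1 by near: r; exact: nbhs_left_lt.
have r2 : 2^-1 < r.
  by near: r; apply: nbhs_left_gt; rewrite invf_lt1// ltr1n.
have r0 : 0 <= r by apply: ltW; apply: le_lt_trans r2; rewrite invr_ge0.
have reta : 1 - r < e * k / (8 * (Psi + 1)) by near: r; exact: nbhs_left_ltBl.
have r01 : 0 <= r < 1 by rewrite r0.
apply: (le_trans (Poisson_deviation t c iw r01)).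
set X := rint _.
have mK : measurable_fun setT (fun s : R => poisson r (s - t)).
  by apply: continuous_measurable_fun; exact: continuous_poisson.
have K0 s : 0 <= poisson r (s - t) by exact: poisson_ge0.
have iX : realint (fun s => poisson r (s - t) * `|w s - c|).
  under eq_fun do rewrite mulrC; apply: realint_mul_poisson => //.
  by apply: realint_norm; apply: realintB => //; exact: realint_cst.
have X0 : 0 <= X by apply: rint_ge0 => s _; rewrite mulr_ge0.
have XE : X%:E = eint arc (fun s : R => poisson r (s - t) * psi s).
  rewrite /X -EFin_rint//; apply: eq_integral => s; rewrite inE => as_.
  by rewrite /psi /W patchE mem_set.
have mKp : measurable_fun setT (fun s : R => poisson r (s - t) * psi s).
  exact: measurable_funM.
have Kp0 s : 0 <= poisson r (s - t) * psi s by rewrite mulr_ge0.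
have eta0 : 0 < 1 - r by rewrite subr_gt0.
have denlb u : (1 - r) ^+ 2 + (1 - cos u) <= 1 - 2 * r * cos u + r ^+ 2.
  rewrite poisson_den lerD2l ler_peMl ?subr_ge0 ?cos_le1//.
  lra.
have near_part : (eint Bd (fun s : R => poisson r (s - t) * psi s)%R <=
    (5 * 16 * (2 * e1))%:E)%E.
  apply: (@dyadic_estimate _ psi (fun s => poisson r (s - t)) t d (1 - r)) => //.
  - by rewrite mulr_ge0// ltW.
  - move=> s Bs.
    have su : `|s - t| < d1.
      by apply: lt_le_trans dd1; move: Bs; rewrite /ball /= distrC.
    have den0 : 0 < (1 - r) ^+ 2 + (s - t) ^+ 2.
      by rewrite ltr_wpDr ?sqr_ge0// exprn_gt0.
    have -> : 16 * (1 - r) / ((1 - r) ^+ 2 + (s - t) ^+ 2) =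
        2 * (1 - r) / (((1 - r) ^+ 2 + (s - t) ^+ 2) / 8).
      by field; rewrite gt_eqF.
    apply: poisson_le => //; first by rewrite divr_gt0.
    apply: le_trans (denlb _); have := Hd1 _ su; have := sqr_ge0 (1 - r).
    lra.
  - by move=> h /andP[h0 hd]; apply: Hd2; rewrite h0 (le_lt_trans hd).
have far_part : (eint (arc `\` Bd) (fun s : R => poisson r (s - t) * psi s)%R <=
    (2 * (1 - r) / k * Psi)%:E)%E.
  have c0 : 0 <= 2 * (1 - r) / k by rewrite divr_ge0 ?mulr_ge0// ltW.
  apply: (@le_trans _ _ (eint (arc `\` Bd) (fun s : R => 2 * (1 - r) / k * psi s)%R)).
    apply: eint_le => //; [exact: measurableD|exact: measurable_funM|].
    move=> s [as_ nBs]; rewrite ler_wpM2r//; apply: poisson_le => //.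
    apply: le_trans (denlb _).
    have : cos (s - t) <= cos d.
      apply: cos_far; first by rewrite d0.
      move: nBs; rewrite /Bd /ball /= distrC => /negP; rewrite -leNgt => ->/=.
      move: as_; rewrite /arc /= in_itv/= => /andP[s0 s2].
      by rewrite ler_norml; apply/andP; split; lra.
    by rewrite /k; have := sqr_ge0 (1 - r); lra.
  apply: (@le_trans _ _ (eint arc (fun s : R => 2 * (1 - r) / k * psi s)%R)).
    apply: eint_sub => //; [exact: measurableD|exact: measurable_funM|].
    by move=> s; rewrite mulr_ge0.
  by rewrite eintZ// [leRHS]EFinM /Psi -EFin_rint.
have : X <= 5 * 16 * (2 * e1) + 2 * (1 - r) / k * Psi.
  rewrite -lee_fin XE (eint_split mBd measurable_arc_sigma)// EFinD.
  exact: leeD.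
have : 2 * (1 - r) / k * Psi <= e / 4.
  rewrite mulrAC ler_pdivrMr//.
  apply: (@le_trans _ _ (2 * (e * k / (8 * (Psi + 1))) * Psi)).
    by rewrite ler_wpM2r// ler_wpM2l// ltW.
  have -> : 2 * (e * k / (8 * (Psi + 1))) * Psi = e / 4 * k * (Psi / (Psi + 1)).
    by field; rewrite gt_eqF// ltr_wpDl.
  rewrite ler_piMr ?mulr_ge0 ?(ltW e0) ?(ltW k0)//.
  by rewrite ler_pdivrMr ?mul1r ?lerDl// ltr_wpDl.
move=> h1 h2.
apply: (@le_trans _ _ X).
  rewrite ler_piMl// invf_le1 ?twopi_gt0//.
  have := @pi_ge2 R; lra.
by rewrite /e1 in h2; lra.
Unshelve. all: by end_near. Qed.

(** Almost every point is a Lebesgue point of the integrable function w. *)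
Theorem Poisson_Fatou w : realint w -> {ae mu, forall t, arc t ->
  (2 * pi)^-1 * rint (fun s => w s * poisson r (s - t)) @[r --> (1:R)^'-] --> w t}.
Proof.
move=> iw.
have lw : locally_integrable [set: R] (w \_ arc) by exact: integrable_locally.
have := lebesgue_differentiation lw.
have : {ae mu, forall t : R, t != 0}.
  exists [set 0]; split => //.
    exact: lebesgue_measure_set1.
  by move=> t /= /negP; rewrite negbK => /eqP.
apply: filterS2 => t t0 Lt; rewrite /arc /= in_itv/= => /andP[t1 t2].
by apply: Poisson_lebesgue_pt => //; rewrite lt_neqAle eq_sym t0 t1.
Qed.

End PoissonFatouThm.

(** * H^2 as the closure of the analytic polynomials *)

Section HardyCharacterization.
Context {R : realType}.
Notation mu := (@lebesgue_measure R).
Implicit Types (f g h : R[i] -> R[i]) (a b : nat -> R[i]).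
#[local] Hint Resolve measurable_arc measurable_arc_sigma : core.
#[local] Existing Instance ae_filter.

Definition Cauchy f : R[i] -> R[i] := fun z => intT (f \* Ckernel z).

Lemma cvg_Cauchy f z : integT f -> normc z < 1 ->
  ((\sum_(k < n) coef f k * z ^+ k : R[i]) : R[i]^o) @[n --> \oo] -->
  (Cauchy f z : R[i]^o).
Proof.
move=> If z1; apply/cvg_normcP => e e0.
set C : R := 2 * ((2 * pi)^-1 * ((1 - normc z)^-1 * rint (norm1 f))).
have c0 : C * normc z ^+ n @[n --> \oo] --> (0 : R).
  by apply: cvg_geo0; rewrite normc_ge0.
move/cvgrPdist_lt: c0 => /(_ e e0); apply: filterS => n; rewrite sub0r normrN => h.
rewrite normcBC; apply: le_lt_trans h; apply: le_trans (ler_norm _).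
apply: (le_trans (Cauchy_series n If z1)).
by rewrite le_eqVlt; apply/orP; left; apply/eqP; rewrite /C; ring.
Qed.

Lemma series_ordE a z n : series (fun k => a k * z ^+ k : R[i]^o) n =
  \sum_(k < n) a k * z ^+ k.
Proof. by rewrite seriesEord. Qed.

Lemma analyticD_Cauchy f : integT f -> analyticD (Cauchy f).
Proof.
move=> If; exists (coef f) => z z1; under eq_fun do rewrite series_ordE.
exact: cvg_Cauchy.
Qed.

Lemma normc_rz (r : R) z : 0 <= r < 1 -> normc z = 1 -> normc (r%:C * z) < 1.
Proof. by move=> /andP[r0 r1] z1; rewrite normcM normcR z1 mulr1 ger0_norm. Qed.

Lemma poly_dilate a (r : R) z n :
  \sum_(k < n) a k * (r%:C * z) ^+ k = poly (fun k => a k * r%:C ^+ k) n z.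
Proof. by rewrite /poly; apply: eq_bigr => k _; rewrite exprMn mulrA. Qed.

Lemma normc_dilate a (r : R) k : 0 <= r < 1 ->
  normc (a k * r%:C ^+ k) ^+ 2 <= normc (a k) ^+ 2.
Proof.
move=> /andP[r0 r1]; rewrite normcM normcX normcR ger0_norm//.
have := normc_ge0 (a k); set x := normc _ => x0.
rewrite exprMn ler_piMr ?sqr_ge0//.
by rewrite exprn_ile1 ?exprn_ge0// exprn_ile1// ltW.
Qed.

(** On the circle of radius r, the Cauchy integral is the pointwise limit of the
    dilated partial sums, whose norms are bounded by Bessel's inequality. *)
Lemma sqnorm_Cauchy_dilate f (r : R) : L2T f -> 0 <= r < 1 ->
  L2T (fun z => Cauchy f (r%:C * z)) /\
  sqnorm (fun z => Cauchy f (r%:C * z)) <= sqnorm f.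
Proof.
move=> Lf r01; have If := L2T_integ Lf.
have cv z : normc z = 1 -> (poly (fun k => coef f k * r%:C ^+ k) n z : R[i]^o)
    @[n --> \oo] --> (Cauchy f (r%:C * z) : R[i]^o).
  move=> z1; have := cvg_Cauchy If (normc_rz r01 z1).
  by under eq_fun do rewrite poly_dilate.
apply: (@sqnorm_fatou _ (poly (fun k => coef f k * r%:C ^+ k))).
- by move=> n; exact: L2T_poly.
- by apply: (measT_cvg _ cv) => n; exact/L2T_meas/L2T_poly.
- exact: aeT_all.
- move=> e e0; apply: nearW => n; rewrite sqnorm_poly.
  apply: (@le_trans _ _ (sqnorm f)); last by rewrite lerDl ltW.
  apply: le_trans (Bessel n Lf); apply: ler_sum => k _; exact: normc_dilate.
Qed.

Lemma hardy2D_Cauchy f : L2T f -> hardy2D (Cauchy f).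
Proof.
move=> Lf; split; first exact/analyticD_Cauchy/L2T_integ.
exists (2 * pi * sqnorm f) => r r01; have [Lr nr] := sqnorm_Cauchy_dilate Lf r01.
have := integral_sqn Lr; rewrite /sqn => ->.
by rewrite lee_fin ler_pM2l// twopi_gt0.
Qed.

Lemma near1 : \forall r \near (1:R)^'-, 0 <= r < 1.
Proof.
near=> r; apply/andP; split; first by near: r; exact: nbhs_left_ge.
by near: r; exact: nbhs_left_lt.
Unshelve. all: by end_near. Qed.

(** Fatou's theorem. Without Fourier coefficients of negative index, the Cauchy
    integral is a Poisson integral, which has radial limits almost everywhere. *)
Lemma boundary_Cauchy f : integT f ->
  (forall k, (0 < k)%N -> intT (f \* mono k) = 0) -> boundary (Cauchy f) f.
Proof.
move=> If f0; have [f1 f2] := If.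
have := Poisson_Fatou f2; have := Poisson_Fatou f1.
rewrite /boundary /aeT; apply: filterS2 => t h1 h2 at_.
have {}h1 := h1 at_; have {}h2 := h2 at_.
have E1 r s : complex.Re ((f \* Pkernel r (cis t)) (cis s)) =
    complex.Re (f (cis s)) * poisson r (s - t).
  change (complex.Re (f (cis s) * Pkernel r (cis t) (cis s)) =
    complex.Re (f (cis s)) * poisson r (s - t)).
  by rewrite Pkernel_cis mulrC cReZ mulrC.
have E2 r s : complex.Im ((f \* Pkernel r (cis t)) (cis s)) =
    complex.Im (f (cis s)) * poisson r (s - t).
  change (complex.Im (f (cis s) * Pkernel r (cis t) (cis s)) =
    complex.Im (f (cis s)) * poisson r (s - t)).
  by rewrite Pkernel_cis mulrC cImZ mulrC.
apply/cvg_ReIm; split.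
  apply: cvg_trans h1; apply: near_eq_cvg; near=> r.
  have r01 : 0 <= r < 1 by near: r; exact: near1.
  rewrite /Cauchy -Pkernel_integral ?normc_cis// Re_intT; congr (_ * _).
  by apply: eq_rint => s _; rewrite E1.
apply: cvg_trans h2; apply: near_eq_cvg; near=> r.
have r01 : 0 <= r < 1 by near: r; exact: near1.
rewrite /Cauchy -Pkernel_integral ?normc_cis// Im_intT; congr (_ * _).
by apply: eq_rint => s _; rewrite E2.
Unshelve. all: by end_near. Qed.

(** Membership in the closed span of the monomials of nonnegative degree, with the
    coefficients made explicit. *)
Definition analyticL2 a f := L2T f /\ cvgL2 (poly a) f.

Lemma analyticL2_boundary a f : analyticL2 a f -> boundary (Cauchy f) f.
Proof.
move=> [Lf af]; apply: boundary_Cauchy; first exact: L2T_integ.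
by move=> k k0; exact: analytic_anticoef af k0.
Qed.

Lemma analyticL2_H2p a f : analyticL2 a f -> H2p f.
Proof.
move=> af; have [Lf _] := af; split => //.
by exists (Cauchy f); [exact: hardy2D_Cauchy|exact: analyticL2_boundary af].
Qed.

Lemma cvg_normc_unique T (F : set_system T) (FF : ProperFilter F)
    (u : T -> R[i]^o) (l l' : R[i]^o) : u @ F --> l -> u @ F --> l' -> l = l'.
Proof.
move=> /cvg_ReIm[a1 a2] /cvg_ReIm[b1 b2].
by apply: ComplexP; [exact: (cvg_unique _ a1 b1)|exact: (cvg_unique _ a2 b2)].
Qed.

(** The terms of a convergent series are bounded; so the coefficients are dominated
    by a geometric sequence, square summable on every smaller circle. *)
Lemma power_series_bounded a (rho : R) l :
  (series (fun k => a k * rho%:C ^+ k : R[i]^o) n @[n --> \oo] --> (l : R[i]^o)) ->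
  exists C : R, forall k, normc (a k * rho%:C ^+ k) <= C.
Proof.
move=> /cvg_ReIm[c1 c2].
have b1 := @cvg_seq_bounded _ _ _ (cvgP _ c1).
have b2 := @cvg_seq_bounded _ _ _ (cvgP _ c2).
have [C1 HC1] : exists C1 : R, forall n,
    `|complex.Re (series (fun k => a k * rho%:C ^+ k : R[i]^o) n)| <= C1.
  have [M [_ HM]] := b1; exists (M + 1) => n; apply: HM => //; by rewrite ltrDl.
have [C2 HC2] : exists C2 : R, forall n,
    `|complex.Im (series (fun k => a k * rho%:C ^+ k : R[i]^o) n)| <= C2.
  have [M [_ HM]] := b2; exists (M + 1) => n; apply: HM => //; by rewrite ltrDl.
have S n : normc (\sum_(k < n) a k * rho%:C ^+ k) <= C1 + C2.
  rewrite -series_ordE; apply: (le_trans (normc_le_ReIm _)).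
  by apply: lerD; [exact: HC1|exact: HC2].
exists ((C1 + C2) + (C1 + C2)) => k.
have -> : a k * rho%:C ^+ k =
    \sum_(j < k.+1) a j * rho%:C ^+ j - \sum_(j < k) a j * rho%:C ^+ j.
  by rewrite big_ord_recr/= addrAC subrr add0r.
by apply: (le_trans (normcD _ _)); rewrite normc_opp lerD.
Qed.

Lemma sum_geo_le (q C : R) N : 0 <= q < 1 -> 0 <= C ->
  \sum_(k < N) C * q ^+ k <= C / (1 - q).
Proof.
move=> /andP[q0 q1] C0.
rewrite -mulr_sumr ler_wpM2l// -[leLHS]mulr1 -[X in _ * X](divff (_ : 1 - q != 0)).
  rewrite mulrA ler_piMl ?invr_ge0 ?subr_ge0 ?(ltW q1)//.
  by rewrite mulrC -opprB mulNr -subrX1 opprB gerBl exprn_ge0.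
by rewrite subr_eq0 gt_eqF.
Qed.

(** The polynomials converge in L^2 because the dilated coefficients are square
    summable, and pointwise to F on the circle of radius r; the limits agree, as
    a subsequence converges almost everywhere to the L^2 limit. *)
Lemma dilate_analyticL2 a F (r : R) : (forall z, normc z < 1 ->
    series (fun k => a k * z ^+ k : R[i]^o) n @[n --> \oo] --> (F z : R[i]^o)) ->
  0 <= r < 1 ->
  analyticL2 (fun k => a k * r%:C ^+ k) (fun z => F (r%:C * z)).
Proof.
move=> aF r01; have /andP[r0 r1] := r01.
pose b k := a k * r%:C ^+ k.
(* a radius strictly between r and 1 *)
pose rho : R := (r + 1) / 2.
have rrho : r < rho by rewrite /rho; lra.
have rho1 : rho < 1 by rewrite /rho; lra.
have rho0 : 0 < rho by apply: le_lt_trans rrho.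
have nrho : normc rho%:C < 1 by rewrite normcR gtr0_norm.
have [C HC] := power_series_bounded (aF _ nrho).
have C0 : 0 <= C by apply: le_trans (HC 0%N); exact: normc_ge0.
pose q : R := (r / rho) ^+ 2.
have q01 : 0 <= q < 1.
  rewrite sqr_ge0 /q expr_lt1//; first by rewrite ltr_pdivrMr// mul1r.
  by apply: divr_ge0 => //; exact: ltW.
have bq k : normc (b k) ^+ 2 <= C ^+ 2 * q ^+ k.
  rewrite /q -exprM mulnC exprM -exprMn ler_pXn2r ?nnegrE ?normc_ge0//; last first.
    by rewrite mulr_ge0// exprn_ge0// divr_ge0// ltW.
  have := HC k; rewrite /b !normcM !normcX !normcR (ger0_norm r0) (gtr0_norm rho0).
  move=> h; rewrite expr_div_n mulrA ler_pdivlMr ?exprn_gt0//.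
  by rewrite mulrAC ler_wpM2r// exprn_ge0.
have sb N : \sum_(k < N) normc (b k) ^+ 2 <= C ^+ 2 / (1 - q).
  apply: le_trans (sum_geo_le N q01 (sqr_ge0 C)).
  by apply: ler_sum => k _; exact: bq.
have [g [s [Lg bg sj sg]]] := RieszFischer (L2T_poly b) (cauchy_poly sb).
have cv z : normc z = 1 ->
    (poly b n z : R[i]^o) @[n --> \oo] --> (F (r%:C * z) : R[i]^o).
  move=> z1; have := aF _ (normc_rz r01 z1).
  by under eq_fun do rewrite series_ordE poly_dilate.
have mF : measT (fun z => F (r%:C * z)).
  by apply: (measT_cvg _ cv) => n; exact/L2T_meas/L2T_poly.
have Fg : eqT (fun z => F (r%:C * z)) g.
  apply: aeTS2 (aeT_all cv) sg => z cz gz.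
  apply/esym/(cvg_normc_unique _ gz).
  apply: (cvg_comp _ _ _ cz).
  by apply/cvgnyPge => A; exists A => // j /= Aj; exact: leq_trans (sj j).
have LF : L2T (fun z => F (r%:C * z)) by exact: L2T_eqT mF (eqT_sym Fg) Lg.
split => //; apply: cvg_trans bg; apply: near_eq_cvg; apply: nearW => n.
apply: eq_sqnorm.
- by apply/L2T_meas/L2TB => //; exact: L2T_poly.
- by apply/L2T_meas/L2TB => //; exact: L2T_poly.
by move: Fg; apply: aeTS => z /= ->.
Qed.

Lemma cvg_psum (c : nat -> R) N (r : nat -> R) :
  r j @[j --> \oo] --> (1 : R) ->
  \sum_(k < N) c k * r j ^+ k @[j --> \oo] --> \sum_(k < N) c k.
Proof.
move=> r1; elim: N => [|N IH].
  by rewrite big_ord0; under eq_fun do rewrite big_ord0; exact: cvg_cst.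
rewrite big_ord_recr/=; under eq_fun do rewrite big_ord_recr/=.
apply: cvgD => //; rewrite -[X in _ --> X]mulr1 -(expr1n R N).
apply: cvgM; first exact: cvg_cst.
exact: (cvg_comp _ _ r1 (@exprn_continuous _ _ _)).
Qed.

(** The coefficients a_k r^k of the dilations of F have square sums bounded
    independently of r; letting r tend to 1, the a_k are square summable and define
    a function g of L^2. The Cauchy integral of g has the same power series as F, so
    f and g are radial limits of the same function. *)
Lemma H2p_analyticL2 f : H2p f -> exists a, analyticL2 a f.
Proof.
move=> [Lf [F [[a aF] [M FM]] Ff]]; exists a.
have M1 (r : R) N : 0 <= r < 1 ->
    \sum_(k < N) normc (a k) ^+ 2 * (r ^+ 2) ^+ k <= (2 * pi)^-1 * M.
  move=> r01; have [Lr ar] := dilate_analyticL2 aF r01.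
  have := FM r r01; have := integral_sqn Lr; rewrite /sqn => ->.
  rewrite lee_fin => nM; have p0 : 2 * pi != 0 :> R by rewrite gt_eqF// twopi_gt0.
  apply: (@le_trans _ _ (sqnorm (fun z => F (r%:C * z)))); last first.
    by rewrite -[leLHS](mulKf p0) ler_wpM2l// twopiV_ge0.
  apply: le_trans (Bessel N Lr); apply: ler_sum => k _.
  rewrite /coef (analytic_coef k Lr ar) normcM normcX normcR [leRHS]exprMn.
  by case/andP: r01 => r0 _; rewrite (ger0_norm r0) -!exprM mulnC.
have B N : \sum_(k < N) normc (a k) ^+ 2 <= (2 * pi)^-1 * M.
  pose r (j : nat) : R := 1 - j.+1%:R^-1.
  have r01 j : 0 <= r j < 1.
    by rewrite /r subr_ge0 invf_le1// ler1n/= ltrBlDr ltrDl invr_gt0.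
  have r1 : r j ^+ 2 @[j --> \oo] --> (1 : R).
    have : r j @[j --> \oo] --> (1 - 0 : R).
      by apply: cvgB; [exact: cvg_cst|exact: cvg_harmonic].
    rewrite subr0 => h; rewrite -[X in _ --> X](expr1n R 2).
    exact: (cvg_comp _ _ h (@exprn_continuous _ _ _)).
  have c := cvg_psum (c := fun k => normc (a k) ^+ 2) (N := N) r1.
  rewrite -(cvg_lim _ c)//; apply: limr_le; first by apply/cvg_ex; eexists; exact: c.
  by apply: nearW => j; exact: M1.
have [g [_ [Lg ag _ _]]] := RieszFischer (L2T_poly a) (cauchy_poly B).
have Gg := analyticL2_boundary (conj Lg ag).
have FG z : normc z < 1 -> F z = Cauchy g z.
  move=> z1; apply: (cvg_normc_unique _ (aF _ z1)).
  have := cvg_Cauchy (L2T_integ Lg) z1; apply: cvg_trans; apply: near_eq_cvg.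
  apply: nearW => n; rewrite series_ordE; apply: eq_bigr => k _.
  by rewrite /coef (analytic_coef k Lg ag).
have fg : eqT f g.
  have aT : aeT (fun z : R[i] => normc z = 1) by exact: aeT_all.
  apply: (aeTS3 _ Ff Gg aT) => z fz gz z1.
  apply: (cvg_normc_unique _ fz); apply: cvg_trans gz; apply: near_eq_cvg.
  near=> r; rewrite FG// normc_rz//; near: r; exact: near1.
split => //; apply: cvg_trans ag; apply: near_eq_cvg; apply: nearW => n.
apply: eq_sqnorm.
- by apply/L2T_meas/L2TB => //; exact: L2T_poly.
- by apply/L2T_meas/L2TB => //; exact: L2T_poly.
by move: fg; apply: aeTS => z /= ->.
Unshelve. all: by end_near. Qed.

(** From here on, H^2 is handled through this description, in which it is visibly a
    closed subspace; radial limits no longer occur. *)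
Lemma H2pP f : H2p f <-> exists a, analyticL2 a f.
Proof. by split=> [/H2p_analyticL2//|[a /analyticL2_H2p]]. Qed.

End HardyCharacterization.

(** * Projection onto H^2 and multiplication by H^infinity *)

Section HardySpace.
Context {R : realType}.
Implicit Types (f g h u : R[i] -> R[i]) (a b : nat -> R[i]).
#[local] Existing Instance ae_filter.

Lemma H2p_L2T f : H2p f -> L2T f.
Proof. by case. Qed.

Lemma H2p_eqT f g : measT g -> eqT f g -> H2p f -> H2p g.
Proof.
move=> mg fg [Lf [F HF Ff]]; split; first exact: L2T_eqT fg Lf.
exists F; first exact: HF.
by move: fg Ff; apply: aeTS2 => z fgz; rewrite fgz.
Qed.

Lemma H2pD f g : H2p f -> H2p g -> H2p (f \+ g).
Proof.
move=> /H2pP[a [Lf af]] /H2pP[b [Lg bg]]; apply/H2pP.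
exists (fun k => a k + b k); split; first exact: L2TD.
have := cvgL2D (L2T_poly a) (L2T_poly b) Lf Lg af bg.
suff -> : (fun n => poly a n \+ poly b n) = poly (fun k => a k + b k) by [].
apply/funext => n; apply/funext => z; rewrite /poly /= -big_split.
by apply: eq_bigr => k _; rewrite mulrDl.
Qed.

Lemma H2pZ (c : R[i]) f : H2p f -> H2p (fun z => c * f z).
Proof.
move=> /H2pP[a [Lf af]]; apply/H2pP.
exists (fun k => c * a k); split; first exact: L2TZ.
have := cvgL2Z c (L2T_poly a) Lf af.
suff -> : (fun n z => c * poly a n z) = poly (fun k => c * a k) by [].
apply/funext => n; apply/funext => z; rewrite /poly mulr_sumr.
by apply: eq_bigr => k _; rewrite mulrA.
Qed.

Lemma H2pN f : H2p f -> H2p (\- f).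
Proof.
move=> /(H2pZ (-1)); suff -> : (fun z => -1 * f z) = \- f by [].
by apply/funext => z; rewrite mulN1r.
Qed.

Lemma H2pB f g : H2p f -> H2p g -> H2p (f \- g).
Proof. by move=> Hf Hg; exact: (H2pD Hf (H2pN Hg)). Qed.

Lemma H2p0 f : H2p f -> H2p (cst (0 : R[i])).
Proof.
move=> /(H2pZ 0); suff -> : (fun z => 0 * f z) = cst 0 by [].
by apply/funext => z; rewrite mul0r.
Qed.

Lemma dotT_poly_orth f b n : L2T f -> (forall k, dotT f (mono k) = 0) ->
  dotT (poly b n) f = 0.
Proof.
move=> Lf f0; elim: n => [|n IH].
  rewrite (_ : poly b 0 = (fun z => 0 * mono 0 z)); last first.
    by apply/funext => z; rewrite /poly big_ord0 mul0r.
  by rewrite dotTZl ?mul0r//; exact: L2T_mono.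
rewrite polyS dotTDl//; [|exact: L2T_poly|by apply: L2TZ; exact: L2T_mono].
rewrite IH add0r dotTZl//; last exact: L2T_mono.
rewrite dotTJ//; last exact: L2T_mono.
by rewrite f0 conjc0 mulr0.
Qed.

(** The projection is the sum of the part of the Fourier series with nonnegative
    indices, which converges by Bessel's inequality and the Riesz-Fischer theorem. *)
Lemma H2p_projection f : L2T f ->
  exists g, H2p g /\ forall h, H2p h -> dotT (f \- g) h = 0.
Proof.
move=> Lf.
have [g [_ [Lg cg _ _]]] := RieszFischer (L2T_poly (coef f))
  (cauchy_poly (fun N => Bessel N Lf)).
exists g; split; first by apply/H2pP; exists (coef f).
move=> h /H2pP[b [Lh bh]]; have Lfg := L2TB Lf Lg.
have o k : dotT (f \- g) (mono k) = 0.
  rewrite dotTBl//; last exact: L2T_mono.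
  by rewrite (analytic_coef k Lg cg) subrr.
rewrite dotTJ// (cvgL2_dot_cst (c := 0) (L2T_poly b) Lh Lfg bh) ?conjc0//.
by apply: nearW => n; exact: dotT_poly_orth.
Qed.

Lemma eqT_sqnormB f g : L2T f -> L2T g -> sqnorm (f \- g) = 0 -> eqT f g.
Proof.
move=> Lf Lg /(sqnorm_eq0 (L2TB Lf Lg)); apply: aeTS => z /= /eqP.
by rewrite subr_eq0 => /eqP.
Qed.

(** The difference of f and its projection is a limit of elements of H^2, to which
    it is orthogonal; so it is orthogonal to itself. *)
Lemma H2p_closed (u : nat -> R[i] -> R[i]) f : (forall n, H2p (u n)) ->
  L2T f -> cvgL2 u f -> H2p f.
Proof.
move=> Hu Lf uf; have [g [Hg og]] := H2p_projection Lf.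
have Lg := H2p_L2T Hg; have Lfg := L2TB Lf Lg.
have Lu n := H2p_L2T (Hu n).
suff fg : eqT f g by exact: H2p_eqT (L2T_meas Lf) (eqT_sym fg) Hg.
apply: eqT_sqnormB => //; rewrite /sqnorm.
rewrite (_ : dotT (f \- g) (f \- g) = 0)//.
apply: (cvgL2_dot_cst (u := fun n => u n \- g)) => //.
- by move=> n; exact: L2TB.
- apply: cvg_trans uf; apply: near_eq_cvg; apply: nearW => n.
  suff -> : u n \- g \- (f \- g) = u n \- f by [].
  by apply/funext => z /=; ring.
- apply: nearW => n; have Hn := H2pB (Hu n) Hg.
  by rewrite (dotTJ Lfg (H2p_L2T Hn)) (og _ Hn) conjc0.
Qed.

Lemma H2p_mulz f : H2p f -> H2p (mono 1 \* f).
Proof.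
move=> /H2pP[a [Lf af]]; apply/H2pP.
pose b k := if k is k'.+1 then a k' else 0.
have E n : poly b n.+1 = mono 1 \* poly a n.
  apply/funext => z; rewrite /poly big_ord_recl mul0r add0r [RHS]/= mulr_sumr.
  by apply: eq_bigr => k _; rewrite lift0 /= /mono expr1 exprS; ring.
have m1 : aeT (fun z : R[i] => normc (mono 1 z) <= 1).
  by apply: aeT_all => z z1; rewrite normc_mono.
exists b; split; first exact: L2T_mul (measT_mono 1) Lf m1.
have := cvgL2_mul (L2T_poly a) Lf (measT_mono 1) m1 af.
rewrite /cvgL2 => h.
rewrite -(cvg_shiftS (fun n => sqnorm (poly b n \- mono 1 \* f))).
by under eq_fun do rewrite E.
Qed.

Lemma H2p_mulmono k f : H2p f -> H2p (mono k \* f).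
Proof.
move=> Hf; elim: k => [|k IH].
  suff -> : mono 0 \* f = f by [].
  by apply/funext => z; rewrite mono0 /= mul1r.
suff -> : mono k.+1 \* f = mono 1 \* (mono k \* f) by exact: H2p_mulz.
by apply/funext => z; rewrite -add1n monoD /= mulrA.
Qed.

Lemma H2p_mulpoly b n f : H2p f -> H2p (poly b n \* f).
Proof.
move=> Hf; elim: n => [|n IH].
  suff -> : poly b 0 \* f = cst 0 by exact: H2p0 Hf.
  by apply/funext => z; rewrite /poly /= big_ord0 mul0r.
suff -> : poly b n.+1 \* f = (poly b n \* f) \+ (fun z => b n * (mono n \* f) z).
  exact: (H2pD IH (H2pZ (b n) (H2p_mulmono n Hf))).
by apply/funext => z; rewrite polyS /= mulrDl mulrA.
Qed.

Lemma normc_cvg_le T (F : set_system T) (FF : ProperFilter F) (v : T -> R[i]^o)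
  (l : R[i]^o) (M : R) : v @ F --> l -> (\forall x \near F, normc (v x) <= M) ->
  normc l <= M.
Proof.
move=> /cvg_normcP vl vM; rewrite leNgt; apply/negP => Ml.
have d0 : 0 < normc l - M by rewrite subr_gt0.
have [x [h1 h2]] := filter_ex (filterI (vl _ d0) vM).
have := normcD (l - v x) (v x); rewrite subrK normcBC.
move: h1 h2; lra.
Qed.

Lemma Hinf_meas u : Hinf u -> measT u.
Proof. by case. Qed.

Lemma Hinf_LinfT u : Hinf u -> LinfT u.
Proof.
move=> [mu_ [F [aF [M FM]] Fu]]; split => //; exists M.
have aT : aeT (fun z : R[i] => normc z = 1) by exact: aeT_all.
move: Fu aT; apply: aeTS2 => z cz z1; apply: normc_cvg_le cz _.
near=> r; apply: FM; apply: normc_rz => //; near: r; exact: near1.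
Unshelve. all: by end_near. Qed.

Lemma LinfT_L2T u : LinfT u -> L2T u.
Proof.
move=> Lu; have := L2T_mulLinf Lu (L2T_cst 1).
suff -> : u \* cst 1 = u by [].
by apply/funext => z; rewrite /= mulr1.
Qed.

(** A bounded analytic function satisfies the growth condition of the Hardy space. *)
Lemma Hinf_H2p u : Hinf u -> H2p u.
Proof.
move=> Hu; have := Hu => -[mu_ [F [aF [M FM]] Fu]].
split; first exact/LinfT_L2T/Hinf_LinfT.
exists F => //; split => //; exists (2 * pi * M ^+ 2) => r r01.
have [a Fa] := aF; have [Lr _] := dilate_analyticL2 Fa r01.
have := integral_sqn Lr; rewrite /sqn => ->.
rewrite lee_fin ler_pM2l ?twopi_gt0//; apply: sqnorm_le_bound => // z z1.
by apply: FM; exact: normc_rz.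
Qed.

(** Products with polynomials lie in H^2 because the monomials act on it, and u is
    a bounded multiplier: approximate h by polynomials and use that H^2 is closed. *)
Lemma Hinf_mul_H2p u h : Hinf u -> H2p h -> H2p (u \* h).
Proof.
move=> Hu /H2pP[b [Lh bh]]; have [mu_ [M uM]] := Hinf_LinfT Hu.
have Hup := Hinf_H2p Hu.
apply: (@H2p_closed (fun n => u \* poly b n)).
- move=> n; suff -> : u \* poly b n = poly b n \* u by exact: H2p_mulpoly.
  by apply/funext => z /=; rewrite mulrC.
- exact: L2T_mul mu_ Lh uM.
- exact: cvgL2_mul (L2T_poly b) Lh mu_ uM bh.
Qed.

Lemma LinfTJ u : LinfT u -> LinfT (conjT u).
Proof.
move=> [mu_ [M uM]]; split; first exact: measTJ.
by exists M; apply: aeTS uM => z; rewrite /conjT normc_conj.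
Qed.

Lemma cHinf_LinfT u : cHinf u -> LinfT u.
Proof. by move=> /Hinf_LinfT/LinfTJ; rewrite conjTK. Qed.

Lemma dotT_adj u f g : dotT (u \* f) g = dotT f (conjT u \* g).
Proof.
congr intT; apply/funext => z; rewrite /conjT /= conjM conjcK; ring.
Qed.

Lemma H2m_L2T f : H2m f -> L2T f.
Proof. by case. Qed.

Lemma H2m_eqT f g : measT g -> eqT f g -> H2m f -> H2m g.
Proof.
move=> mg fg [Lf of_]; split; first exact: L2T_eqT fg Lf.
move=> h Hh; rewrite -(of_ h Hh); have mh := L2T_meas (H2p_L2T Hh).
by apply: eq_dotT => //; [exact: L2T_meas|exact: eqT_sym|exact: eqT_refl].
Qed.

Lemma H2mD f g : H2m f -> H2m g -> H2m (f \+ g).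
Proof.
move=> [Lf of_] [Lg og]; split; first exact: L2TD.
by move=> h Hh; rewrite dotTDl ?of_ ?og ?addr0//; exact: H2p_L2T.
Qed.

Lemma H2mN f : H2m f -> H2m (\- f).
Proof.
move=> [Lf of_]; split; first exact: L2TN.
by move=> h Hh; rewrite dotTNl ?of_ ?oppr0//; exact: H2p_L2T.
Qed.

Lemma H2mB f g : H2m f -> H2m g -> H2m (f \- g).
Proof. by move=> Hf Hg; exact: (H2mD Hf (H2mN Hg)). Qed.

(** Multiplication by u is the adjoint of multiplication by conj(u), which
    preserves H^2. *)
Lemma cHinf_mul_H2m u f : cHinf u -> H2m f -> H2m (u \* f).
Proof.
move=> Hu [Lf of_]; split; first exact: L2T_mulLinf (cHinf_LinfT Hu) Lf.
by move=> h Hh; rewrite dotT_adj; exact: (of_ _ (Hinf_mul_H2p Hu Hh)).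
Qed.

End HardySpace.

(** * Nonzero functions of H^2 are nonzero almost everywhere *)

Section Uniqueness.
Context {R : realType}.
Implicit Types (f g h u : R[i] -> R[i]).
#[local] Existing Instance ae_filter.

(** The hypothesis says that |g|^2, a real function, has all its Fourier
    coefficients zero except the mean. Its Cauchy integral is then constant, and has
    |g|^2 as radial limits by Fatou's theorem. *)
Lemma constant_modulus g : L2T g ->
  (forall m, (0 < m)%N -> dotT (mono m \* g) g = 0) ->
  aeT (fun z => normc (g z) ^+ 2 = sqnorm g).
Proof.
move=> Lg og; pose G := g \* conjT g.
have IG : integT G by exact: integT_mulJ.
have G0 k : (0 < k)%N -> intT (G \* mono k) = 0.
  move=> k0; rewrite -(og k k0); apply: eq_intT_circle => z _.
  by rewrite /G /= mulrC mulrA.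
have GJ z : conjc (G z) = G z by rewrite /G /conjT /= conjM conjcK mulrC.
have cG k : (0 < k)%N -> coef G k = 0.
  move=> k0; rewrite /coef /dotT.
  have -> : G \* conjT (mono k) = conjT (G \* mono k).
    apply/funext => z; change (G z * conjc (mono k z) = conjc (G z * mono k z)).
    by rewrite conjM GJ.
  rewrite intTJ ?G0 ?conjc0//.
  apply: (@integT_mulb _ _ _ 1 IG (measT_mono k)) => w w1.
  by rewrite normc_mono.
have aT : aeT (fun z : R[i] => normc z = 1) by exact: aeT_all.
move: (boundary_Cauchy IG G0) aT; apply: aeTS2 => z bz z1.
have e : intT G = G z.
  apply: (cvg_normc_unique _ _ bz).
  apply/cvg_normcP => e e0; near=> r.
  have r01 : 0 <= r < 1 by near: r; exact: near1.
  by rewrite /Cauchy (Cauchy_const IG (normc_rz r01 z1) cG) subrr normc0.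
have Gz : G z = (normc (g z) ^+ 2)%:C by exact: mulJc.
have := congr1 (fun x : R[i] => complex.Re x) e.
by rewrite Gz => h; apply: esym; exact: h.
Unshelve. all: by end_near. Qed.

(** Moving g by a small multiple of h against their inner product would decrease
    its norm. *)
Lemma minimal_orthogonal g h : L2T g -> L2T h ->
  (forall c : R[i], sqnorm g <= sqnorm (g \+ (fun z => c * h z))) -> dotT h g = 0.
Proof.
move=> Lg Lh gmin; rewrite dotTJ//; set c := dotT g h.
(* the optimal step is 1 / sqnorm h; adding 1 avoids a division by 0 *)
pose t : R := (sqnorm h + 1)^-1.
have h0 := sqnorm_ge0 h; have h1 : 0 < sqnorm h + 1 by rewrite ltr_wpDl.
have := gmin (- (t%:C * c)).
rewrite sqnormD//; last exact: L2TZ.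
rewrite sqnormZ// dotTZr// -/c conjN conjM conjc_real mulNr cReN.
rewrite -(mulrA t%:C) (mulrC (conjc c)) mulJc.
rewrite cReZ normc_opp normcM normcR exprMn real_normK ?num_real//.
move=> H; suff : normc c ^+ 2 <= 0.
  move=> q; have /eqP : normc c ^+ 2 = 0 by apply/eqP; rewrite eq_le q sqr_ge0.
  by rewrite sqrf_eq0 normc_eq0 => /eqP ->; rewrite conjc0.
have t0 : 0 < t by rewrite invr_gt0.
have th : t * sqnorm h <= 1 by rewrite /t ler_pdivrMl// mulr1 lerDl.
have c0 := sqr_ge0 (normc c).
rewrite -(pmulr_rle0 _ t0).
have : t * (t * sqnorm h * normc c ^+ 2) <= t * (normc c ^+ 2).
  by rewrite ler_pM2l// ler_piMl.
have -> : t * (t * sqnorm h * normc c ^+ 2) = t ^+ 2 * normc c ^+ 2 * sqnorm h by ring.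
move: H; set A := t * normc c ^+ 2; set B := t ^+ 2 * _ * _; lra.
Qed.

(** By the parallelogram identity, a minimizing sequence in a convex set is Cauchy.
    The closedness hypothesis also provides convergence almost everywhere along a
    subsequence, for conditions that are stated pointwise. *)
Lemma minimal_norm (S : set (R[i] -> R[i])) : S !=set0 ->
  (forall g, S g -> L2T g) ->
  (forall g h, S g -> S h -> S (fun z => 2^-1 * (g z + h z))) ->
  (forall (v : nat -> R[i] -> R[i]) g s, (forall n, S (v n)) -> L2T g ->
     cvgL2 v g ->
     aeT (fun z => (v (s j) z : R[i]^o) @[j --> \oo] --> (g z : R[i]^o)) -> S g) ->
  exists2 g, S g & forall h, S h -> sqnorm g <= sqnorm h.
Proof.
move=> [f Sf] SL Smid Scl.
pose E : set R := [set sqnorm g | g in S].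
have hE : has_inf E.
  split; first by exists (sqnorm f), f.
  by exists 0 => _ [g _ <-]; exact: sqnorm_ge0.
pose d := inf E.
have dE g : S g -> d <= sqnorm g.
  by move=> Sg; apply: inf_lbound; [case: hE|exists g].
have /choice[v Hv] : forall n : nat, exists g,
    S g /\ sqnorm g < d + n.+1%:R^-1.
  move=> n.
  have e0 : 0 < n.+1%:R^-1 :> R by rewrite invr_gt0.
  by have [_ [g Sg <-] gd] := inf_adherent e0 hE; exists g.
have Sv n : S (v n) by have [] := Hv n.
have Lv n := SL _ (Sv n).
have bound m n : sqnorm (v m \- v n) <= 2 * (m.+1%:R^-1 + n.+1%:R^-1).
  (* the midpoint belongs to S, so its norm is at least the infimum d *)
  have mid := dE _ (Smid _ _ (Sv m) (Sv n)).
  have := sqnormZ (2^-1) (L2TD (Lv m) (Lv n)).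
  have -> : normc (2^-1 : R[i]) = 2^-1 :> R.
    rewrite (_ : 2^-1 = (2^-1 : R)%:C); first by rewrite normcR ger0_norm.
    by rewrite fmorphV rmorph_nat.
  move=> h; rewrite h in mid.
  have [_ a] := Hv m; have [_ b] := Hv n.
  move: mid; rewrite sqnormD// sqnormB//.
  have -> : 2^-1 ^+ 2 = 4^-1 :> R by field.
  set x := complex.Re _; set A := m.+1%:R^-1 in a *; set B := n.+1%:R^-1 in b *.
  lra.
have [g [s [Lg vg _ sg]]] : exists f s, [/\ L2T f, cvgL2 v f,
    forall j, (j <= s j)%N &
    aeT (fun z => (v (s j) z : R[i]^o) @[j --> \oo] --> (f z : R[i]^o))].
  apply: RieszFischer => // e e0.
  pose N := Num.bound (4 / e).
  have Ne n : (N <= n)%N -> n.+1%:R^-1 <= e / 4.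
    move=> Nn; rewrite -[leRHS]invrK lef_pV2 ?posrE ?invr_gt0 ?divr_gt0//.
    rewrite invf_div; apply: (le_trans (ltW (archi_boundP _))).
      by rewrite divr_ge0// ltW.
    by rewrite ler_nat (leq_trans Nn).
  exists N => m n /Ne hm /Ne hn; apply: (le_trans (bound m n)).
  by move: hm hn; set A := m.+1%:R^-1; set B := n.+1%:R^-1; lra.
have Sg : S g by exact: Scl sg.
exists g => // h Sh; apply: le_trans (dE _ Sh).
have c := cvgL2_sqnorm Lv Lg vg.
have c' : d + n.+1%:R^-1 @[n --> \oo] --> (d + 0 : R).
  by apply: cvgD; [exact: cvg_cst|exact: cvg_harmonic].
rewrite addr0 in c'.
rewrite -(cvg_lim _ c)// -(cvg_lim _ c')//.
apply: ler_lim; [by apply/cvg_ex; eexists; exact: c|by apply/cvg_ex; eexists; exact: c'|].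
by apply: nearW => n; apply: ltW; have [] := Hv n.
Qed.

Lemma dotT0 h : dotT (cst 0) h = 0.
Proof.
apply: etrans (intT_cst 0); congr intT; apply/funext => z; exact: mul0r.
Qed.

Lemma coef_mulmono m g k : H2p g ->
  coef (mono m \* g) k = if (m <= k)%N then coef g (k - m) else 0.
Proof.
move=> Hg; case: leqP => mk.
  by rewrite /coef -{1}(subnKC mk) monoD dotT_mulmono.
have /H2pP[a [Lg ag]] := Hg.
rewrite -(analytic_anticoef Lg ag (k := m - k)); last by rewrite subn_gt0.
apply: eq_intT_circle => z z1.
rewrite /conjT /= -{1}(subnKC (ltnW mk)) monoD /=.
have := mulJc (mono k z); rewrite normc_mono// expr1n => h.
transitivity (g z * mono (m - k) z * (mono k z * conjc (mono k z))); first ring.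
by rewrite h mulr1.
Qed.

(** Let a_k be the first nonzero Fourier coefficient of f. Among the functions of
    H^2 that vanish where f does and have the same coefficients as f up to index k,
    take g of minimal norm. For m > 0, adding a multiple of z^m g to g changes neither
    condition, so g is orthogonal to z^m g and has constant modulus. As a_k is not 0,
    that constant is not 0: g vanishes almost nowhere, hence neither does f. *)
Lemma H2p_neq0 f : H2p f -> ~ eqT f (cst 0) -> aeT (fun z => f z != 0).
Proof.
move=> Hf f0; have [a [Lf af]] := (H2pP f).1 Hf.
have [k0 ak0 kmin] : exists2 k, a k != 0 & forall j, (j < k)%N -> a j = 0.
  have ex : exists k, a k != 0.
    apply: contrapT => na; apply: f0; apply: sqnorm_eq0 => //.
    have az k : a k = 0 by apply/eqP; apply: contrapT => /negP h; apply: na; exists k.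
    have := cvgL2_sqnorm (L2T_poly a) Lf af => c.
    rewrite -(cvg_lim _ c)//; under eq_fun do rewrite sqnorm_poly.
    rewrite (_ : (fun _ => _) = cst 0) ?lim_cst//.
    apply/funext => n; apply: big1 => k _; by rewrite az normc0 expr0n.
  have [k ak km] := ex_minnP ex; exists k => // j jk.
  by apply/eqP; apply: contrapT => /negP /km; rewrite leqNgt jk.
pose S : set (R[i] -> R[i]) := [set g | [/\ H2p g,
  aeT (fun z => f z = 0 -> g z = 0) &
  forall j, (j <= k0)%N -> coef g j = coef f j]].
have Cf j : coef f j = a j by rewrite /coef (analytic_coef j Lf af).
have Lm := @L2T_mono R.
have [g [Hg gf Cg] gmin] : exists2 g, S g & forall h, S h -> sqnorm g <= sqnorm h.
  apply: minimal_norm.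
  - by exists f; split => //; exact: aeT_all.
  - by move=> g [/H2p_L2T].
  - move=> g h [Hg gf Cg] [Hh hf Ch]; split.
    + exact: (H2pZ 2^-1 (H2pD Hg Hh)).
    + by move: gf hf; apply: aeTS2 => z gz hz fz; rewrite gz// hz// addr0 mulr0.
    + move=> j jk; rewrite /coef.
      rewrite (dotTZl 2^-1 (L2TD (H2p_L2T Hg) (H2p_L2T Hh)) (Lm j)).
      rewrite (dotTDl (H2p_L2T Hg) (H2p_L2T Hh) (Lm j)).
      rewrite -/(coef g j) -/(coef h j) -/(coef f j) Cg// Ch//; by field.
  - move=> v g s Sv Lg vg sg; split.
    + have Hv n : H2p (v n) by have [] := Sv n.
      exact: (H2p_closed Hv Lg vg).
    + have vf : aeT (fun z => forall n, f z = 0 -> v n z = 0).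
        by apply: aeT_forall => n; have [] := Sv n.
      move: vf sg; apply: aeTS2 => z vz gz fz.
      apply: (cvg_normc_unique _ gz).
      by under eq_fun do rewrite vz//; exact: cvg_cst.
    + move=> j jk; apply: (cvgL2_dot_cst _ Lg (Lm j) vg).
        by move=> n; have [/H2p_L2T] := Sv n.
      by apply: nearW => n; have [_ _] := Sv n; apply.
have Lg := H2p_L2T Hg.
have og m : (0 < m)%N -> dotT (mono m \* g) g = 0.
  move=> m0; have Hm := H2p_mulmono m Hg.
  apply: (minimal_orthogonal Lg (H2p_L2T Hm)) => c; apply: gmin; split.
  - exact: H2pD Hg (H2pZ c Hm).
  - by move: gf; apply: aeTS => z gz fz; rewrite /= gz// !mulr0 addr0.
  - move=> j jk; rewrite /coef.
    rewrite (dotTDl Lg (L2TZ c (H2p_L2T Hm)) (Lm j)).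
    rewrite (dotTZl c (H2p_L2T Hm) (Lm j)) -/(coef g j).
    rewrite -/(coef (mono m \* g) j) coef_mulmono// Cg//.
    case: leqP => mj; last by rewrite mulr0 addr0.
    rewrite Cg; last by rewrite (leq_trans (leq_subr _ _)).
    rewrite -/(coef f j) [coef f (j - m)%N]Cf kmin ?mulr0 ?addr0//.
    by apply: (leq_trans _ jk); rewrite ltn_subrL m0 (leq_trans m0).
have gk0 : coef g k0 = a k0 by rewrite Cg.
have ng : sqnorm g != 0.
  apply/eqP => /(sqnorm_eq0 Lg) g0; move: ak0; rewrite -gk0 /coef.
  rewrite (eq_dotT (L2T_meas Lg) (measT_cst 0) (measT_mono k0) (measT_mono k0)
    g0 (eqT_refl _)).
  by rewrite dotT0 eqxx.
move: gf (constant_modulus Lg og); apply: aeTS2 => z gz cz.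
by apply/eqP => /gz g0; move: cz; rewrite g0 normc0 expr0n /= => /esym/eqP; rewrite (negbTE ng).
Qed.

End Uniqueness.

(** * Orthogonal projections and model spaces *)

Section Projections.
Context {R : realType}.
Implicit Types (f g h u : R[i] -> R[i]) (M : set (R[i] -> R[i])).
#[local] Existing Instance ae_filter.

Definition has_proj M f :=
  exists g, M g /\ forall h, M h -> dotT (f \- g) h = 0.

Lemma projP M f : has_proj M f ->
  M (proj M f) /\ forall h, M h -> dotT (f \- proj M f) h = 0.
Proof. by move=> ex; exact: (xgetPex (cst 0) ex). Qed.

Lemma proj_eq0 M f : (forall g, M g -> L2T g) -> L2T f -> has_proj M f ->
  eqT (proj M f) (cst 0) <-> forall h, M h -> dotT f h = 0.
Proof.
move=> ML Lf /projP[Mp op]; have Lp := ML _ Mp; split=> [p0 h Mh|o].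
  rewrite -[RHS](op _ Mh) (dotTBl Lf Lp (ML _ Mh)).
  have mh := L2T_meas (ML _ Mh).
  rewrite (eq_dotT (L2T_meas Lp) (measT_cst 0) mh mh p0 (eqT_refl _)).
  by rewrite dotT0 subr0.
apply: sqnorm_eq0 => //; have := op _ Mp.
rewrite (dotTBl Lf Lp Lp) (o _ Mp) sub0r => /eqP; rewrite oppr_eq0 => /eqP e.
by rewrite /sqnorm e.
Qed.

Lemma proj_eqT M f g : (forall g, M g -> L2T g) ->
  (forall g h, M g -> M h -> M (g \- h)) -> L2T f ->
  M g -> (forall h, M h -> dotT (f \- g) h = 0) -> eqT (proj M f) g.
Proof.
move=> ML MB Lf Mg og; have ex : has_proj M f by exists g.
have [Mp op] := projP ex.
have Lp := ML _ Mp; have Lg := ML _ Mg.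
apply: eqT_sqnormB => //; have Mpg := MB _ _ Mp Mg; have Lpg := ML _ Mpg.
rewrite /sqnorm (_ : dotT _ _ = 0)//.
have h1 := op _ Mpg; have h2 := og _ Mpg.
rewrite (dotTBl Lp Lg Lpg).
move: h1 h2; rewrite (dotTBl Lf Lp Lpg) (dotTBl Lf Lg Lpg).
move=> /subr0_eq <- /subr0_eq <-; exact: subrr.
Qed.

Lemma H2p_has_proj f : L2T f -> has_proj H2p f.
Proof. exact: H2p_projection. Qed.

Lemma Pp_H2p f : L2T f -> H2p (Pp f).
Proof. by move=> /H2p_has_proj/projP[]. Qed.

Lemma Pp_H2m f : L2T f -> H2m (f \- Pp f).
Proof.
move=> Lf; have [Hp op] := projP (H2p_has_proj Lf); split; last exact: op.
exact: L2TB Lf (H2p_L2T Hp).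
Qed.

Lemma H2m_orth f g : H2m f -> H2p g -> dotT g f = 0.
Proof.
move=> Hf Hg; rewrite (dotTJ (H2m_L2T Hf) (H2p_L2T Hg)).
by case: Hf => _ of_; rewrite (of_ _ Hg) conjc0.
Qed.

Lemma Pp_sum g h : H2p g -> H2m h -> eqT (Pp (g \+ h)) g.
Proof.
move=> Hg Hh; apply: proj_eqT.
- exact: H2p_L2T.
- exact: H2pB.
- exact: L2TD (H2p_L2T Hg) (H2m_L2T Hh).
- exact: Hg.
- suff -> : (g \+ h) \- g = h by case: Hh.
  by apply/funext => z /=; rewrite addrAC subrr add0r.
Qed.

Lemma Pm_sum g h : H2p g -> H2m h -> eqT (Pm (g \+ h)) h.
Proof.
move=> Hg Hh; apply: proj_eqT.
- exact: H2m_L2T.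
- exact: H2mB.
- exact: L2TD (H2p_L2T Hg) (H2m_L2T Hh).
- exact: Hh.
- move=> k Hk; suff -> : (g \+ h) \- h = g by exact: H2m_orth.
  by apply/funext => z /=; rewrite addrK.
Qed.

Lemma Pm_H2m f : L2T f -> H2m (Pm f).
Proof.
move=> Lf; suff /projP[] : has_proj H2m f by [].
exists (f \- Pp f); split; first exact: Pp_H2m.
move=> h Hh; suff -> : f \- (f \- Pp f) = Pp f.
  exact: H2m_orth Hh (Pp_H2p Lf).
by apply/funext => z /=; rewrite opprB addrC subrK.
Qed.

(** P^+ and P^- split f into its components g in H^2_+ and h in H^2_-, so the
    kernel is described by these components alone. *)
Lemma kerSpP a b g : kerSp a b g <->
  H2p g /\ exists2 h, H2m h & eqT (a \* g \+ b \* h) (cst 0).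
Proof.
split=> [[[mg _] [f [Lf Sf] gP]]|[Hg [h Hh e]]].
  have Hp := Pp_H2p Lf; split; first exact: H2p_eqT mg (eqT_sym gP) Hp.
  exists (Pm f); first exact: Pm_H2m.
  by move: gP Sf; apply: aeTS2 => z /= ->.
split; first exact: H2p_L2T.
exists (g \+ h); last exact/eqT_sym/Pp_sum.
split; first exact: L2TD (H2p_L2T Hg) (H2m_L2T Hh).
move: (Pp_sum Hg Hh) (Pm_sum Hg Hh) e; apply: aeTS3 => z.
by rewrite /opS /= => -> ->.
Qed.

Lemma kertoeplitzP s g : LinfT s ->
  kertoeplitz s g <-> H2p g /\ H2m (s \* g).
Proof.
move=> Ls; split=> -[Hg e]; split=> //; have Lsg := L2T_mulLinf Ls (H2p_L2T Hg).
  split; first exact: Lsg.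
  exact/(proj_eq0 (@H2p_L2T R) Lsg (H2p_has_proj Lsg)).
by apply/(proj_eq0 (@H2p_L2T R) Lsg (H2p_has_proj Lsg)) => h; case: e => _; exact.
Qed.

Lemma inner_Hinf u : inner u -> Hinf u.
Proof. by case. Qed.

Lemma inner_LinfT u : inner u -> LinfT u.
Proof. by move=> /inner_Hinf/Hinf_LinfT. Qed.

Lemma inner_mulJ u : inner u -> aeT (fun z => u z * conjc (u z) = 1).
Proof. by case=> _; apply: aeTS => z uz; rewrite mulJc uz expr1n. Qed.

(** Being orthogonal to theta H^2_+ is, for conj(theta) f, being orthogonal to
    H^2_+, since multiplication by conj(theta) is the adjoint of multiplication by
    theta. *)
Lemma modelKP theta f : inner theta ->
  modelK theta f <-> H2p f /\ H2m (conjT theta \* f).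
Proof.
move=> it; have Lt := LinfTJ (inner_LinfT it).
split=> -[Hf o]; split; try exact: Hf.
  split; first exact: L2T_mulLinf Lt (H2p_L2T Hf).
  move=> h Hh; rewrite dotT_adj conjTK; apply: o.
  have H := Hinf_mul_H2p (inner_Hinf it) Hh.
  by split; [exact: H2p_L2T|exists h => //; exact: eqT_refl].
move=> g [Lg [h Hh e]].
have Lth := H2p_L2T (Hinf_mul_H2p (inner_Hinf it) Hh).
rewrite (eq_dotT (L2T_meas (H2p_L2T Hf)) (L2T_meas (H2p_L2T Hf)) (L2T_meas Lg)
  (L2T_meas Lth) (eqT_refl _) e).
have -> : dotT f (theta \* h) = dotT (conjT theta \* f) h.
  by rewrite dotT_adj conjTK.
by case: o => _; exact.
Qed.

Lemma modelK_L2T theta f : modelK theta f -> L2T f.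
Proof. by case=> [[]]. Qed.

(** P_theta = P^+ - theta P^+ conj(theta) P^+: the component p is the projection
    of conj(theta) P^+ f. *)
Lemma modelK_decomposition theta f : inner theta -> L2T f ->
  exists g p m, [/\ modelK theta g, H2p p, H2m m &
    eqT f (m \+ theta \* p \+ g)].
Proof.
move=> it Lf; have Hp := Pp_H2p Lf; have Hm := Pp_H2m Lf.
have LJ := LinfTJ (inner_LinfT it).
have Lq := L2T_mulLinf LJ (H2p_L2T Hp).
have Hq := Pp_H2p Lq; have Hqm := Pp_H2m Lq.
pose q := Pp (conjT theta \* Pp f).
have Htq : H2p (theta \* q) by exact: Hinf_mul_H2p (inner_Hinf it) Hq.
exists (Pp f \- theta \* q), q, (f \- Pp f); split.
- apply/(modelKP _ it); split; first exact: H2pB.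
  apply: H2m_eqT Hqm.
    apply: L2T_meas; apply: L2T_mulLinf LJ _; apply: H2p_L2T; exact: H2pB.
  move: (inner_mulJ it); apply: aeTS => z e.
  rewrite /= -/q mulrBr mulrA [conjT theta z * theta z]mulrC.
  by rewrite [theta z * _]e mul1r.
- exact: Hq.
- exact: Hm.
- apply: aeT_all => z _ /=; ring.
Qed.

Lemma modelK_orth theta g p m : inner theta -> modelK theta g -> H2p p ->
  H2m m -> dotT (m \+ theta \* p) g = 0.
Proof.
move=> it Kg Hp Hm; have [Hg Hgm] := (modelKP g it).1 Kg.
have Htp := Hinf_mul_H2p (inner_Hinf it) Hp.
rewrite (dotTDl (H2m_L2T Hm) (H2p_L2T Htp) (H2p_L2T Hg)).
case: (Hm) => _ om; rewrite (om _ Hg) add0r dotT_adj.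
exact: H2m_orth Hgm Hp.
Qed.

Lemma modelK_has_proj theta f : inner theta -> L2T f -> has_proj (modelK theta) f.
Proof.
move=> it Lf; have [g [p [m [Kg Hp Hm e]]]] := modelK_decomposition it Lf.
have Lg := modelK_L2T Kg.
have Htp := Hinf_mul_H2p (inner_Hinf it) Hp.
have Lmp := L2TD (H2m_L2T Hm) (H2p_L2T Htp).
exists g; split => // h Kh; have mh := L2T_meas (modelK_L2T Kh).
rewrite -(modelK_orth it Kh Hp Hm).
apply: (eq_dotT (L2T_meas (L2TB Lf Lg)) (L2T_meas Lmp) mh mh _ (eqT_refl _)).
by move: e; apply: aeTS => z /= ->; rewrite addrK.
Qed.

(** L^2 is the orthogonal sum of H^2_-, K_theta and theta H^2_+, so the orthogonal
    complement of K_theta consists of the two outer components. *)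
Lemma modelK_orthP theta f : inner theta -> L2T f ->
  (forall h, modelK theta h -> dotT f h = 0) <->
  exists p m, [/\ H2p p, H2m m & eqT f (m \+ theta \* p)].
Proof.
move=> it Lf; split=> [orth|[p [m [Hp Hm e]]] h Kh].
  have [g [p [m [Kg Hp Hm e]]]] := modelK_decomposition it Lf.
  exists p, m; split=> //; have Lg := modelK_L2T Kg.
  have Htp := Hinf_mul_H2p (inner_Hinf it) Hp.
  have Lmp := L2TD (H2m_L2T Hm) (H2p_L2T Htp).
  have := orth _ Kg.
  rewrite (eq_dotT (L2T_meas Lf) (L2T_meas (L2TD Lmp Lg)) (L2T_meas Lg)
    (L2T_meas Lg) e (eqT_refl _)) (dotTDl Lmp Lg Lg) (modelK_orth it Kg Hp Hm).
  rewrite add0r => gg; have g0 : eqT g (cst 0).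
    by apply: sqnorm_eq0 => //; rewrite /sqnorm gg.
  by move: e g0; apply: aeTS2 => z /= -> ->; rewrite addr0.
rewrite -(modelK_orth it Kh Hp Hm).
have Htp := Hinf_mul_H2p (inner_Hinf it) Hp.
have Lmp := L2TD (H2m_L2T Hm) (H2p_L2T Htp).
have mh := L2T_meas (modelK_L2T Kh).
exact: (eq_dotT (L2T_meas Lf) (L2T_meas Lmp) mh mh e (eqT_refl _)).
Qed.

Lemma modelK_proj_id theta f : modelK theta f ->
  inner theta -> eqT (proj (modelK theta) f) f.
Proof.
move=> Kf it; have Lf := modelK_L2T Kf; apply: proj_eqT => //.
- exact: modelK_L2T.
- move=> g h /(modelKP _ it)[Hg Hgm] /(modelKP _ it)[Hh Hhm].
  apply/(modelKP _ it); split; first exact: H2pB.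
  suff -> : conjT theta \* (g \- h) = (conjT theta \* g) \- (conjT theta \* h).
    exact: H2mB.
  by apply/funext => z /=; rewrite mulrBr.
- move=> h Kh; have -> : f \- f = cst 0 by apply/funext => z /=; rewrite subrr.
  exact: dotT0.
Qed.

(** P_alpha kills phi f exactly when phi f lies in the orthogonal complement
    H^2_- + alpha H^2_+ of K_alpha. *)
Lemma kerATTOP theta alpha phi f : inner theta -> inner alpha -> LinfT phi ->
  kerATTO theta alpha phi f <->
  [/\ H2p f, H2m (conjT theta \* f) &
      exists p m, [/\ H2p p, H2m m & eqT (phi \* f) (m \+ alpha \* p)]].
Proof.
move=> it ia Lphi.
have key : modelK theta f -> eqT (ATTO theta alpha phi f) (cst 0) <->
    exists p m, [/\ H2p p, H2m m & eqT (phi \* f) (m \+ alpha \* p)].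
  move=> Kf; have Lf := modelK_L2T Kf; have e := modelK_proj_id Kf it.
  have [Kp _] := projP (modelK_has_proj it Lf).
  have Lpp := L2T_mulLinf Lphi (modelK_L2T Kp).
  rewrite /ATTO (proj_eq0 (@modelK_L2T alpha) Lpp (modelK_has_proj ia Lpp)).
  rewrite (modelK_orthP ia Lpp).
  by split=> -[p [m [Hp Hm e']]]; exists p, m; split=> //; move: e e';
    apply: aeTS2 => z /= ->.
rewrite /kerATTO; split=> [[Kf /(key Kf) ex]|[Hf Hm ex]].
  by have [Hf Hm] := (modelKP f it).1 Kf.
have Kf : modelK theta f by apply/(modelKP f it).
by split=> //; apply/(key Kf).
Qed.

End Projections.

(** * The kernel of the truncated Toeplitz operator *)

Section KernelATTO.
Context {R : realType}.
Implicit Types (f g h u : R[i] -> R[i]).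
#[local] Existing Instance ae_filter.

Lemma LinfTM u v : LinfT u -> LinfT v -> LinfT (u \* v : R[i] -> R[i]).
Proof.
move=> [mu_ [M uM]] [mv [N vN]]; split; first exact: measTM.
exists (M * N); move: uM vN; apply: aeTS2 => z a b.
by rewrite /= normcM ler_pM// normc_ge0.
Qed.

Lemma Hinf_neq0 u : Hinf u -> ~ eqT u (cst 0) -> aeT (fun z => u z != 0).
Proof. by move=> Hu; apply: H2p_neq0; exact: Hinf_H2p. Qed.

Lemma cHinf_neq0 u : cHinf u -> ~ eqT u (cst 0) -> aeT (fun z => u z != 0).
Proof.
move=> Hu u0; have : aeT (fun z => conjT u z != 0).
  apply: Hinf_neq0 => // h; apply: u0; apply: aeTS h => z /= h.
  by rewrite -[u z]conjcK -/(conjT u z) h conjc0.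
by apply: aeTS => z; apply: contra => /eqP uz; rewrite /conjT uz conjc0.
Qed.

Lemma inner_neq0 u : inner u -> aeT (fun z => u z != 0).
Proof.
by case=> _; apply: aeTS => z uz; rewrite -normc_eq0 uz oner_eq0.
Qed.

(** The corona relation replaces f by (A c + B d) f, where the factor A f equals
    - B g: every term contains B. This is the pointwise step that removes the
    denominators. *)
Lemma corona_divide (A B c d f g : R[i]) : B != 0 -> A * c + B * d = 1 ->
  g = - (A / B * f) -> f = B * (d * f - c * g).
Proof.
move=> B0 cor ->; transitivity ((A * c + B * d) * f); first by rewrite cor mul1r.
by field.
Qed.

Section Kernel.
Context (theta alpha A1 B1 A2 B2 : R[i] -> R[i]).
Context (htheta : inner theta) (halpha : inner alpha).
Context (hCPp : CPp A2 B2) (hCPm : CPm A1 B1).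
Context (hB2 : ~ eqT B2 (cst 0)) (hB1 : ~ eqT B1 (cst 0)).
Context (hphi : LinfT (symbol theta alpha A1 B1 A2 B2)).
Context (hS : setS alpha A1 B1 A2 B2 = zeroT).

Let HA2 : Hinf A2. Proof. by case: hCPp. Qed.
Let HB2 : Hinf B2. Proof. by case: hCPp. Qed.
Let HA1 : cHinf A1. Proof. by case: hCPm. Qed.
Let HB1 : cHinf B1. Proof. by case: hCPm. Qed.

(** If phi f = m + alpha p, then
    alpha (p + (A2 / B2) f) = - m + (A1 / B1) conj(theta) f
    is an element of S, hence 0. Therefore p = - (A2 / B2) f and
    m = (A1 / B1) conj(theta) f, and the two corona relations divide f by B2 and
    conj(theta) f by B1. *)
Lemma kerATTO_sub f : kerATTO theta alpha (symbol theta alpha A1 B1 A2 B2) f ->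
  exists g h, [/\ H2p g, H2m h, eqT f (B2 \* g) &
    eqT (conjT theta \* f) (B1 \* h)].
Proof.
move=> /(kerATTOP _ htheta halpha hphi)[Hf Hk [p [m [Hp Hm e]]]].
have [_ _ [c2 [d2 [Hc2 Hd2 cor2]]]] := hCPp.
have [_ _ [c1 [d1 [Hc1 Hd1 cor1]]]] := hCPm.
have mA2 := Hinf_meas HA2; have mB2 := Hinf_meas HB2.
have mp := L2T_meas (H2p_L2T Hp); have mf := L2T_meas (H2p_L2T Hf).
have ma := Hinf_meas (inner_Hinf halpha).
pose k := conjT theta \* f.
pose X := alpha \* (p \+ divT A2 B2 \* f).
have mX : measT X by exact: (measTM ma (measTD mp (measTM (measT_div mA2 mB2) mf))).
(* phi f = m + alpha p, rearranged: both sides belong to S *)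
have X2 : eqT X (cst 1 \* (\- m \+ divT A1 B1 \* k)).
  move: e; apply: aeTS => z; rewrite /symbol /X /k /= => e.
  rewrite mul1r mulrDr; apply/eqP; rewrite -subr_eq0; apply/eqP.
  transitivity (m z + alpha z * p z -
    (conjT theta z * divT A1 B1 z - alpha z * divT A2 B2 z) * f z); first ring.
  by rewrite e subrr.
have : setS alpha A1 B1 A2 B2 X.
  split; split=> //.
    by exists p, f; split; [exact: Hp|exact: Hf|exact: eqT_refl].
  by exists (\- m), k; split; [exact: H2mN|exact: Hk|exact: X2].
rewrite hS => -[_ X0].
have nB2 := Hinf_neq0 HB2 hB2; have nB1 := cHinf_neq0 HB1 hB1.
have pE : aeT (fun z => p z = - (A2 z / B2 z * f z)).
  move: X0 (inner_neq0 halpha); apply: aeTS2 => z; rewrite /X /divT /=.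
  move=> /eqP; rewrite mulf_eq0 => /orP[/eqP -> /eqP//|/eqP H _].
  by apply/eqP; rewrite -addr_eq0 H.
have mE : aeT (fun z => - m z = - (A1 z / B1 z * k z)).
  move: X0 X2; apply: aeTS2 => z -> /=; rewrite mul1r /divT => /esym/eqP.
  by rewrite addr_eq0 => /eqP.
exists (d2 \* f \- c2 \* p), (d1 \* k \- c1 \* (\- m)); split.
- exact: H2pB (Hinf_mul_H2p Hd2 Hf) (Hinf_mul_H2p Hc2 Hp).
- exact: H2mB (cHinf_mul_H2m Hd1 Hk) (cHinf_mul_H2m Hc1 (H2mN Hm)).
- by move: nB2 cor2 pE; apply: aeTS3 => z; exact: corona_divide.
- by move: nB1 cor1 mE; apply: aeTS3 => z; exact: corona_divide.
Qed.

(** Conversely phi f = A1 h - alpha A2 g, with A1 h in H^2_- and A2 g in H^2_+. *)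
Lemma kerATTO_sup f g h : measT f -> H2p g -> H2m h -> eqT f (B2 \* g) ->
  eqT (conjT theta \* f) (B1 \* h) ->
  kerATTO theta alpha (symbol theta alpha A1 B1 A2 B2) f.
Proof.
move=> mf Hg Hh fg fh; apply/(kerATTOP _ htheta halpha hphi).
have HBg := Hinf_mul_H2p HB2 Hg; have HBh := cHinf_mul_H2m HB1 Hh.
have mtf := measTM (measTJ (Hinf_meas (inner_Hinf htheta))) mf.
split.
- exact: H2p_eqT mf (eqT_sym fg) HBg.
- exact: H2m_eqT mtf (eqT_sym fh) HBh.
exists (\- (A2 \* g)), (A1 \* h); split.
- exact/H2pN/Hinf_mul_H2p.
- exact: cHinf_mul_H2m.
have nB2 := Hinf_neq0 HB2 hB2; have nB1 := cHinf_neq0 HB1 hB1.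
have e2 : aeT (fun z => A2 z / B2 z * f z = A2 z * g z).
  by move: nB2 fg; apply: aeTS2 => z B0 ->; rewrite /= mulrA divfK.
have e1 : aeT (fun z => A1 z / B1 z * (conjT theta z * f z) = A1 z * h z).
  by move: nB1 fh; apply: aeTS2 => z B0 /= ->; rewrite mulrA divfK.
move: e1 e2; apply: aeTS2 => z /= <-; rewrite mulrN => <-.
rewrite /symbol /divT /=; ring.
Qed.

Lemma kerATTOE : kerATTO theta alpha (symbol theta alpha A1 B1 A2 B2) =
  mulset B2 (kerSp (conjT theta \* B2) (\- B1)).
Proof.
apply/seteqP; split=> f.
  move=> Kf; have [g [h [Hg Hh fg fh]]] := kerATTO_sub Kf.
  have [[[Lf _] _] _] := Kf; split; first exact: Lf.
  exists g => //; apply/kerSpP; split; first exact: Hg.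
  exists h; first exact: Hh.
  move: fg fh; apply: aeTS2 => z /= fz; rewrite fz mulrA => ->.
  by rewrite mulNr subrr.
move=> [Lf [g /kerSpP[Hg [h Hh e]] fg]].
apply: (kerATTO_sup (L2T_meas Lf) Hg Hh fg).
move: e fg; apply: aeTS2 => z /= e ->.
by rewrite mulrA; apply/eqP; rewrite -subr_eq0 -mulNr e.
Qed.

(** The functions g and h of [kerATTO_sub] can be multiplied by O2 and conj(O1) and
    by their inverses without leaving H^2_+ and H^2_-; so B2 and B1 may be replaced by
    their inner factors I2 and conj(I1). For f = I2 g the second condition then reads
    conj(theta) I1 I2 g in H^2_-. *)
Lemma kerATTOE_outer I1 O1 I2 O2 : inner I1 -> inner I2 ->
  eqT (conjT B1) (I1 \* O1) -> eqT B2 (I2 \* O2) -> GHinf O1 -> GHinf O2 ->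
  kerATTO theta alpha (symbol theta alpha A1 B1 A2 B2) =
  mulset I2 (kertoeplitz (conjT theta \* (I1 \* I2))).
Proof.
move=> hI1 hI2 eB1 eB2 [HO1 [Q1 HQ1 OQ1]] [HO2 [Q2 HQ2 OQ2]].
have Ls : LinfT (conjT theta \* (I1 \* I2)).
  apply: LinfTM; first exact/LinfTJ/inner_LinfT.
  by apply: LinfTM; exact: inner_LinfT.
have cHJ u : Hinf u -> cHinf (conjT u) by rewrite /cHinf /= conjTK.
have mth := measTJ (Hinf_meas (inner_Hinf htheta)).
have mI1 := Hinf_meas (inner_Hinf hI1); have mI2 := Hinf_meas (inner_Hinf hI2).
have B1E : eqT B1 (conjT (I1 \* O1)).
  by move: eB1; apply: aeTS => z; rewrite /conjT /= => <-; rewrite conjcK.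
apply/seteqP; split=> f.
  move=> Kf; have [g [h [Hg Hh fg fh]]] := kerATTO_sub Kf.
  have [[[Lf _] _] _] := Kf; split; first exact: Lf.
  have HOg := Hinf_mul_H2p HO2 Hg; have HOh := cHinf_mul_H2m (cHJ _ HO1) Hh.
  have fI : eqT f (I2 \* (O2 \* g)).
    by move: fg eB2; apply: aeTS2 => z -> /= ->; rewrite mulrA.
  exists (O2 \* g); last exact: fI.
  apply/(kertoeplitzP _ Ls); split; first exact: HOg.
  apply: H2m_eqT HOh.
    exact: measTM (measTM mth (measTM mI1 mI2)) (L2T_meas (H2p_L2T HOg)).
  have fh' : eqT (conjT theta \* f) (conjT (I1 \* O1) \* h).
    by move: fh B1E; apply: aeTS2 => z -> /= ->.
  move: fh' fI (inner_mulJ hI1); apply: aeTS3 => z /= e fz i1.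
  rewrite fz in e.
  transitivity (I1 z * (conjT theta z * (I2 z * (O2 z * g z)))); last by ring.
  by rewrite e /conjT /= conjM !mulrA i1 mul1r.
move=> [Lf [g' /(kertoeplitzP _ Ls)[Hg' Hh'] fg]].
have Hg := Hinf_mul_H2p HQ2 Hg'; have Hh := cHinf_mul_H2m (cHJ _ HQ1) Hh'.
apply: (kerATTO_sup (L2T_meas Lf) Hg Hh).
  move: fg eB2 OQ2; apply: aeTS3 => z /= -> -> e.
  transitivity (I2 z * (O2 z * Q2 z) * g' z); first by rewrite e mulr1.
  by ring.
have i1 : aeT (fun z => conjT (I1 \* O1) z * conjT Q1 z * I1 z = 1).
  move: OQ1 (inner_mulJ hI1); apply: aeTS2 => z /= e i1.
  rewrite /conjT /= -conjM -mulrA e mulr1 mulrC.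
  exact: i1.
move: fg B1E i1; apply: aeTS3 => z /= -> -> i.
transitivity (conjT (I1 \* O1) z * conjT Q1 z * I1 z *
  (conjT theta z * (I2 z * g' z))); first by rewrite i mul1r.
by ring.
Qed.

End Kernel.
End KernelATTO.

Theorem theorem4p14 (R : realType)
    (theta alpha A1 B1 A2 B2 : R[i] -> R[i])
    (htheta : inner theta) (halpha : inner alpha)
    (hCPp : CPp A2 B2) (hCPm : CPm A1 B1)
    (hB2 : ~ eqT B2 (cst 0)) (hB1 : ~ eqT B1 (cst 0))
    (hphi : LinfT (symbol theta alpha A1 B1 A2 B2))
    (hS : setS alpha A1 B1 A2 B2 = zeroT) :
  [/\ forall alpha' : R[i] -> R[i], inner alpha' ->
        LinfT (symbol theta alpha' A1 B1 A2 B2) ->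
        setS alpha' A1 B1 A2 B2 = zeroT ->
        kerATTO theta alpha' (symbol theta alpha' A1 B1 A2 B2) =
        kerATTO theta alpha (symbol theta alpha A1 B1 A2 B2),
      kerATTO theta alpha (symbol theta alpha A1 B1 A2 B2) =
        mulset B2 (kerSp (conjT theta \* B2) (\- B1)) &
      forall I1 O1 I2 O2 : R[i] -> R[i],
        inner I1 -> outer O1 -> inner I2 -> outer O2 ->
        eqT (conjT B1) (I1 \* O1) -> eqT B2 (I2 \* O2) ->
        GHinf O1 -> GHinf O2 ->
        kerATTO theta alpha (symbol theta alpha A1 B1 A2 B2) =
        mulset I2 (kertoeplitz (conjT theta \* (I1 \* I2)))].
Proof.
split=> [alpha' halpha' hphi' hS'||I1 O1 I2 O2 hI1 _ hI2 _ e1 e2 G1 G2].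
- by rewrite !kerATTOE.
- exact: kerATTOE.
- exact: kerATTOE_outer hI1 hI2 e1 e2 G1 G2.
Qed.
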